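(* Assuming the Exponential Time Hypothesis (ETH), there is no algorithm which, given a $4$-QBF instance $\phi$ with $n$ variables of which $k$ are existentially quantified, decides whether $\phi$ is true in time $2^{2^{o(k)}}\cdot n^{O(1)}$.
   Context: A $d$-QBF is a quantified Boolean formula in prenex form $\phi=(Q_1x_1)\dots(Q_nx_n)\psi$, where each $Q_i\in\{\exists,\forall\}$ (the order of the quantifiers is arbitrary, with any number of alternations) and the propositional matrix $\psi$ is in $d$-CNF, i.e. a conjunction of clauses each containing at most $d$ literals. The ETH is used in the form: 3-SAT on $n$ variables cannot be solved in time $2^{o(n)}$. *)

(* Defs.v *)
From mathcomp Require Import all_boot.

Set Implicit Arguments.
Unset Strict Implicit.
Unset Printing Implicit Defensive.

(* The literal (i, true) is x_i and (i, false) is its negation. *)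
Definition literal := (nat * bool)%type.
Definition clause := seq literal.
Definition cnf := seq clause.

(* Clauses and formulas are duplicate-free because they stand for sets.  For
   fixed d this bounds the input length by a polynomial in n; with unbounded
   repetitions no time bound in n alone could be met by any algorithm. *)
Definition is_dcnf (d n : nat) (F : cnf) : bool :=
  uniq F &&
  all (fun C : clause =>
         [&& uniq C, size C <= d & all (fun l : literal => l.1 < n) C]) F.

Definition cnf_eval (F : cnf) (s : seq bool) : bool :=
  all (fun C : clause => has (fun l : literal => nth false s l.1 == l.2) C) F.

Definition satisfiable (n : nat) (F : cnf) : bool :=
  [exists s : n.-tuple bool, cnf_eval F s].

Inductive quantifier := Exists | Forall.

Definition is_exists (q : quantifier) : bool :=
  if q is Exists then true else false.

(* The i-th quantifier of the prefix, counted from 0, binds x_i. *)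
Record qbf := QBF { qbf_prefix : seq quantifier; qbf_matrix : cnf }.

Definition nb_vars (phi : qbf) : nat := size (qbf_prefix phi).

Definition nb_exists (phi : qbf) : nat := count is_exists (qbf_prefix phi).

Definition is_dqbf (d : nat) (phi : qbf) : bool :=
  is_dcnf d (nb_vars phi) (qbf_matrix phi).

Fixpoint quantify (qs : seq quantifier) (psi : seq bool -> bool) : bool :=
  match qs with
  | [::] => psi [::]
  | q :: qs' =>
      let value b := quantify qs' (fun s => psi (b :: s)) in
      match q with
      | Exists => value false || value true
      | Forall => value false && value true
      end
  end.

Definition qbf_true (phi : qbf) : bool :=
  quantify (qbf_prefix phi) (cnf_eval (qbf_matrix phi)).

(* Instances are written as bit strings.  Indices are in unary, so an instance
   with n variables has length polynomial in n; all time bounds below are in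
   terms of n and k and are insensitive to a polynomial change of length. *)
Definition enc_nat (i : nat) : seq bool := rcons (nseq i true) false.

Definition enc_seq (T : Type) (enc : T -> seq bool) (s : seq T) : seq bool :=
  rcons (flatten [seq true :: enc x | x <- s]) false.

Definition enc_literal (l : literal) : seq bool := l.2 :: enc_nat l.1.

Definition enc_cnf (F : cnf) : seq bool := enc_seq (enc_seq enc_literal) F.

Definition enc_sat (n : nat) (F : cnf) : seq bool := enc_nat n ++ enc_cnf F.

Definition enc_qbf (phi : qbf) : seq bool :=
  enc_seq (fun q => [:: is_exists q]) (qbf_prefix phi) ++
  enc_cnf (qbf_matrix phi).

(* Algorithms are deterministic multi-tape Turing machines. *)
Inductive direction := Left | Stay | Right.

(* A two-way infinite tape: the cells on each side of the head are listed from
   the head outwards, and all cells beyond the lists are blank. *)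
Record tape (A : Type) :=
  Tape { tape_left : seq A; tape_head : A; tape_right : seq A }.

Definition tape_of (A : Type) (blank : A) (s : seq A) : tape A :=
  Tape [::] (head blank s) (behead s).

Definition tape_write (A : Type) (a : A) (t : tape A) : tape A :=
  Tape (tape_left t) a (tape_right t).

Definition tape_move (A : Type) (blank : A) (d : direction) (t : tape A) :
    tape A :=
  let: Tape l a r := t in
  match d with
  | Left => Tape (behead l) (head blank l) (a :: r)
  | Stay => t
  | Right => Tape (a :: l) (head blank r) (behead r)
  end.

(* There are tm_work + 1 tapes, tape 0 holding the input.  The value of
   tm_verdict is None on running states, and Some true or Some false on
   accepting or rejecting ones. *)
Record tm := TM {
  tm_state : finType;
  tm_symbol : finType;
  tm_work : nat;
  tm_blank : tm_symbol;
  tm_bit : bool -> tm_symbol;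
  tm_bit_inj : injective tm_bit;
  tm_bit_blank : forall b, tm_bit b != tm_blank;
  tm_start : tm_state;
  tm_verdict : tm_state -> option bool;
  tm_trans : tm_state -> {ffun 'I_tm_work.+1 -> tm_symbol} ->
             tm_state * {ffun 'I_tm_work.+1 -> tm_symbol * direction}
}.

Record config (M : tm) := Config {
  cfg_state : tm_state M;
  cfg_tapes : {ffun 'I_(tm_work M).+1 -> tape (tm_symbol M)}
}.

Definition tm_init (M : tm) (w : seq bool) : config M :=
  Config (tm_start M)
    [ffun i => tape_of (tm_blank M)
                 (if i == ord0 then [seq tm_bit M b | b <- w] else [::])].

Definition tm_step (M : tm) (c : config M) : config M :=
  if tm_verdict (cfg_state c) is Some _ then c else
  let: (q, act) :=
    tm_trans (cfg_state c) [ffun i => tape_head (cfg_tapes c i)] in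
  Config q
    [ffun i => tape_move (tm_blank M) (act i).2
                 (tape_write (act i).1 (cfg_tapes c i))].

(* Halting configurations are fixed by tm_step, so this says that M halts on w
   after at most t steps, with answer b. *)
Definition answers_within (M : tm) (w : seq bool) (t : nat) (b : bool) : Prop :=
  tm_verdict (cfg_state (iter t (@tm_step M) (tm_init M w))) = Some b.

(* f(n) = o(n).  Exponents are natural numbers: rounding a real-valued o(n) up
   to the next natural number leaves it o(n). *)
Definition is_little_o (f : nat -> nat) : Prop :=
  forall c : nat, exists N : nat, forall n : nat, N <= n -> c * f n <= n.

(* g(n) = n^O(1) *)
Definition is_poly_bounded (g : nat -> nat) : Prop :=
  exists c N : nat, forall n : nat, N <= n -> g n <= n ^ c.

Definition ETH : Prop :=
  ~ exists (M : tm) (f : nat -> nat),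
      is_little_o f /\
      forall (n : nat) (F : cnf), is_dcnf 3 n F ->
        answers_within M (enc_sat n F) (2 ^ f n) (satisfiable n F).

(* Main.v *)
Require Import Defs.
From mathcomp Require Import all_boot zify.

Set Implicit Arguments.
Unset Strict Implicit.
Unset Printing Implicit Defensive.

(* The instance of 3-SAT is turned into the question whether it is false: the
   universal player first chooses the assignment x, and the existential player
   must then name a clause falsified by x, giving its number in binary.  A
   clause of width 4 cannot test a whole number, so the universal player decodes
   numbers: after a number of 2^h bits has been chosen, it announces, for each
   of its two halves, the one-hot vector (of length 2^2^(h-1)) that represents
   this half.  A condition on a number is then a clause with one negated literal
   from each of the two vectors, which leaves room for two more literals.

   The universal player may cheat by setting a wrong entry of a vector.  To
   expose this the existential player names such an entry, with half as many
   bits as before; this number is decoded in turn, and so on down to a number of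
   one bit, which needs no decoding.  After the last move the existential player
   stands on one level, by setting a guard; only the clauses of this level
   matter, and it wins by standing on a level that was decoded honestly although
   the level above was not; at the top level it names a falsified clause instead
   of a wrong entry.  The guard also indicates a bit where the named entry
   differs from the half that it should represent.  Since the numbers of bits
   decrease geometrically, there are O(log n) existential variables in total,
   and a running time of 2^2^o(log n) = 2^(n^o(1)) on the formula contradicts
   the ETH.

   The reduction is computed by a Turing machine whose tapes are counters. *)

(** * Composition of machines *)

(** With O(log n) existential variables the existential player cannot hold an assignment, but it can
    hold the number of a clause; hence the falsity of the instance is asked, and the answer is
    reversed at the end. The vectors are affordable because they are universal: a half of 2^(h-1)
    bits needs 2^2^(h-1) entries, polynomially many in n since the top number has O(log n) bits. An
    entry is negated wherever its vector serves as a decoding, so leaving it unset gains nothing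
    there; it is positive only where an accused entry is required to be set. Hence only entries that
    are wrongly set must be exposed. The obstacle is that an accusation is made before one knows
    whether it will be decoded honestly itself. So the choice of a level is postponed to the guards,
    when all vectors are visible; below a cheated level there is always a clean one, as the lowest
    level has no vectors. The guard also tells which half is accused, which the named number does
    not contain. Rounding the number of bits up to a power of two costs only a polynomial in the
    width. *)

Section Routines.

Variables (sym : finType) (blank : sym) (k : nat).

Definition heads := {ffun 'I_k -> sym}.
Definition action := {ffun 'I_k -> sym * direction}.
Definition tapes := {ffun 'I_k -> tape sym}.

Definition read (T : tapes) : heads := [ffun i => tape_head (T i)].

Definition act_on (T : tapes) (a : action) : tapes :=
  [ffun i => tape_move blank (a i).2 (tape_write (a i).1 (T i))].

(* The control of a Turing machine with one exit, represented by None. *)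
Record routine := Routine {
  rt_state : finType;
  rt_start : rt_state;
  rt_trans : rt_state -> heads -> option rt_state * action
}.

Definition rt_step (m : routine) (c : option (rt_state m) * tapes) :=
  if c.1 is Some q then
    let: (o, a) := rt_trans q (read c.2) in (o, act_on c.2 a)
  else c.

(** The exit is absorbing, so [t] is only an upper bound on the running time and may be
    increased. *)
Definition halts_in (m : routine) t q (T T' : tapes) : Prop :=
  iter t (@rt_step m) (Some q, T) = (None, T').

Definition exec (m : routine) (T T' : tapes) (t : nat) : Prop :=
  halts_in t (rt_start m) T T'.

Lemma rt_step_exit (m : routine) t T :
  iter t (@rt_step m) (None, T) = (None, T).
Proof. by elim: t => //= t ->. Qed.

Lemma halts_inS (m : routine) t q T T' (r := @rt_trans m q (read T)) :
  halts_in t.+1 q T T' <->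
  if r.1 is Some q' then halts_in t q' (act_on T r.2) T' else act_on T r.2 = T'.
Proof.
rewrite /halts_in iterSr /rt_step /= -/r; case: r => [[q'|] a] //=.
by rewrite rt_step_exit; split=> [[]|->].
Qed.

Lemma halts_in_le (m : routine) t t' (q : rt_state m) T T' :
  t <= t' -> halts_in t q T T' -> halts_in t' q T T'.
Proof. by move=> /subnK <- e; rewrite /halts_in iterD e rt_step_exit. Qed.

Lemma exec_le (m : routine) T T' t t' :
  t <= t' -> exec m T T' t -> exec m T T' t'.
Proof. exact: halts_in_le. Qed.

Definition stay_act (h : heads) : action := [ffun i => (h i, Stay)].

Lemma act_on_stay T : act_on T (stay_act (read T)) = T.
Proof. by apply/ffunP => i; rewrite !ffunE /=; case: (T i). Qed.

Definition prim (f : heads -> action) : routine :=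
  @Routine unit tt (fun _ h => (None, f h)).

Lemma exec_prim f T : exec (prim f) T (act_on T (f (read T))) 1.
Proof. by []. Qed.

Definition seqr (m1 m2 : routine) : routine :=
  @Routine (rt_state m1 + rt_state m2)%type (inl (rt_start m1))
    (fun q h => match q with
     | inl q1 => let: (o, a) := rt_trans q1 h in
         (Some (if o is Some q1' then inl q1' else inr (rt_start m2)), a)
     | inr q2 => let: (o, a) := rt_trans q2 h in (omap inr o, a)
     end).

Lemma exec_seqr m1 m2 T T1 T2 t1 t2 :
  exec m1 T T1 t1 -> exec m2 T1 T2 t2 -> exec (seqr m1 m2) T T2 (t1 + t2).
Proof.
rewrite /exec => e1 e2.
have run2 t q S : halts_in t q S T2 -> @halts_in (seqr m1 m2) t (inr q) S T2.
  elim: t q S => // t IH q S; rewrite !halts_inS /=.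
  by case: (rt_trans q (read S)) => [[q'|] a] //=; apply: IH.
rewrite /=; elim: t1 (rt_start m1) T e1 => // t IH q S;
rewrite addSn !halts_inS /=.
case: (rt_trans q (read S)) => [[q'|] a] /=; first exact: IH.
by move=> ->; apply: halts_in_le (run2 _ _ _ e2); apply: leq_addl.
Qed.

Definition ifr (test : heads -> bool) (m1 m2 : routine) : routine :=
  @Routine (option (rt_state m1 + rt_state m2)%type) None
    (fun q h => match q with
     | None => (Some (Some (if test h then inl (rt_start m1)
                            else inr (rt_start m2))), stay_act h)
     | Some (inl q1) => let: (o, a) := rt_trans q1 h in
         (omap (fun q => Some (inl q)) o, a)
     | Some (inr q2) => let: (o, a) := rt_trans q2 h in
         (omap (fun q => Some (inr q)) o, a)
     end).

Lemma exec_ifr test m1 m2 T T' t :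
  (if test (read T) then exec m1 T T' t else exec m2 T T' t) ->
  exec (ifr test m1 m2) T T' t.+1.
Proof.
rewrite /exec halts_inS /= act_on_stay; case: (test _).
- elim: t (rt_start m1) T => // t IH q S; rewrite !halts_inS /=.
  by case: (rt_trans q (read S)) => [[q'|] a] //=; apply: IH.
- elim: t (rt_start m2) T => // t IH q S; rewrite !halts_inS /=.
  by case: (rt_trans q (read S)) => [[q'|] a] //=; apply: IH.
Qed.

Definition whiler (test : heads -> bool) (m : routine) : routine :=
  @Routine (option (rt_state m)) None
    (fun q h => match q with
     | None => (if test h then Some (Some (rt_start m)) else None, stay_act h)
     | Some q => let: (o, a) := rt_trans q h in (Some o, a)
     end).

Lemma exec_whiler_stop (test : heads -> bool) m T :
  ~~ test (read T) -> exec (whiler test m) T T 1.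
Proof. by move=> /negPf nt; rewrite /exec halts_inS /= nt act_on_stay. Qed.

Lemma exec_whiler_next (test : heads -> bool) m T T1 T2 t1 t2 :
  test (read T) -> exec m T T1 t1 -> exec (whiler test m) T1 T2 t2 ->
  exec (whiler test m) T T2 (t1 + t2).+1.
Proof.
rewrite /exec => et e1 e2; rewrite halts_inS /= et act_on_stay.
elim: t1 (rt_start m) {et} T e1 => // t IH q S; rewrite addSn !halts_inS /=.
case: (rt_trans q (read S)) => [[q'|] a] /=; first exact: IH.
by move=> ->; apply: halts_in_le e2; apply: leq_addl.
Qed.

End Routines.

(** * A reduction followed by a decision procedure with the opposite answer *)

Section ThenMachine.

Variables (M : tm) (r : nat).
Let k := r.+1 + (tm_work M).+1.
Variable m : routine (tm_symbol M) k.

Definition upper_tape (i : 'I_(tm_work M).+1) : 'I_k := rshift r.+1 i.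

(* Runs m, then M on the upper tapes, and negates the answer of M. *)
Definition then_not : tm :=
  @TM (rt_state m + tm_state M)%type (tm_symbol M) (r + (tm_work M).+1)
    (tm_blank M) (@tm_bit M) (@tm_bit_inj M) (@tm_bit_blank M)
    (inl (rt_start m))
    (fun q => if q is inr q then omap negb (tm_verdict q) else None)
    (fun q (h : {ffun 'I_k -> tm_symbol M}) => match q with
     | inl q => let: (o, a) := rt_trans q h in
         (if o is Some q' then inl q' else inr (tm_start M), a)
     | inr q => let: (q', a) := tm_trans q [ffun i => h (upper_tape i)] in
         (inr q', [ffun i => match split i with
                             | inl _ => (h i, Stay)
                             | inr j => a j end])
     end).

Definition upper_config q (T : tapes (tm_symbol M) k) : config M :=
  Config q [ffun i => T (upper_tape i)].

Lemma tm_step_upper q T : exists q' T',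
  tm_step (@Config then_not (inr q) T) = @Config then_not (inr q') T' /\
  upper_config q' T' = tm_step (upper_config q T).
Proof.
case e: (tm_verdict q) => [b|].
  by exists q, T; rewrite /tm_step /= e.
rewrite /tm_step /= e /=.
have -> : [ffun i => [ffun i0 => tape_head (T i0)] (upper_tape i)] =
          [ffun i => tape_head ([ffun i => T (upper_tape i)] i)].
  by apply/ffunP => i; rewrite !ffunE.
case: (tm_trans _ _) => [q' a]; eexists q', _; split; first reflexivity.
by congr Config; apply/ffunP => i; rewrite !ffunE /upper_tape (unsplitK (inr
  _)).
Qed.

Lemma then_not_upper t q (T : tapes (tm_symbol M) k) :
  tm_verdict (cfg_state (iter t (@tm_step then_not)
                           (@Config then_not (inr q) T))) =
  omap negb (tm_verdict (cfg_state (iter t (@tm_step M) (upper_config q T)))).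
Proof.
elim: t q T => // t IH q T; rewrite !iterSr.
by have [q' [T' [-> <-]]] := tm_step_upper q T.
Qed.

(** The exact moment [u] of the exit is extracted from the bound [t], because [M] starts to run
    right after it. *)
Lemma then_not_lower t q (T T' : tapes (tm_symbol M) k) :
  halts_in (tm_blank M) t q T T' -> exists2 u, u <= t &
  iter u (@tm_step then_not) (@Config then_not (inl q) T) =
    @Config then_not (inr (tm_start M)) T'.
Proof.
elim: t q T => // t IH q T; rewrite halts_inS => h.
have step : tm_step (@Config then_not (inl q) T) = @Config then_not
    (if (rt_trans q (read T)).1 is Some q' then inl q' else inr (tm_start M))
    (act_on (tm_blank M) T (rt_trans q (read T)).2).
  by rewrite /tm_step /= -/(read T); case: (rt_trans q (read T)) => [[]].
case: (rt_trans q (read T)).1 step h => [q'|] step h.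
  by case: (IH _ _ h) => u le_ut e; exists u.+1; rewrite // iterSr step.
by exists 1; rewrite //= step h.
Qed.

(** Only the upper tapes must look like an initial configuration: [M] does not see the lower ones,
    so the counters may be left in any state. *)
Lemma then_notP w w' t t' b (T : tapes (tm_symbol M) k) :
  exec (tm_blank M) m
    [ffun i => tape_of (tm_blank M)
       (if i == ord0 then [seq tm_bit M b | b <- w] else [::])] T t ->
  (forall i, T (upper_tape i) = cfg_tapes (tm_init M w') i) ->
  answers_within M w' t' b -> answers_within then_not w (t + t') (~~ b).
Proof.
move=> /then_not_lower[u le_ut e] eT ans; rewrite /answers_within.
(* The [t - u] spare steps are spent in the final configuration of [M], which is a fixed point. *)
rewrite -(subnKC le_ut) -addnA addnC iterD.
have -> : tm_init then_not w = Config (inl (rt_start m) : tm_state then_not)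
  [ffun i => tape_of (tm_blank M)
     (if i == ord0 then [seq tm_bit M b | b <- w] else [::])] by [].
rewrite e then_not_upper.
have -> : upper_config (tm_start M) T = tm_init M w'.
  by rewrite /upper_config /tm_init; congr Config; apply/ffunP => i;
     rewrite ffunE eT.
rewrite iterD.
have -> : iter (t - u) (@tm_step M) (iter t' (@tm_step M) (tm_init M w')) =
  iter t' (@tm_step M) (tm_init M w').
  elim: (t - u) => //= x ->; by rewrite /tm_step ans.
by rewrite ans.
Qed.

End ThenMachine.

(** * Counters *)

Record store := Store { regs : seq nat; input : seq bool; output : seq bool }.

Definition reg (s : store) (r : nat) : nat := nth 0 (regs s) r.

Definition upd (s : store) (r v : nat) : store :=
  Store (set_nth 0 (regs s) r v) (input s) (output s).

Lemma reg_upd s r v i : reg (upd s r v) i = if i == r then v else reg s i.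
Proof. by rewrite /reg nth_set_nth. Qed.

Lemma upd_upd s r v r' v' : upd (upd s r v) r' v' =
  if r == r' then upd s r' v' else upd (upd s r' v') r v.
Proof. by rewrite /upd /= set_set_nth; case: eqP. Qed.

Section Counters.

Variables (sym : finType) (blank : sym) (bit : bool -> sym).
Hypotheses (bit_inj : injective bit) (bit_blank : forall b, bit b != blank).
Variables (R w : nat).
Let k := R.+1 + w.+1.

Definition input_tape : 'I_k := lshift w.+1 ord0.
Definition reg_tape (r : 'I_R) : 'I_k := lshift w.+1 (lift ord0 r).
Definition output_tape : 'I_k := rshift R.+1 ord0.

(* The value of a counter is the distance of the head from a mark. *)
Definition counts (v : nat) (t : tape sym) : Prop :=
  tape_head t :: tape_left t = nseq v blank ++ [:: bit true] /\
  exists j, tape_right t = nseq j blank.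

(** The left part of the input tape is arbitrary, since that tape is only read rightwards. The upper
    tapes are described exactly, because they become the initial tapes of the next machine. *)
Definition holds (s : store) (T : tapes sym k) : Prop :=
  [/\ exists l, T input_tape =
        Tape l (head blank (map bit (input s))) (behead (map bit (input s))),
      forall r : 'I_R, counts (reg s r) (T (reg_tape r)),
      T output_tape = Tape [::] blank (map bit (output s))
    & forall i : 'I_w, T (rshift R.+1 (lift ord0 i)) = Tape [::] blank [::]].

Record triple (m : routine sym k) (s s' : store) (t : nat) : Prop := Triple {
  tripleE : forall T, holds s T -> exists2 T', exec blank m T T' t & holds s' T'
}.

Lemma triple_le m s s' t t' : t <= t' -> triple m s s' t -> triple m s s' t'.
Proof.
by move=> le_tt' [m_s]; split=> T /m_s[T' e h]; exists T' => //;
apply: exec_le e.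
Qed.

Lemma triple_seq m1 m2 s s1 s2 t1 t2 :
  triple m1 s s1 t1 -> triple m2 s1 s2 t2 ->
  triple (seqr m1 m2) s s2 (t1 + t2).
Proof.
move=> [h1] [h2]; split=> T /h1[T1 e1 /h2[T2 e2 ?]]; exists T2 => //.
exact: exec_seqr e1 e2.
Qed.

Definition act_at (i : 'I_k) (f : sym -> sym * direction) : routine sym k :=
  prim (fun h => [ffun j => if j == i then f (h i) else (h j, Stay)]).

Lemma exec_act_at i f (T : tapes sym k) : exists2 T', exec blank (act_at i f) T
  T' 1 &
  T' i = tape_move blank (f (tape_head (T i))).2
           (tape_write (f (tape_head (T i))).1 (T i)) /\
  forall j, j != i -> T' j = T j.
Proof.
eexists; first exact: exec_prim; split=> [|j /negPf ne].
  by rewrite !ffunE eqxx.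
by rewrite !ffunE ne /=; case: (T j).
Qed.

Definition inc (r : 'I_R) := act_at (reg_tape r) (fun a => (a, Right)).
Definition dec (r : 'I_R) := act_at (reg_tape r) (fun a => (a, Left)).
Definition out (b : bool) := act_at output_tape (fun a => (bit b, Left)).
(* The head stays on the first symbol, so that the tape is exactly the input
   tape of the next machine. *)
Definition out_last (b : bool) := act_at output_tape (fun a => (bit b, Stay)).
Definition advance := act_at input_tape (fun a => (a, Right)).

Lemma tape_neq :
  ((forall r, input_tape != reg_tape r) * (input_tape != output_tape) *
   (forall r, reg_tape r != input_tape) * (forall r, reg_tape r != output_tape)
     *
   (output_tape != input_tape) * (forall r, output_tape != reg_tape r)) *
  forall i : 'I_w, let o := rshift R.+1 (lift ord0 i) : 'I_k in
  (o != input_tape) * (forall r, o != reg_tape r) * (o != output_tape).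
Proof.
by do !split; rewrite //= => *;
  rewrite (eq_lshift, eq_rshift, eq_lrshift, eq_rlshift).
Qed.

Lemma reg_tape_eq r r' : (reg_tape r == reg_tape r') = (r == r').
Proof. by rewrite /reg_tape eq_lshift (inj_eq lift_inj). Qed.

Lemma triple_reg (r : 'I_R) f s v :
  (forall t, counts (reg s r) t -> counts v
     (tape_move blank (f (tape_head t)).2 (tape_write (f (tape_head t)).1 t)))
       ->
  triple (act_at (reg_tape r) f) s (upd s r v) 1.
Proof.
move=> hf; split=> T [hi hr ho hw]; have [T' e [e1 e2]] := exec_act_at
  (reg_tape r) f T.
exists T' => //; split=> [|r'||i]; try by rewrite e2 ?tape_neq //; apply: hr.
rewrite reg_upd val_eqE; have [->|ne] := eqVneq r' r.
  by rewrite e1; apply: hf.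
by rewrite e2 ?reg_tape_eq // ne.
Qed.

Lemma triple_inc (r : 'I_R) s : triple (inc r) s (upd s r (reg s r).+1) 1.
Proof.
apply: triple_reg => -[l a t] [/= el [j ->]]; split => /=.
  by rewrite el; case: j.
by case: j => [|j]; [exists 0 | exists j].
Qed.

Lemma triple_dec (r : 'I_R) s : 0 < reg s r -> triple (dec r) s (upd s r (reg s
  r).-1) 1.
Proof.
case e: (reg s r) => [//|v] _.
apply: triple_reg => -[l a t] [/=]; rewrite e => -[-> ->] [j ->].
split; last by exists j.+1.
by case: v {e}.
Qed.

Lemma triple_out b s :
  triple (out b) s (Store (regs s) (input s) (b :: output s)) 1.
Proof.
split=> T [hi hr ho hw]; have [T' e [e1 e2]] := exec_act_at output_tape (fun=>
  (bit b, Left)) T.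
exists T' => //; split=> [|r'||i]; try by rewrite e2 ?tape_neq //; apply: hr.
by rewrite e1 ho.
Qed.

Lemma triple_advance s :
  triple advance s (Store (regs s) (behead (input s)) (output s)) 1.
Proof.
split=> T [hi hr ho hw]; have [T' e [e1 e2]] := exec_act_at input_tape (fun a
  => (a, Right)) T.
exists T' => //; split=> [|r'||i]; try by rewrite e2 ?tape_neq //; apply: hr.
by have [l] := hi; rewrite e1 => -> /=; eexists; rewrite behead_map;
reflexivity.
Qed.

Lemma exec_out_last b s T : holds s T ->
  exists2 T', exec blank (out_last b) T T' 1 & forall i,
  T' (rshift R.+1 i) =
    tape_of blank (if i == ord0 then map bit (b :: output s) else [::]).
Proof.
move=> [hi hr ho hw]; have [T' e [e1 e2]] := exec_act_at output_tape (fun=>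
  (bit b, Stay)) T.
exists T' => // i; case: (unliftP ord0 i) => [j|] -> /=.
  by rewrite e2 ?tape_neq.
by rewrite e1 ho.
Qed.

Definition while_pos (r : 'I_R) := whiler (fun h : heads sym k => h (reg_tape
  r) != bit true).

Lemma pos_test (r : 'I_R) s T : holds s T ->
  (read T (reg_tape r) != bit true) = (0 < reg s r).
Proof.
move=> [_ /(_ r)[+ _] _ _]; rewrite ffunE; case: (reg s r) => [|v] [-> _].
  by rewrite eqxx.
by rewrite eq_sym bit_blank.
Qed.

Lemma triple_while (r : 'I_R) m n (s : nat -> store) t :
  (forall i, i < n -> 0 < reg (s i) r) -> reg (s n) r = 0 ->
  (forall i, i < n -> triple m (s i) (s i.+1) t) ->
  triple (while_pos r m) (s 0) (s n) (n * t.+1).+1.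
Proof.
elim: n s => [|n IH] s pos nil body; split=> T hT.
  by exists T => //; apply: exec_whiler_stop; rewrite (pos_test _ hT) nil.
have [T1 e1 h1] := tripleE (body 0 isT) hT.
have [T2 e2 h2] := tripleE (IH (fun i => s i.+1) (fun i => pos i.+1) nil
  (fun i => body i.+1)) h1.
exists T2 => //.
rewrite mulSn addSn -addnS; apply: exec_whiler_next e1 e2.
by rewrite (pos_test _ hT) pos.
Qed.

Definition while_input :=
  whiler (fun h : heads sym k => h input_tape == bit true).

Definition if_input :=
  ifr (fun h : heads sym k => h input_tape == bit true).

Lemma input_test s T : holds s T ->
  (read T input_tape == bit true) = head false (input s).
Proof.
move=> [[l e] _ _ _]; rewrite ffunE e /=; case: (input s) => [|b u] /=.
  by rewrite eq_sym (negPf (bit_blank _)).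
by rewrite (inj_eq bit_inj) eqb_id.
Qed.

Lemma triple_while_input m n (s : nat -> store) t :
  (forall i, i < n -> head false (input (s i))) -> ~~ head false (input (s n))
    ->
  (forall i, i < n -> triple m (s i) (s i.+1) t) ->
  triple (while_input m) (s 0) (s n) (n * t.+1).+1.
Proof.
elim: n s => [|n IH] s pos nil body; split=> T hT.
  by exists T => //; apply: exec_whiler_stop; rewrite (input_test hT).
have [T1 e1 h1] := tripleE (body 0 isT) hT.
have [T2 e2 h2] := tripleE (IH (fun i => s i.+1) (fun i => pos i.+1) nil
  (fun i => body i.+1)) h1.
exists T2 => //.
rewrite mulSn addSn -addnS; apply: exec_whiler_next e1 e2.
by rewrite (input_test hT) pos.
Qed.

Lemma triple_if_input m1 m2 s s' t :
  triple (if head false (input s) then m1 else m2) s s' t ->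
  triple (if_input m1 m2) s s' t.+1.
Proof.
move=> [h]; split=> T hT; have [T' e hT'] := h T hT; exists T' => //.
by apply: exec_ifr; rewrite (input_test hT); case: ifP e.
Qed.

(** Counting [r] down destroys it, so [i] collects the iterations and the second loop gives them
    back. Meanwhile the body finds the index of its iteration in [i]. *)
Definition for_ (i r : 'I_R) (m : routine sym k) : routine sym k :=
  seqr (while_pos r (seqr m (seqr (dec r) (inc i))))
       (while_pos i (seqr (dec i) (inc r))).

(** The equation on [s j] says at once that [r] holds [n], that [i] holds 0 and that both counters
    exist; so [s] describes the loop as if it never touched them. *)
Lemma triple_for (i r : 'I_R) m n (s : nat -> store) t : i != r ->
  (forall j, j <= n -> upd (upd (s j) r n) i 0 = s j) ->
  (forall j, j < n -> triple m (upd (upd (s j) r (n - j)) i j)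
                              (upd (upd (s j.+1) r (n - j)) i j) t) ->
  triple (for_ i r m) (s 0) (s n) (n * (t + 6) + 2).
Proof.
move=> ne_ir fixs body.
have ne : (i == r :> nat) = false by apply/negbTE.
have ne' : (r == i :> nat) = false by rewrite eq_sym.
have -> : n * (t + 6) + 2 = (n * (t + 2).+1).+1 + (n * 3).+1 by lia.
rewrite -[s 0]fixs // -[s n]fixs //.
apply: (@triple_seq _ _ _ (upd (upd (s n) r 0) i n)).
  pose s' j := upd (upd (s j) r (n - j)) i j.
  have -> : upd (upd (s 0) r n) i 0 = s' 0 by rewrite /s' subn0.
  have -> : upd (upd (s n) r 0) i n = s' n by rewrite /s' subnn.
  apply: (triple_while (s := s')) => [j lt_jn||j lt_jn]; rewrite /s'.
  - by rewrite !reg_upd eqxx ne' subn_gt0.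
  - by rewrite !reg_upd eqxx ne' subnn.
  - apply: triple_seq (body _ lt_jn) _.
    have := triple_dec (r := r) (s := upd (upd (s j.+1) r (n - j)) i j).
    rewrite !reg_upd ne' eqxx (upd_upd _ i _ r) ne (upd_upd _ r _ r) eqxx.
      rewrite subn_gt0 => /(_ lt_jn).
    move=> h; apply: triple_seq h _.
    have := @triple_inc i (upd (upd (s j.+1) r (n - j).-1) i j).
    by rewrite !reg_upd eqxx (upd_upd _ i _ i) eqxx subnS.
pose s' j := upd (upd (s n) r j) i (n - j).
have -> : upd (upd (s n) r 0) i n = s' 0 by rewrite /s' subn0.
have -> : upd (upd (s n) r n) i 0 = s' n by rewrite /s' subnn.
apply: (triple_while (s := s')) => [j lt_jn||j lt_jn]; rewrite /s'.
- by rewrite !reg_upd eqxx subn_gt0.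
- by rewrite !reg_upd eqxx subnn.
- have := triple_dec (r := i) (s := upd (upd (s n) r j) i (n - j)).
  rewrite !reg_upd eqxx (upd_upd _ i _ i) eqxx subn_gt0 => /(_ lt_jn).
  move=> h; apply: triple_seq h _.
  have := @triple_inc r (upd (upd (s n) r j) i (n - j).-1).
  by rewrite !reg_upd eqxx ne' (upd_upd _ i _ r) ne (upd_upd _ r _ r) eqxx
    subnS.
Qed.

(** A blank tape is not yet a counter, since zero is recognised by the mark under the head. *)
Definition mark_regs : routine sym k :=
  prim (fun h => [ffun j : 'I_k => if (0 < j) && (j <= R) then (bit true, Stay)
                            else (h j, Stay)]).

Lemma exec_mark_regs u : exists2 T', exec blank mark_regs
    [ffun i => tape_of blank (if i == ord0 then map bit u else [::])] T' 1 &
  holds (Store (nseq R 0) u [::]) T'.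
Proof.
eexists; first exact: exec_prim; split=> [|r||i]; rewrite !ffunE /=.
- by eexists; reflexivity.
- have -> : bump 0 r <= R by rewrite /bump add1n ltn_ord.
  by rewrite /reg nth_nseq if_same; split; last by exists 0.
- by rewrite addn0 ltnn.
- by rewrite addSn ltnNge leq_addr.
Qed.

End Counters.

Arguments triple_inc {sym blank bit R w} r s.
Arguments triple_dec {sym blank bit R w} r s _.
Arguments triple_out {sym blank bit R w} b s.
Arguments triple_advance {sym blank bit R w} s.

(** * Strategies and bits *)

(** A strategy is a function of the history. After a first move [b] the same strategy is
    [fun p => sigma (b :: p)], which drives the induction. *)
Lemma quantify_strategy qs (psi : seq bool -> bool) (sigma : seq bool -> bool) :
  (forall s, size s = size qs ->
     (forall i, i < size qs -> nth Forall qs i = Exists ->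
        nth false s i = sigma (take i s)) -> psi s) ->
  quantify qs psi.
Proof.
elim: qs psi sigma => [|q qs IH] psi sigma win /=; first exact: win.
have play b : (q = Exists -> b = sigma [::]) ->
    quantify qs (fun s => psi (b :: s)).
  move=> eb; apply: (IH _ (fun p => sigma (b :: p))) => s ss follow.
  by apply: win => [|[|i]] /=; rewrite ?ss //; apply: follow.
case: q play {win} => play; last by rewrite !play.
by have := play (sigma [::]) (fun=> erefl); case: (sigma [::]) => ->;
rewrite ?orbT.
Qed.

Definition dual (q : quantifier) : quantifier :=
  if q is Exists then Forall else Exists.

Lemma quantify_dual qs psi :
  ~~ quantify qs psi = quantify (map dual qs) (fun s => ~~ psi s).
Proof.
elim: qs psi => //= -[] qs IH psi.
- by rewrite negb_or !IH.
- by rewrite negb_and !IH.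
Qed.

Lemma quantify_refute qs (psi : seq bool -> bool) (sigma : seq bool -> bool) :
  (forall s, size s = size qs ->
     (forall i, i < size qs -> nth Forall qs i = Forall ->
        nth false s i = sigma (take i s)) -> ~~ psi s) ->
  ~~ quantify qs psi.
Proof.
move=> win; rewrite quantify_dual; apply: quantify_strategy (sigma) _ => s.
rewrite size_map => ss follow; apply: win => // i lt_i q_i.
by apply: follow; rewrite // (nth_map Forall) // q_i.
Qed.

Lemma nth_flatten_rows (T : Type) (x : T) (f : nat -> seq T) Z b m i j :
  (forall i, size (f i) = Z) -> i < m -> j < Z ->
  nth x (flatten [seq f i | i <- iota b m]) (i * Z + j) = nth x (f (b + i)) j.
Proof.
move=> size_f; elim: m b i => // m IH b [|i] lt_im lt_jZ /=.
  by rewrite nth_cat size_f lt_jZ addn0.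
rewrite nth_cat size_f mulSn -addnA ltnNge leq_addr /= addKn.
by rewrite IH // addSnnS.
Qed.

Definition bit (v u : nat) : bool := odd (v %/ 2 ^ u).

Lemma bit0 v : bit v 0 = odd v.
Proof. by rewrite /bit divn1. Qed.

Lemma bitS v u : bit v u.+1 = bit v./2 u.
Proof. by rewrite /bit expnS divnMA divn2. Qed.

Lemma bit_inj m v v' : v < 2 ^ m -> v' < 2 ^ m ->
  (forall u, u < m -> bit v u = bit v' u) -> v = v'.
Proof.
elim: m v v' => [|m IH] v v'; first by case: v v' => [|?] [|?].
rewrite expnS => lt_v lt_v' eqb.
have eq0 : odd v = odd v' by rewrite -!bit0 eqb.
rewrite -[v]odd_double_half -[v']odd_double_half eq0; congr (_ + _.*2).
by apply: IH => [||u lt_u]; [lia | lia | rewrite -!bitS eqb].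
Qed.

Lemma bit_exists m (f : nat -> bool) :
  exists2 v, v < 2 ^ m & forall u, u < m -> bit v u = f u.
Proof.
elim: m f => [|m IH] f; first by exists 0.
have [v lt_v vP] := IH (fun u => f u.+1); exists (f 0 + v.*2).
  by rewrite expnS; case: (f 0); lia.
case=> [|u] lt_u; first by rewrite bit0 oddD odd_double addbF oddb.
by rewrite bitS half_bit_double vP.
Qed.

Lemma bit_cat m v1 v2 u : v1 < 2 ^ m ->
  bit (v2 * 2 ^ m + v1) u = if u < m then bit v1 u else bit v2 (u - m).
Proof.
move=> lt_v1; rewrite /bit; case: ltnP => [lt_um|le_mu].
  rewrite -(subnK (ltnW lt_um)) expnD mulnA divnMDl ?expn_gt0 //.
  by rewrite oddD oddM oddX subn_eq0 leqNgt lt_um andbF.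
by rewrite -{1}(subnKC le_mu) expnD divnMA divnMDl ?expn_gt0 // (divn_small
  lt_v1) addn0.
Qed.

(** The number of values of [2 ^ h] bits, hence the length of a one-hot vector for them. *)
Definition dexp (h : nat) : nat := 2 ^ 2 ^ h.

Lemma dexp_gt0 h : 0 < dexp h. Proof. by rewrite expn_gt0. Qed.

Lemma dexpS h : dexp h.+1 = dexp h * dexp h.
Proof. by rewrite /dexp expnS mul2n -addnn expnD. Qed.

Lemma leq_dexp h h' : h <= h' -> dexp h <= dexp h'.
Proof. by move=> le_h; rewrite leq_exp2l // leq_exp2l. Qed.

Lemma all_flatten (T : Type) (a : pred T) ss :
  all a (flatten ss) = all (all a) ss.
Proof. by elim: ss => //= s ss IH; rewrite all_cat IH. Qed.

Lemma lt_dexp_pair h v1 v2 : 0 < h -> v1 < dexp h.-1 -> v2 < dexp h.-1 ->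
  v2 * dexp h.-1 + v1 < dexp h.
Proof.
case: h => // h _ lt_v1 lt_v2; rewrite dexpS.
apply: (@leq_trans (v2.+1 * dexp h)); first by rewrite mulSn addnC ltn_add2r.
by rewrite leq_mul2r lt_v2 orbT.
Qed.

(** * The formula *)

Lemma all_iotaP (P : pred nat) a m :
  reflect (forall i, a <= i < a + m -> P i) (all P (iota a m)).
Proof.
by apply: (iffP allP) => h i; have := h i; rewrite mem_iota.
Qed.

Section Reduction.

Variables (n c : nat) (F : cnf).

Definition height : nat := c.+1.
Definition width : nat := dexp height.
Definition nb_guards : nat := 2 * 2 ^ height.

(* The prefix consists of rows of equal length, padded with universal variables.
   Row 0 holds the variables of the 3-CNF.  It is followed, for each level h
   from the top one down to 0, by a row e_h for the bits of a number, at the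
   offsets 2 ^ h to 2 ^ h.+1 - 1, and by two rows r_h for the one-hot vectors of
   its two halves (there are none for h = 0).  The last two rows hold the guards
   and the variables c_i, which say that some guard of index at least i is set. *)
Definition cell_var (row off : nat) : nat := row * width + off.
Definition e_var (h u : nat) : nat := cell_var (3 * (height - h) + 1) u.
Definition r_var (h side v : nat) : nat := cell_var (3 * (height - h) + 2 +
  side) v.
Definition g_var (i : nat) : nat := cell_var (3 * height + 2) i.
Definition c_var (i : nat) : nat := cell_var (3 * height + 3) i.

Definition nb_rows : nat := 3 * height + 4.

(** The existential variables fill a row from offset 0 although the bits of level [h] start at
    offset [2 ^ h]. The idle half only doubles their number, and it lets a bit and its guard have
    the same offset. *)
Definition row_exists (row : nat) : nat :=
  if row == 0 then 0
  else if 3 * height + 2 <= row then nb_guards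
  else if row %% 3 == 1 then 2 * 2 ^ (height - row %/ 3) else 0.

Definition row_prefix (k : nat) : seq quantifier :=
  nseq k Exists ++ nseq (width - k) Forall.

Definition red_prefix : seq quantifier :=
  flatten [seq row_prefix (row_exists row) | row <- iota 0 nb_rows].

(* The guard for bit t of the given half of the number of level h.+1 has the
   same offset as this bit; guard 1 is the one of the top level. *)
Definition guard_index (h side t : nat) : nat := 2 ^ h.+1 + side * 2 ^ h + t.

Definition diff_clauses (h side t : nat) : cnf :=
  let g := guard_index h side t in
  [:: [:: (g_var g, false); (e_var h (2 ^ h + t), true); (e_var h.+1 g, true)];
      [:: (g_var g, false); (e_var h (2 ^ h + t), false);
      (e_var h.+1 g, false)]].

(** The entry named at level 0 is a single bit, so a case distinction on it replaces the
    decoding. *)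
Definition base_clauses (side : nat) : cnf :=
  let g := guard_index 0 side 0 in
  diff_clauses 0 side 0 ++
  [:: [:: (g_var g, false); (e_var 0 1, true); (r_var 1 side 0, true)];
      [:: (g_var g, false); (e_var 0 1, false); (r_var 1 side 1, true)]].

(** If [v1] and [v2] are the decoded halves of the named entry, this entry must be set in the vector
    above. The implication concerns [t] only through its guard; it is repeated for every [t] because
    any guard of the level activates it. *)
Definition level_clauses (h side t : nat) : cnf :=
  let g := guard_index h side t in
  diff_clauses h side t ++
  flatten [seq [seq [:: (g_var g, false); (r_var h 0 v1, false);
                       (r_var h 1 v2, false);
                       (r_var h.+1 side (v2 * dexp h.-1 + v1), true)]
               | v1 <- iota 0 (dexp h.-1)] | v2 <- iota 0 (dexp h.-1)].

(* The last of the c_i is universal, hence may be taken to be false. *)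
Definition chain_clause (i : nat) : clause :=
  [:: (c_var i, false); (g_var i, true); (c_var i.+1, true)].

(* The top number has only a first half, which is the number of a clause. *)
Definition top_clauses (j : nat) : cnf :=
  if j < size F then
    [seq [:: (g_var 1, false); (r_var height 0 j, false); (l.1, ~~ l.2)]
    | l : literal <- nth [::] F j]
  else [:: [:: (g_var 1, false); (r_var height 0 j, false)]].

Definition emitted : cnf :=
  flatten [seq base_clauses side | side <- iota 0 2] ++
  flatten [seq flatten [seq flatten [seq level_clauses h side t
    | t <- iota 0 (2 ^ h)] | side <- iota 0 2] | h <- iota 1 c] ++
  [:: [:: (c_var 1, true)]] ++
  [seq chain_clause i | i <- iota 0 nb_guards] ++
  flatten [seq top_clauses j | j <- iota 0 (dexp c)].

Definition red_qbf : qbf := QBF red_prefix (rev emitted).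

(** The nested lists are taken apart once, both for the truth and for the format of the clauses. *)
Lemma all_emittedP (P : pred clause) : reflect
  [/\ forall side, side < 2 -> all P (base_clauses side),
      forall h side t, 0 < h <= c -> side < 2 -> t < 2 ^ h ->
        all P (level_clauses h side t),
      P [:: (c_var 1, true)],
      forall i, i < nb_guards -> P (chain_clause i)
    & forall j, j < dexp c -> all P (top_clauses j)]
  (all P emitted).
Proof.
have all_cat5 a (s1 s2 s3 s4 s5 : cnf) : all a (s1 ++ s2 ++ s3 ++ s4 ++ s5) =
    [&& all a s1, all a s2, all a s3, all a s4 & all a s5] by rewrite !all_cat.
rewrite /emitted all_cat5 !all_flatten !all_map.
apply: (iffP and5P) => -[base level unit chain top]; split.
- by move=> side; apply: (elimT (all_iotaP _ _ _) base side).
- move=> h side t; rewrite -[h <= c]ltnS => lt_h lt_side lt_t.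
  have : all P (flatten [seq flatten [seq level_clauses h side t
      | t <- iota 0 (2 ^ h)] | side <- iota 0 2]) := elimT (all_iotaP _ _ _)
        level h lt_h.
  rewrite all_flatten all_map => /all_iotaP/(_ side lt_side) level_h.
  have : all P (flatten [seq level_clauses h side t | t <- iota 0 (2 ^ h)]) :=
    level_h.
  by rewrite all_flatten all_map => /all_iotaP/(_ t lt_t).
- by move: unit; rewrite /= andbT.
- by move=> i; apply: (elimT (all_iotaP _ _ _) chain i).
- by move=> j; apply: (elimT (all_iotaP _ _ _) top j).
- by apply/all_iotaP => side; apply: base.
- apply/all_iotaP => h; rewrite add1n ltnS => lt_h.
  suff : all P (flatten [seq flatten [seq level_clauses h side t
      | t <- iota 0 (2 ^ h)] | side <- iota 0 2]) by [].
  rewrite all_flatten all_map; apply/all_iotaP => side lt_side.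
  suff : all P (flatten [seq level_clauses h side t | t <- iota 0 (2 ^ h)]) by
    [].
  by rewrite all_flatten all_map; apply/all_iotaP => t lt_t; apply: level.
- by rewrite /= unit.
- by apply/all_iotaP => i; apply: chain.
- by apply/all_iotaP => j; apply: top.
Qed.

Section Assignment.

Variable s : seq bool.

Let val := nth false s.

(** Says that [v] is the right entry for this half of the number of level [h.+1]. *)
Definition bits_match (h side v : nat) : bool :=
  all (fun u => val (e_var h.+1 (guard_index h side u)) == bit v u)
      (iota 0 (2 ^ h)).

(** The meaning of the clauses, against which both strategies are checked. *)
Record constraints : Prop := Constraints {
  diff_holds : forall h side t, h <= c -> side < 2 -> t < 2 ^ h ->
    val (g_var (guard_index h side t)) ->
    val (e_var h (2 ^ h + t)) != val (e_var h.+1 (guard_index h side t));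
  base_holds : forall side, side < 2 -> val (g_var (guard_index 0 side 0)) ->
    val (r_var 1 side (val (e_var 0 1)));
  level_holds : forall h side t v1 v2, 0 < h <= c -> side < 2 -> t < 2 ^ h ->
    v1 < dexp h.-1 -> v2 < dexp h.-1 -> val (g_var (guard_index h side t)) ->
    val (r_var h 0 v1) -> val (r_var h 1 v2) ->
    val (r_var h.+1 side (v2 * dexp h.-1 + v1));
  chain_start : val (c_var 1);
  chain_holds : forall i, i < nb_guards -> val (c_var i) ->
    val (g_var i) || val (c_var i.+1);
  top_clause_holds : forall j l, j < dexp c -> j < size F ->
    l \in nth [::] F j -> val (g_var 1) -> val (r_var height 0 j) ->
    val l.1 != l.2;
  top_default_holds : forall j, j < dexp c -> size F <= j ->
    val (g_var 1) -> ~~ val (r_var height 0 j)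
}.

Lemma cnf_evalP : reflect constraints (cnf_eval (rev emitted) s).
Proof.
pose sat (C : clause) := has (fun l : literal => val l.1 == l.2) C.
rewrite /cnf_eval all_rev; apply: (iffP (all_emittedP sat)).
- case=> base level + chain top; rewrite /sat /= orbF eqb_id => unit.
  have diff h side t : h <= c -> side < 2 -> t < 2 ^ h ->
      all sat (diff_clauses h side t).
    case: h => [|h] lt_h lt_side.
      by case: t => // _; have := base side lt_side; rewrite all_cat => /andP[].
    by move=> lt_t; have := level h.+1 side t lt_h lt_side lt_t;
       rewrite all_cat => /andP[].
  split=> //.
  + move=> h side t lt_h lt_side lt_t; have := diff h side t lt_h lt_side lt_t.
    rewrite /= !orbF => /andP[+ /andP[+ _]].
    by case: (val (g_var _)); case: (val (e_var h _));
    case: (val (e_var h.+1 _)).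
  + move=> side lt_side gt; have := base side lt_side.
    rewrite /base_clauses all_cat => /andP[_] /=.
    rewrite -/val gt !orbF /=; case: (val (e_var 0 1)) => /=.
      by rewrite andbT => /eqP.
    by rewrite andbT => /eqP.
  + move=> h side t v1 v2 lt_h lt_side lt_t lt_v1 lt_v2 gt r1 r2.
    have := level h side t lt_h lt_side lt_t.
    rewrite all_cat => /andP[_]; rewrite all_flatten all_map.
    move=> /all_iotaP/(_ v2 lt_v2) /=; rewrite all_map.
    move=> /all_iotaP/(_ v1 lt_v1) /=.
    by rewrite -/val gt r1 r2 /= orbF => /eqP.
  + move=> i lt_i ct; have := chain i lt_i; rewrite /= -/val ct /= orbF.
    by rewrite !eqb_id.
  + move=> j l lt_j lt_jF l_in gt rt.
    have : all sat (top_clauses j) := top j lt_j.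
    rewrite /top_clauses lt_jF all_map => /allP/(_ l l_in) /=.
    by rewrite -/val gt rt /= orbF; case: (val l.1); case: l.2.
  + move=> j lt_j le_Fj gt.
    have : all sat (top_clauses j) := top j lt_j.
    rewrite /top_clauses ltnNge le_Fj /= -/val gt orbF andbT /=.
    by case: (val _).
- case=> diff base level unit chain top deflt.
  have diffs h side t : h <= c -> side < 2 -> t < 2 ^ h ->
      all sat (diff_clauses h side t).
    move=> lt_h lt_side lt_t; have := diff h side t lt_h lt_side lt_t.
    rewrite /=; case: (val (g_var _)) => //= /(_ isT).
    by case: (val (e_var h _)); case: (val (e_var h.+1 _)).
  split.
  + move=> side lt_side; rewrite all_cat diffs //=.
    rewrite -/val; have := base side lt_side; case: (val (g_var _)) => //=.
    by case: (val (e_var 0 1)) => /(_ isT) ->.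
  + move=> h side t lt_h lt_side lt_t.
    rewrite all_cat diffs //=; last by case/andP: lt_h.
    rewrite all_flatten all_map; apply/all_iotaP => v2 lt_v2 /=.
    rewrite all_map; apply/all_iotaP => v1 lt_v1 /=.
    have := level h side t v1 v2 lt_h lt_side lt_t lt_v1 lt_v2.
    rewrite -/val; case: (val (g_var _)) => //= /(_ isT).
    case: (val (r_var h 0 _)) => //= /(_ isT).
    by case: (val (r_var h 1 _)) => //= /(_ isT) ->.
  + by rewrite /= -/val unit.
  + move=> i lt_i; have := chain i lt_i; rewrite /= -/val.
    case: (val (c_var i)) => //= /(_ isT).
    by case: (val (g_var i)) => //= ->.
  + move=> j lt_j; rewrite /top_clauses.
    case: ltnP => [lt_jF|le_Fj]; rewrite ?all_map.
      apply/allP => l l_in; have := top j l lt_j lt_jF l_in.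
      rewrite /= -/val; case: (val (g_var 1)) => //= /(_ isT).
      by case: (val (r_var _ _ _)) => //= /(_ isT); case: (val l.1); case: l.2.
    have := deflt j lt_j le_Fj; rewrite /= -/val.
    by case: (val (g_var 1)) => //= /(_ isT) /negPf ->.
Qed.

End Assignment.

End Reduction.

(** * The game *)

Lemma size_flatten_rows (A : Type) (f : nat -> seq A) z b m :
  (forall i, size (f i) = z) -> size (flatten [seq f i | i <- iota b m]) = m *
    z.
Proof.
by move=> sf; elim: m b => //= m IH b; rewrite size_cat IH sf.
Qed.

(** * Arithmetic of rows, offsets and guard indices *)

Section Layout.

Variable c : nat.

Local Notation H := (height c).
Local Notation Z := (width c).
Local Notation T := (nb_guards c).
Local Notation cell := (cell_var c).
Local Notation e_var := (e_var c).
Local Notation r_var := (r_var c).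
Local Notation g_var := (g_var c).
Local Notation c_var := (c_var c).

Lemma width_gt0 : 0 < Z. Proof. exact: dexp_gt0. Qed.

Lemma leq_dexp_width h : h <= H -> dexp h <= Z.
Proof. exact: leq_dexp. Qed.

Lemma cell_div row off : off < Z -> cell row off %/ Z = row.
Proof. by move=> lt_off; rewrite divnMDl ?width_gt0 // divn_small ?addn0. Qed.

Lemma cell_mod row off : off < Z -> cell row off %% Z = off.
Proof. by move=> lt_off; rewrite modnMDl modn_small. Qed.

Lemma cell_ltn row row' off off' : row < row' -> off < Z -> cell row off < cell
  row' off'.
Proof.
move=> lt_row lt_off; rewrite /cell_var.
apply: (@leq_trans (row.+1 * Z)); first by rewrite mulSn addnC ltn_add2r.
by apply: leq_trans (leq_addr _ _); rewrite leq_mul2r lt_row orbT.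
Qed.

Lemma row_exists_e h : h <= H -> row_exists c (3 * (H - h) + 1) = 2 * 2 ^ h.
Proof.
move=> le_h; rewrite /row_exists ifF; last by lia.
rewrite ifF; last by lia.
rewrite ifT; last by lia.
by have -> : H - (3 * (H - h) + 1) %/ 3 = h by lia.
Qed.

Lemma row_exists_r h side : 0 < h <= H -> side < 2 ->
  row_exists c (3 * (H - h) + 2 + side) = 0.
Proof.
move=> le_h lt_side; rewrite /row_exists.
rewrite ifF; last by lia.
rewrite ifF; last by lia.
by rewrite ifF; last by lia.
Qed.

Lemma row_exists_g : row_exists c (3 * H + 2) = T.
Proof. by rewrite /row_exists addn2 /= leqnn. Qed.

Lemma row_exists_c : row_exists c (3 * H + 3) = T.
Proof. by rewrite /row_exists addn3 /= addn2 leqnSn. Qed.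

Lemma guard_index_lt h side t : side < 2 -> t < 2 ^ h ->
  guard_index h side t < 2 ^ h.+2.
Proof. by rewrite /guard_index !expnS; case: side => [|[|]] //; lia. Qed.

Lemma exp2_le h : h <= H -> 2 ^ h.+1 <= T.
Proof. by move=> le_h; rewrite /nb_guards expnS leq_mul2l leq_exp2l. Qed.

Lemma guard_index_width h side t : h <= c -> side < 2 -> t < 2 ^ h ->
  guard_index h side t < T.
Proof.
move=> le_h lt_side lt_t; apply: leq_trans (guard_index_lt lt_side lt_t) _.
exact: exp2_le.
Qed.

(** The guards of level [h] fill the interval from [2 ^ h.+1] to [2 ^ h.+2 - 1], so the binary
    logarithm of an index determines its level. *)
Definition guard_level (i : nat) : nat := (trunc_log 2 i).-1.

Definition guard_side (i : nat) : nat :=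
  2 ^ (guard_level i).+1 + 2 ^ guard_level i <= i.

Definition guard_bit (i : nat) : nat :=
  i - 2 ^ (guard_level i).+1 - guard_side i * 2 ^ guard_level i.

Lemma guard_indexK h side t : side < 2 -> t < 2 ^ h ->
  let i := guard_index h side t in
  [/\ guard_level i = h, guard_side i = side & guard_bit i = t].
Proof.
move=> lt_side lt_t i; have elog : trunc_log 2 i = h.+1.
  apply: trunc_log_eq => //; rewrite guard_index_lt // andbT.
  by rewrite /i /guard_index -addnA leq_addr.
have eh : guard_level i = h by rewrite /guard_level elog.
have es : guard_side i = side.
  rewrite /guard_side eh /i /guard_index -addnA leq_add2l.
  by case: side lt_side {i elog eh} => [|[|]] // _;
  rewrite ?mul1n ?leq_addr // add0n leqNgt lt_t.
by split=> //; rewrite /guard_bit es eh /i /guard_index; lia.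
Qed.

Lemma guard_indexP i : 1 < i < T -> exists h side t,
  [/\ h <= c, side < 2, t < 2 ^ h & i = guard_index h side t].
Proof.
case/andP=> gt1 lt_iT; have i_gt0 : 0 < i by lia.
have /andP[le_i gt_i] := trunc_log_bounds (isT : 1 < 2) i_gt0.
have log_gt0 : 0 < trunc_log 2 i by rewrite trunc_log_gt0.
have elog : trunc_log 2 i = (guard_level i).+1 by rewrite /guard_level prednK.
rewrite elog in le_i gt_i; exists (guard_level i), (guard_side i), (guard_bit
  i).
have le_c : guard_level i <= c.
  have : 2 ^ (guard_level i).+1 < 2 ^ c.+2.
    by apply: leq_ltn_trans le_i _; rewrite expnS.
  by rewrite ltn_exp2l.
rewrite /guard_bit /guard_index /guard_side.
move: le_i gt_i; rewrite !expnS; case: leqP => //= h1 h2 h3; split=> //; lia.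
Qed.

Hypothesis c_gt0 : 0 < c.

Lemma lt_guards_width : T < Z.
Proof.
rewrite /nb_guards /width /dexp -expnS ltn_exp2l // /height expnS.
by have := ltn_expl c (isT : 1 < 2); lia.
Qed.

Lemma row_exists_le row : row_exists c row <= Z.
Proof.
apply: leq_trans (ltnW lt_guards_width); rewrite /row_exists.
case: ifP => // _; case: ifP => // _; case: ifP => // _.
by rewrite leq_mul2l leq_exp2l // leq_subr.
Qed.

Lemma size_row_prefix row : size (row_prefix c (row_exists c row)) = Z.
Proof. by rewrite size_cat !size_nseq subnKC ?row_exists_le. Qed.

Lemma size_red_prefix : size (red_prefix c) = nb_rows c * Z.
Proof. exact: size_flatten_rows size_row_prefix. Qed.

Lemma cell_lt row off : row < nb_rows c -> off < Z -> cell row off < size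
  (red_prefix c).
Proof.
move=> lt_row lt_off; rewrite size_red_prefix /cell_var.
apply: (@leq_trans (row.+1 * Z)); first by rewrite mulSn addnC ltn_add2r.
by rewrite leq_mul2r lt_row orbT.
Qed.

Lemma nth_red_prefix row off : row < nb_rows c -> off < Z ->
  nth Forall (red_prefix c) (cell row off) =
  if off < row_exists c row then Exists else Forall.
Proof.
move=> lt_row lt_off; rewrite (nth_flatten_rows _ _ size_row_prefix) //.
rewrite nth_cat !nth_nseq size_nseq add0n if_same.
by case: (off < _).
Qed.

End Layout.

Section Game.

Variables (n c : nat) (F : cnf).
Hypotheses (c_gt0 : 0 < c) (F_3cnf : is_dcnf 3 n F).
Hypotheses (le_n : n <= dexp c) (le_F : size F <= dexp c).

Local Notation H := (height c).
Local Notation Z := (width c).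
Local Notation T := (nb_guards c).
Local Notation cell := (cell_var c).
Local Notation e_var := (e_var c).
Local Notation r_var := (r_var c).
Local Notation g_var := (g_var c).
Local Notation c_var := (c_var c).

(** * The universal player wins on satisfiable instances *)

Section Refute.

Variable a : seq bool.
Hypothesis a_sat : cnf_eval F a.

(** On the last two rows [level] is 0 and the move is false; this makes the last chain variable
    false. The moves on padding are arbitrary. *)
Definition honest (p : seq bool) : bool :=
  let row := size p %/ Z in
  let level := H - (row - 2) %/ 3 in
  if row == 0 then nth false a (size p)
  else (0 < level) && bits_match c p level.-1 ((row - 2) %% 3) (size p %% Z).

Variable s : seq bool.
Hypothesis size_s : size s = size (red_prefix c).
Hypothesis s_honest : forall i, i < size (red_prefix c) ->
  nth Forall (red_prefix c) i = Forall -> nth false s i = honest (take i s).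

Let val := nth false s.

Lemma val_forall row off : row < nb_rows c -> row_exists c row <= off < Z ->
  val (cell row off) = honest (take (cell row off) s).
Proof.
move=> lt_row /andP[le_off lt_off]; apply: s_honest; first exact: cell_lt.
by rewrite nth_red_prefix // ltnNge le_off.
Qed.

Lemma size_take_cell row off : row < nb_rows c -> off < Z ->
  size (take (cell row off) s) = cell row off.
Proof. by move=> ? ?; rewrite size_takel // size_s ltnW // cell_lt. Qed.

Lemma val_x i : i < n -> val i = nth false a i.
Proof.
move=> lt_in; have lt_iZ : i < Z.
  by apply: leq_trans lt_in (leq_trans le_n (leq_dexp_width _)).
have := @val_forall 0 i isT; rewrite /row_exists eqxx lt_iZ => /(_ isT).
rewrite /honest size_take_cell // (cell_div _ lt_iZ) eqxx.
by rewrite /cell_var mul0n.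
Qed.

(** The number decoded here stands in an earlier row, so the history already contains all its
    bits. *)
Lemma val_r h side v : 0 < h <= H -> side < 2 -> v < dexp h.-1 ->
  val (r_var h side v) = bits_match c s h.-1 side v.
Proof.
move=> lt_h lt_side lt_v.
have lt_vZ : v < Z by apply: leq_trans lt_v (leq_dexp_width _); lia.
have lt_row : 3 * (H - h) + 2 + side < nb_rows c by rewrite /nb_rows; lia.
rewrite val_forall // ?row_exists_r ?leq0n //.
rewrite /honest size_take_cell // cell_div // cell_mod //.
rewrite ifF; last by lia.
have -> : 3 * (H - h) + 2 + side - 2 = (H - h) * 3 + side by lia.
rewrite divnMDl // modnMDl (divn_small (ltn_trans lt_side _)) // addn0.
rewrite (modn_small (ltn_trans lt_side _)) // subKn; last by case/andP: lt_h.
case/andP: lt_h => h_gt0 le_h; rewrite h_gt0 /=; apply: eq_in_all => u.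
rewrite mem_iota => /andP[_ lt_u]; rewrite nth_take // prednK //.
rewrite cell_ltn //; first by lia.
apply: ltn_trans (lt_guards_width c_gt0); apply: guard_index_width => //;
by rewrite -ltnS prednK.
Qed.

(** The chain starts true and ends false, so some guard is set. At a lower level its clauses force
    the named entry into the honest vector above, so this entry equals the half it is accused of
    missing, while the guard claims a differing bit. Guard 1 would name a clause falsified by
    [a]. *)
Lemma honest_refutes : ~ constraints c F s.
Proof.
case=> diff base level start chain top deflt.
have lt_TZ := (lt_guards_width c_gt0).
have lt_1T : 1 < T by rewrite /nb_guards; have := expn_gt0 2 H; lia.
have c_end : val (c_var T) = false.
  have lt_row : 3 * H + 3 < nb_rows c by rewrite /nb_rows; lia.
  rewrite val_forall // ?row_exists_c ?leqnn // /honest size_take_cell //.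
  by rewrite cell_div // ifF //; lia.
have [i lt_i gi] : exists2 i, 0 < i < T & val (g_var i).
  have [|none] := boolP (has (fun i => val (g_var i)) (iota 1 T.-1)).
    by case/hasP=> i; rewrite mem_iota => lt_i gi; exists i => //; lia.
  suff : val (c_var T) by rewrite c_end.
  have gi0 i : 0 < i < T -> val (g_var i) = false.
    move=> lt_i; apply/negbTE/(hasPn none).
    by rewrite mem_iota; lia.
  have all_c i : i < T -> val (c_var i.+1).
    elim: i => // i IH lt_i; have := chain i.+1 lt_i (IH (ltnW lt_i)).
    by rewrite -/val gi0.
  by rewrite -(prednK (ltnW lt_1T)); apply: all_c; lia.
have [gt1|le1] := ltnP 1 i.
  have [|h [side [t [le_h lt_side lt_t ei]]]] := @guard_indexP c i;
  first by lia.
  rewrite {}ei in gi; have := diff h side t le_h lt_side lt_t gi.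
  apply/negP; rewrite negbK; have [h0|h_gt0] := posnP h.
    subst h; have t0 : t = 0 by move: lt_t; rewrite expn0; lia.
    subst t; have := base side lt_side gi; rewrite -/val val_r //; last first.
      by rewrite /dexp; case: (val _).
    move=> /allP/(_ 0); rewrite mem_iota => /(_ isT) /eqP; rewrite -/val => ->.
    by rewrite bit0 -/val; case: (val _).
  have lt_hH : 0 < h <= H by rewrite h_gt0 leqW.
  (* [v1] and [v2] are the actual halves of the number of level [h]; the honest player has set their
     entries. *)
  have [v1 lt_v1 v1P] := bit_exists (2 ^ h.-1)
    (fun u => val (e_var h (guard_index h.-1 0 u))).
  have [v2 lt_v2 v2P] := bit_exists (2 ^ h.-1)
    (fun u => val (e_var h (guard_index h.-1 1 u))).
  have r1 : val (r_var h 0 v1).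
    rewrite val_r //; apply/allP => u; rewrite mem_iota => /andP[_ lt_u].
    by rewrite v1P // prednK.
  have r2 : val (r_var h 1 v2).
    rewrite val_r //; apply/allP => u; rewrite mem_iota => /andP[_ lt_u].
    by rewrite v2P // prednK.
  have lt_hc : 0 < h <= c by rewrite h_gt0.
  have := level h side t v1 v2 lt_hc lt_side lt_t lt_v1 lt_v2 gi r1 r2.
  have lt_v := lt_dexp_pair h_gt0 lt_v1 lt_v2.
  rewrite -/val val_r // => /allP/(_ t); rewrite mem_iota => /(_ lt_t)/eqP.
  rewrite -/val /= => ->.
  rewrite bit_cat //; have exph : 2 ^ h = 2 ^ h.-1 + 2 ^ h.-1.
    by rewrite -{1}(prednK h_gt0) expnS mul2n addnn.
  case: ltnP => [lt_th|le_ht]; rewrite ?v1P ?v2P //; last by lia.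
    by rewrite /guard_index prednK // mul0n addn0 eqxx.
  by rewrite /guard_index prednK // mul1n -addnA subnKC // eqxx.
have i1 : i = 1 by lia.
subst i; have [j lt_j jP] := bit_exists (2 ^ c)
  (fun u => val (e_var H (guard_index c 0 u))).
have rj : val (r_var H 0 j).
  rewrite val_r //=; apply/allP => u; rewrite mem_iota => /andP[_ lt_u].
  by rewrite jP.
have [lt_jF|le_Fj] := ltnP j (size F); last first.
  by have := deflt j lt_j le_Fj gi; rewrite -/val rj.
have Cj_in := mem_nth [::] lt_jF.
have /hasP[l l_in /eqP al_l] := allP a_sat _ Cj_in.
have := top j l lt_j lt_jF l_in gi rj; rewrite -/val val_x ?al_l ?eqxx //.
by case/andP: F_3cnf => _ /allP/(_ _ Cj_in)/and3P[_ _ /allP/(_ _ l_in)].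
Qed.

End Refute.

Lemma sat_refutes : satisfiable n F -> ~~ qbf_true (red_qbf c F).
Proof.
case/existsP=> a a_sat; apply: quantify_refute (honest a) _ => s size_s
  s_honest.
apply/negP => /cnf_evalP; exact: honest_refutes a_sat _ size_s s_honest.
Qed.

(** * The existential player wins on unsatisfiable instances *)

Section Strategy.

Hypothesis F_unsat : ~~ satisfiable n F.

(* The entries of the decoding of level h.+1 that are wrongly set. *)
Definition cheats (p : seq bool) (h : nat) : seq (nat * nat) :=
  [seq sv <- [seq (side, v) | side <- iota 0 2, v <- iota 0 (dexp h)] |
   nth false p (r_var h.+1 sv.1 sv.2) && ~~ bits_match c p h sv.1 sv.2].

Lemma mem_pairs h side v :
  ((side, v) \in [seq (side, v) | side <- iota 0 2, v <- iota 0 (dexp h)]) =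
  (side < 2) && (v < dexp h).
Proof.
apply/allpairsP/andP => [[[side' v'] [+ + [-> ->]]]|[lt_side lt_v]].
  by rewrite !mem_iota.
by exists (side, v); rewrite !mem_iota.
Qed.

(** [cheats p h] concerns the vectors of level [h.+1], whence the predecessor. Level 0 has no
    vectors, which ends the descent in [some_guard]. *)
Definition cheated (p : seq bool) (h : nat) : bool :=
  (0 < h) && (cheats p h.-1 != [::]).

Definition accused (p : seq bool) (h : nat) : nat * nat :=
  head (0, 0) (cheats p h).

(** A guard is set only under conditions that make all its clauses true, so several guards may be
    set without harm. *)
Definition guard_choice (p : seq bool) (i : nat) : bool :=
  let h := guard_level i in
  [&& cheats p h != [::], (accused p h).1 == guard_side i, ~~ cheated p h
    & nth false p (e_var h (2 ^ h + guard_bit i)) != nth false p (e_var h.+1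
      i)].

Definition false_clause (p : seq bool) : nat :=
  find (fun C => ~~ has (fun l : literal => nth false p l.1 == l.2) C) F.

(** On a row of bits, offsets below [2 ^ h] get bit 0 by truncated subtraction; these variables
    occur in no clause. *)
Definition choice (p : seq bool) : bool :=
  let row := size p %/ Z in let off := size p %% Z in
  let h := H - row %/ 3 in
  if row == 3 * H + 2 then
    if off == 1 then ~~ cheated p H else guard_choice p off
  else if row == 3 * H + 3 then
    ~~ has (fun i => nth false p (g_var i)) (iota 1 off.-1)
  else bit (if h == H then false_clause p else (accused p h).2) (off - 2 ^ h).

Variable s : seq bool.
Hypothesis size_s : size s = size (red_prefix c).
Hypothesis s_choice : forall i, i < size (red_prefix c) ->
  nth Forall (red_prefix c) i = Exists -> nth false s i = choice (take i s).

Let val := nth false s.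

Lemma val_exists row off : row < nb_rows c -> off < row_exists c row ->
  val (cell row off) = choice (take (cell row off) s).
Proof.
move=> lt_row lt_off; have lt_offZ := leq_trans lt_off (row_exists_le c_gt0
  row).
by apply: s_choice; [apply: cell_lt | rewrite nth_red_prefix // lt_off].
Qed.

Lemma size_take_exists row off : row < nb_rows c -> off < row_exists c row ->
  size (take (cell row off) s) = cell row off.
Proof.
move=> lt_row lt_off; have lt_offZ := leq_trans lt_off (row_exists_le c_gt0
  row).
by rewrite size_takel // size_s ltnW // cell_lt.
Qed.

(** A strategy sees only the history. This lemma and the next ones say that whatever it consults has
    been settled by the time of its move. *)
Lemma take_bits_match i h side v : h <= c -> side < 2 ->
  e_var h.+1 T <= i ->
  bits_match c (take i s) h side v = bits_match c s h side v.
Proof.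
move=> le_h lt_side le_i; apply: eq_in_all => u.
rewrite mem_iota => /andP[_ lt_u]; rewrite nth_take //.
by apply: leq_trans le_i; rewrite ltn_add2l guard_index_width.
Qed.

Lemma take_cheats i h : h <= c -> cell (3 * (H - h) + 1) 0 <= i ->
  cheats (take i s) h = cheats s h.
Proof.
move=> le_h le_i; have lt_hH : h < H by rewrite ltnS.
apply: eq_in_filter => -[side v].
rewrite mem_pairs => /andP[lt_side lt_v] /=; rewrite take_bits_match //;
last first.
  by apply: leq_trans le_i; apply/ltnW/cell_ltn;
  [lia | apply: (lt_guards_width c_gt0)].
rewrite nth_take //; apply: leq_trans le_i; apply: cell_ltn; first by lia.
by apply: leq_trans lt_v (leq_dexp_width _); apply: leqW.
Qed.

Lemma take_cheated i h : h <= H -> (0 < h -> cell (3 * (H - h) + 4) 0 <= i) ->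
  cheated (take i s) h = cheated s h.
Proof.
case: h => // h le_h le_i; rewrite /cheated /= take_cheats //.
by apply: leq_trans (le_i isT); rewrite leq_add2r leq_mul2r; lia.
Qed.

Lemma take_false_clause i : Z <= i -> false_clause (take i s) = false_clause s.
Proof.
move=> le_i; have -> : false_clause (take i s) = false_clause s; last by [].
rewrite /false_clause; apply/eqP.
have : {in F, forall C : clause, (~~ has (fun l : literal => nth false (take i
  s) l.1 == l.2) C) =
   ~~ has (fun l : literal => nth false s l.1 == l.2) C}.
  move=> C C_in; congr (~~ _); apply: eq_in_has => l l_in; rewrite nth_take //.
  apply: leq_trans le_i; apply: leq_trans (leq_dexp_width (leqnSn c)).
  apply: leq_trans le_n; case/andP: F_3cnf => _ /allP/(_ _ C_in)/and3P[_ _].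
  by move/allP/(_ _ l_in).
elim: F => //= C F' IH eqF; rewrite eqF ?mem_head //; case: ifP => // _.
by rewrite eqSS; apply: IH => D D_in; apply: eqF; rewrite in_cons D_in orbT.
Qed.

Lemma val_e h u : h <= H -> u < 2 ^ h -> val (e_var h (2 ^ h + u)) =
  bit (if h == H then false_clause s else (accused s h).2) u.
Proof.
move=> le_h lt_u; have lt_row : 3 * (H - h) + 1 < nb_rows c by rewrite
  /nb_rows; lia.
have lt_off : 2 ^ h + u < row_exists c (3 * (H - h) + 1) by rewrite
  row_exists_e //; lia.
have lt_offZ := leq_trans lt_off (row_exists_le c_gt0 _).
rewrite val_exists // /choice size_take_exists // cell_div // cell_mod //.
rewrite ifF; last by lia.
rewrite ifF; last by lia.
have -> : H - (3 * (H - h) + 1) %/ 3 = h by lia.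
rewrite addKn; case: eqP => [_|ne]; congr (bit _ u).
  apply: take_false_clause; rewrite /cell_var addn1 mulSn -addnA.
  exact: leq_addr.
rewrite /accused take_cheats //; first by rewrite -ltnS ltn_neqAle le_h andbT;
apply/eqP.
by rewrite leq_add2l.
Qed.

Lemma val_g1 : val (g_var 1) = ~~ cheated s H.
Proof.
have lt_row : 3 * H + 2 < nb_rows c by rewrite /nb_rows; lia.
have lt_off : 1 < row_exists c (3 * H + 2).
  by rewrite row_exists_g /nb_guards; have := expn_gt0 2 H; lia.
have lt_offZ := leq_trans lt_off (row_exists_le c_gt0 _).
rewrite val_exists // /choice size_take_exists // cell_div // cell_mod // !eqxx.
rewrite take_cheated // subnn muln0 add0n /cell_var addn0;
have H_gt0 : 0 < H by [].
by move=> _; apply: leq_trans (leq_addr _ _); rewrite leq_mul2r; lia.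
Qed.

Lemma val_g h side t : h <= c -> side < 2 -> t < 2 ^ h ->
  let i := guard_index h side t in
  val (g_var i) = [&& cheats s h != [::], (accused s h).1 == side,
    ~~ cheated s h & val (e_var h (2 ^ h + t)) != val (e_var h.+1 i)].
Proof.
move=> le_h lt_side lt_t i.
have lt_row : 3 * H + 2 < nb_rows c by rewrite /nb_rows; lia.
have lt_iT : i < T by apply: guard_index_width.
have lt_hH : h < H by rewrite ltnS.
have lt_off : i < row_exists c (3 * H + 2) by rewrite row_exists_g.
have lt_offZ := leq_trans lt_off (row_exists_le c_gt0 _).
rewrite val_exists // /choice size_take_exists // cell_div // cell_mod // eqxx.
have -> : (i == 1) = false.
  by rewrite /i /guard_index expnS; have := expn_gt0 2 h; lia.
have [eh es et] := guard_indexK lt_side lt_t; rewrite /guard_choice eh es et.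
rewrite /accused take_cheats ?take_cheated ?nth_take //.
- by apply: cell_ltn; lia.
- apply: cell_ltn; first by lia.
  apply: leq_trans (lt_guards_width c_gt0); apply: leqW;
  apply: leq_trans (exp2_le (leqW le_h)).
  by rewrite expnS; lia.
- exact: leqW.
- by move=> h_gt0; rewrite /cell_var addn0; apply: leq_trans (leq_addr _ _);
  rewrite leq_mul2r; lia.
- by rewrite /cell_var addn0; apply: leq_trans (leq_addr _ _);
  rewrite leq_mul2r; lia.
Qed.

Lemma val_c i : i < T ->
  val (c_var i) = ~~ has (fun i => val (g_var i)) (iota 1 i.-1).
Proof.
move=> lt_iT; have lt_row : 3 * H + 3 < nb_rows c by rewrite /nb_rows; lia.
have lt_off : i < row_exists c (3 * H + 3) by rewrite row_exists_c.
have lt_offZ := leq_trans lt_off (row_exists_le c_gt0 _).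
rewrite val_exists // /choice size_take_exists // cell_div // cell_mod // eqxx.
rewrite ifF; last by lia.
congr (~~ _); apply: eq_in_has => j; rewrite mem_iota => lt_j.
by rewrite nth_take //; apply: cell_ltn; [lia | apply: ltn_trans lt_offZ; lia].
Qed.

Lemma not_cheated h side v : h <= c -> side < 2 -> v < dexp h ->
  ~~ cheated s h.+1 -> val (r_var h.+1 side v) -> bits_match c s h side v.
Proof.
move=> le_h lt_side lt_v; rewrite /cheated /= negbK => /eqP no_cheat r_v.
apply/negPn/negP => bad; suff : (side, v) \in cheats s h by rewrite no_cheat.
by rewrite mem_filter mem_pairs lt_side lt_v /= bad -/val r_v.
Qed.

Lemma accusedP h : h <= c -> cheats s h != [::] ->
  let: (side, v) := accused s h in
  [/\ side < 2, v < dexp h, val (r_var h.+1 side v) & ~~ bits_match c s h side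
    v].
Proof.
move=> le_h ne; have : accused s h \in cheats s h.
  by rewrite /accused; case: (cheats s h) ne => //= *; apply: mem_head.
case: (accused s h) => side v; rewrite mem_filter /= => /andP[/andP[r_v bad]].
by rewrite mem_pairs => /andP[].
Qed.

Lemma false_clauseP : false_clause s < size F /\
  ~~ has (fun l : literal => val l.1 == l.2) (nth [::] F (false_clause s)).
Proof.
have : has (fun C => ~~ has (fun l : literal => val l.1 == l.2) C) F.
  rewrite [has _ _](has_predC (fun C => has (fun l => val l.1 == l.2) C)).
  apply/negP => sat; case/negP: F_unsat.
  apply/existsP; exists [tuple val i | i < n]; apply/allP => C C_in.
  have /hasP[l l_in sat_l] := allP sat _ C_in.
  apply/hasP; exists l => //; case/andP: F_3cnf => _ /allP/(_ _ C_in)/and3P[_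
    _].
  move/allP/(_ _ l_in) => lt_l.
  have := tnth_mktuple (fun i : 'I_n => val i) (Ordinal lt_l).
  by rewrite (tnth_nth false) /= => ->.
by move=> has_false; rewrite -has_find; split=> //;
apply: (nth_find [::] has_false).
Qed.

(** From a cheated level one descends to a cheated level just above a clean one. The wrong entry
    accused there differs from its half in some bit, and the guard of this bit is set. If the top
    level is clean, guard 1 is set. *)
Lemma some_guard : exists2 i, 0 < i < T & val (g_var i).
Proof.
have guard h : h <= H -> cheated s h -> exists2 i, 0 < i < T & val (g_var i).
  elim: h => // h IH lt_h ch; have [/IH|nch] := boolP (cheated s h).
    by apply; apply: ltnW.
  have ne : cheats s h != [::] by case/andP: ch.
  have := accusedP lt_h ne; case e: (accused s h) => [side v].
  case=> lt_side lt_v r_v /allPn[u]; rewrite mem_iota => /andP[_ lt_u] bad.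
  exists (guard_index h side u).
    by rewrite guard_index_width // /guard_index; have := expn_gt0 2 h.+1; lia.
  rewrite val_g // ne e eqxx nch /= val_e ?(ltnW lt_h) // e.
  by rewrite (ltn_eqF lt_h) eq_sym.
have [/(guard _ (leqnn _))//|nch] := boolP (cheated s H).
exists 1; last by rewrite val_g1.
by rewrite /nb_guards; have := expn_gt0 2 H; lia.
Qed.

(** At a clean level the only entries that can be set are the true halves of the number named there.
    So the conclusion of an active level clause is the accused entry itself, which is set because it
    was a cheat. *)
Lemma choice_constraints : constraints c F s.
Proof.
have lt_1T : 1 < T by rewrite /nb_guards; have := expn_gt0 2 H; lia.
split; rewrite -/val.
- by move=> h side t le_h lt_side lt_t; rewrite -/val val_g // => /and4P[].
- move=> side lt_side; rewrite -/val val_g // => /and4P[ne /eqP es _ _].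
  have := accusedP (leq0n c) ne; case e: (accused s 0) es => [side' v] /= ->.
  case=> _ lt_v r_v _; have := val_e (leq0n H) (isT : 0 < 2 ^ 0).
  rewrite addn0 /= e /= bit0 => ->.
  by case: v lt_v r_v {e} => [|[|]].
- move=> h side t v1 v2 /andP[h_gt0 le_h] lt_side lt_t lt_v1 lt_v2;
  rewrite -/val.
  rewrite val_g // => /and4P[ne /eqP es nch _] r1 r2.
  have := accusedP le_h ne; case e: (accused s h) es => [side' v] /= ->.
  case=> _ lt_v r_v _; suff <- : v = v2 * dexp h.-1 + v1 by [].
  have lt_v12 := lt_dexp_pair h_gt0 lt_v1 lt_v2.
  apply: bit_inj lt_v lt_v12 _ => u lt_u.
  have := val_e (leqW le_h) lt_u; rewrite ifF ?e /=; last by apply: ltn_eqF.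
  move=> <-; rewrite bit_cat //.
  have exph : 2 ^ h = 2 ^ h.-1 + 2 ^ h.-1.
    by rewrite -{1}(prednK h_gt0) expnS mul2n addnn.
  have le_h1 : h.-1 <= c by apply: leq_trans (leq_pred _) le_h.
  have hK : h.-1.+1 = h by apply: prednK.
  have [lt_u1|le_u1] := ltnP u (2 ^ h.-1).
    have := not_cheated (v := v1) (side := 0) le_h1 isT lt_v1.
    rewrite hK => /(_ nch r1) /allP/(_ u);
    rewrite mem_iota => /(_ lt_u1)/eqP <-.
    by rewrite hK /guard_index hK mul0n addn0.
  have lt_u2 : u - 2 ^ h.-1 < 2 ^ h.-1 by lia.
  have := not_cheated (v := v2) (side := 1) le_h1 isT lt_v2.
  rewrite hK => /(_ nch r2) /allP/(_ (u - 2 ^ h.-1)).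
  rewrite mem_iota => /(_ lt_u2)/eqP <-.
  by rewrite hK /guard_index hK mul1n -addnA subnKC.
- by rewrite val_c.
- move=> i lt_i; rewrite -/val; case: i lt_i => [|i] lt_i.
    by rewrite (val_c lt_1T) orbT.
  rewrite val_c //= => none; case gi: (val (g_var i.+1)) => //=.
  have none' : ~~ has (fun i => val (g_var i)) (iota 1 i.+1).
    by rewrite -(addn1 i) iotaD has_cat (negPf none) /= add1n gi.
  have [lt_i1|le_T] := ltnP i.+2 T; first by rewrite val_c.
  (* The next chain variable is the universal one, so the chain must have been broken before it by a
     guard. *)
  have [j lt_j gj] := some_guard; case/hasP: none'; exists j => //.
  by rewrite mem_iota; lia.
- move=> j l lt_j lt_jF l_in; rewrite -/val val_g1 => nch r_j.
  have [lt_f no_lit] := false_clauseP.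
  (* With a clean top level, only the entry of the first half of the top number can be set, and this
     half spells [false_clause s]. *)
  suff ej : j = false_clause s.
    by apply: (hasPn no_lit); rewrite -ej.
  apply: (bit_inj lt_j (leq_trans lt_f le_F)) => u lt_u.
  have lt_uH : u < 2 ^ H by rewrite /height expnS; lia.
  have := val_e (leqnn H) lt_uH; rewrite eqxx => <-.
  have := not_cheated (leqnn c) (isT : 0 < 2) lt_j nch r_j.
  move/allP/(_ u); rewrite mem_iota => /(_ lt_u)/eqP <-.
  by rewrite /guard_index mul0n addn0.
- move=> j lt_j le_Fj; rewrite -/val val_g1 => nch.
  apply/negP => r_j; have [lt_f _] := false_clauseP.
  suff ej : j = false_clause s by rewrite ej leqNgt lt_f in le_Fj.
  apply: (bit_inj lt_j (leq_trans lt_f le_F)) => u lt_u.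
  have lt_uH : u < 2 ^ H by rewrite /height expnS; lia.
  have := val_e (leqnn H) lt_uH; rewrite eqxx => <-.
  have := not_cheated (leqnn c) (isT : 0 < 2) lt_j nch r_j.
  move/allP/(_ u); rewrite mem_iota => /(_ lt_u)/eqP <-.
  by rewrite /guard_index mul0n addn0.
Qed.

End Strategy.

Lemma red_qbf_true : qbf_true (red_qbf c F) = ~~ satisfiable n F.
Proof.
have [sat|unsat] := boolP (satisfiable n F); first exact/negbTE/sat_refutes.
apply: quantify_strategy choice _ => s size_s s_choice.
by apply/cnf_evalP; apply: choice_constraints.
Qed.

End Game.

(** * Format of the formula *)

(** A key that recovers the index of a block makes the blocks disjoint, so that no two blocks have
    to be compared. *)
Lemma uniq_flatten_key (A : eqType) (key : A -> nat) (f : nat -> seq A) s :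
  uniq s -> {in s, forall i, uniq (f i)} ->
  {in s, forall i, {in f i, forall x, key x = i}} ->
  uniq (flatten [seq f i | i <- s]).
Proof.
elim: s => //= i s IH /andP[i_notin uniq_s] uniq_f key_f.
rewrite cat_uniq uniq_f ?mem_head //= IH //; last first.
- by move=> j j_in; apply: key_f; rewrite in_cons j_in orbT.
- by move=> j j_in; apply: uniq_f; rewrite in_cons j_in orbT.
rewrite andbT; apply/hasPn => x /flatten_mapP[j j_in x_in].
apply: contra i_notin => x_in'.
rewrite -(key_f i _ x x_in') ?mem_head // (key_f j _ x x_in) //.
by rewrite in_cons j_in orbT.
Qed.

Lemma uniq_cat_pred (A : eqType) (P : pred A) s1 s2 :
  uniq s1 -> uniq s2 -> all P s1 -> all (predC P) s2 -> uniq (s1 ++ s2).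
Proof.
move=> u1 u2 /allP P1 /allP P2; rewrite cat_uniq u1 u2 andbT /=.
by apply/hasPn => x /P2 /= nPx; apply: contra nPx => /P1.
Qed.

(** * Number of variables *)

Section Size.

Variable c : nat.
Local Notation H := (height c).
Local Notation Z := (width c).
Local Notation T := (nb_guards c).

(** A geometric sum; its missing tail is added on the left so that the induction telescopes without
    subtraction. *)
Lemma row_exists_levels m : m <= H ->
  sumn [seq row_exists c row | row <- iota 0 (3 * m).+1] + 4 * 2 ^ (H - m) =
  4 * 2 ^ H.
Proof.
elim: m => [_|m IH lt_m]; first by rewrite subn0.
have e1 : row_exists c (3 * m).+1 = 2 * 2 ^ (H - m).
  by rewrite -addn1 -{1}(subKn (ltnW lt_m)) row_exists_e // leq_subr.
have e2 : row_exists c (3 * m).+2 = 0.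
  rewrite -[_.+2]addn2 -[_ + 2]addn0 -{1}(subKn (ltnW lt_m)).
  by rewrite row_exists_r // leq_subr subn_gt0 lt_m.
have e3 : row_exists c (3 * m).+3 = 0.
  rewrite -[_.+3]addn3 -[_ + 3]/(_ + (2 + 1)) addnA -{1}(subKn (ltnW lt_m)).
  by rewrite row_exists_r // leq_subr subn_gt0 lt_m.
rewrite -(IH (ltnW lt_m)) (_ : (3 * m.+1).+1 = (3 * m).+1 + 3); last by lia.
rewrite iotaD map_cat sumn_cat [iota _ 3]/= add0n [map _ [:: _; _;
_]]/= e1 e2 e3.
by rewrite (_ : H - m = (H - m.+1).+1) ?expnS /=; lia.
Qed.

(** The levels above 0 contribute [4 * 2 ^ H - 4], level 0 contributes 2, and the guards and the
    chain [2 * 2 ^ H] each. *)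
Lemma nb_exists_red F : nb_exists (red_qbf c F) <= 8 * 2 ^ H.
Proof.
have -> : nb_exists (red_qbf c F) =
    sumn [seq row_exists c row | row <- iota 0 (nb_rows c)].
  rewrite /nb_exists /= /red_prefix count_flatten -map_comp.
  rewrite (eq_map (g := row_exists c)) // => row;
  rewrite /= count_cat !count_nseq.
  by rewrite mul1n mul0n addn0.
have last_rows : sumn [seq row_exists c row | row <- iota (3 * H).+1 3] = 2 +
  (T + (T + 0)).
  have := @row_exists_e c 0 isT; rewrite subn0 addn1 muln1 => e1.
  have := row_exists_g c; rewrite addn2 => e2.
  by have := row_exists_c c; rewrite addn3 => e3; rewrite [LHS]/= e1 e2 e3.
rewrite /nb_rows (_ : 3 * H + 4 = (3 * H).+1 + 3); last by lia.
rewrite iotaD map_cat sumn_cat add0n last_rows.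
by have := row_exists_levels (leqnn H); rewrite subnn /nb_guards; lia.
Qed.

Lemma cell_eq row off row' off' : off < Z -> off' < Z ->
  (cell_var c row off == cell_var c row' off') = (row == row') && (off == off').
Proof.
move=> lt_off lt_off'; apply/eqP/andP => [e|[/eqP-> /eqP-> //]].
split; apply/eqP.
  by rewrite -(cell_div row lt_off) e cell_div.
by rewrite -(cell_mod row lt_off) e cell_mod.
Qed.

Hypothesis c_gt0 : 0 < c.

Lemma nb_vars_red F : nb_vars (red_qbf c F) = nb_rows c * Z.
Proof. exact: (size_red_prefix c_gt0). Qed.

Lemma e_offset h t : h <= H -> t < 2 ^ h -> 2 ^ h + t < Z.
Proof.
move=> le_h lt_t; apply: leq_trans (ltnW (lt_guards_width c_gt0)).
by apply: leq_trans (exp2_le le_h); rewrite expnS; lia.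
Qed.

Lemma guard_offset h side t : h <= c -> side < 2 -> t < 2 ^ h ->
  guard_index h side t < Z.
Proof.
move=> le_h lt_side lt_t; apply: ltn_trans (lt_guards_width c_gt0).
exact: guard_index_width.
Qed.

End Size.

(** * Width and distinctness of the clauses *)

Section Format.

Variables (n c : nat) (F : cnf).
Hypotheses (c_gt0 : 0 < c) (F_3cnf : is_dcnf 3 n F).
Hypotheses (le_n : n <= dexp c) (le_F : size F <= dexp c).

Local Notation H := (height c).
Local Notation Z := (width c).
Local Notation T := (nb_guards c).

Definition well_formed (C : clause) : bool :=
  [&& uniq C, size C <= 4 &
      all (fun l : literal => l.1 < nb_vars (red_qbf c F)) C].

(** Literals are compared as pairs of row and offset, which leaves linear arithmetic instead of
    products with the width. *)
Lemma well_formed_cells (L : seq (nat * nat * bool)) : size L <= 4 -> uniq L ->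
  all (fun l => (l.1.1 < nb_rows c) && (l.1.2 < Z)) L ->
  well_formed [seq (cell_var c l.1.1 l.1.2, l.2) | l <- L].
Proof.
move=> le_L uniq_L /allP in_L; rewrite /well_formed size_map le_L all_map.
rewrite map_inj_in_uniq ?uniq_L => [|[[row off] b] [[row' off'] b'] l_in l_in'].
  apply/allP => l /in_L/andP[lt_row lt_off] /=.
  by rewrite (nb_vars_red c_gt0) -(size_red_prefix c_gt0) cell_lt.
move=> [/eqP e ->]; move/in_L/andP: l_in => /= [_ lt_off].
move/in_L/andP: l_in' => /= [_ lt_off']; move: e.
by rewrite cell_eq // => /andP[/eqP-> /eqP->].
Qed.

Lemma well_formed_emitted : all well_formed (emitted c F).
Proof.
have lt_TZ := lt_guards_width c_gt0; have H_gt0 : 0 < H by [].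
have eH : H = c.+1 by [].
have e_rows : nb_rows c = 3 * H + 4 by [].
have al0_Z h : h <= c -> dexp h < Z.
  by move=> le_h; rewrite ltn_exp2l // ltn_exp2l.
have diff h side t : h <= c -> side < 2 -> t < 2 ^ h ->
    all well_formed (diff_clauses c h side t).
  move=> le_h lt_side lt_t; have lt_g := guard_offset c_gt0 le_h lt_side lt_t.
  have lt_e := e_offset c_gt0 (leqW le_h) lt_t.
  have wf b : well_formed [:: (g_var c (guard_index h side t), false);
    (e_var c h (2 ^ h + t), b); (e_var c h.+1 (guard_index h side t), b)].
    apply: (well_formed_cells (L := [:: (3 * H + 2, guard_index h side t,
      false);
      (3 * (H - h) + 1, 2 ^ h + t, b);
      (3 * (H - h.+1) + 1, guard_index h side t, b)])) => //.
      by rewrite /= !inE !xpair_eqE; lia.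
    by rewrite /= lt_g lt_e; lia.
  by rewrite /= !wf.
apply/all_emittedP; split.
- move=> side lt_side; rewrite all_cat diff //=.
  have lt_g := guard_offset c_gt0 (leq0n c) lt_side (isT : 0 < 2 ^ 0).
  have lt_2Z : 2 < Z by apply: leq_trans (al0_Z 0 (leq0n c)).
  have wf b v : v < 2 -> well_formed [:: (g_var c (guard_index 0 side 0),
    false);
    (e_var c 0 1, b); (r_var c 1 side v, true)].
    move=> lt_v; apply: (well_formed_cells (L :=
      [:: (3 * H + 2, guard_index 0 side 0, false);
      (3 * (H - 0) + 1, 1, b); (3 * (H - 1) + 2 + side, v, true)])) => //.
      by rewrite /= !inE !xpair_eqE; lia.
    by rewrite /= lt_g; lia.
  by rewrite !wf.
- move=> h side t /andP[h_gt0 le_h] lt_side lt_t; rewrite all_cat diff //=.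
  rewrite all_flatten all_map; apply/all_iotaP => v2 lt_v2 /=; rewrite all_map.
  apply/all_iotaP => v1 lt_v1; have lt_g := guard_offset c_gt0 le_h lt_side
    lt_t.
  have lt_hZ : dexp h.-1 < Z by apply: al0_Z; lia.
  have lt_v : v2 * dexp h.-1 + v1 < Z.
    by apply: leq_trans (ltnW (al0_Z h le_h)); apply: lt_dexp_pair.
  apply: (well_formed_cells (L := [:: (3 * H + 2, guard_index h side t, false);
    (3 * (H - h) + 2 + 0, v1, false); (3 * (H - h) + 2 + 1, v2, false);
    (3 * (H - h.+1) + 2 + side, v2 * dexp h.-1 + v1, true)])) => //.
    by rewrite /= !inE !xpair_eqE; lia.
  by rewrite /= lt_g; lia.
- apply: (well_formed_cells (L := [:: (3 * H + 3, 1, true)])) => //=.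
  by have : 2 < Z := leq_trans (al0_Z 0 (leq0n c)) (leqnn _); lia.
- move=> i lt_i; apply: (well_formed_cells (L := [:: (3 * H + 3, i, false);
    (3 * H + 2, i, true); (3 * H + 3, i.+1, true)])) => //.
    by rewrite /= !inE !xpair_eqE; lia.
  by rewrite /=; lia.
- move=> j lt_j; rewrite /top_clauses; have lt_jZ := ltn_trans lt_j (al0_Z c
    (leqnn c)).
  have lt_2Z : 1 < Z by apply: leq_ltn_trans lt_TZ; rewrite /nb_guards;
  have := expn_gt0 2 H; lia.
  case: ltnP => [lt_jF|_]; last first.
    rewrite /= andbT; apply: (well_formed_cells (L := [:: (3 * H + 2, 1, false);
      (3 * (H - H) + 2 + 0, j, false)])) => //.
      by rewrite /= !inE !xpair_eqE; lia.
    by rewrite /=; lia.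
  rewrite all_map; apply/allP => l l_in /=.
  have lt_l : l.1 < Z.
    apply: leq_trans (ltnW (al0_Z c (leqnn c))); apply: leq_trans le_n.
    case/andP: F_3cnf => _ /allP/(_ _ (mem_nth [::] lt_jF))/and3P[_ _].
    by move/allP/(_ _ l_in).
  apply: (well_formed_cells (L := [:: (3 * H + 2, 1, false);
    (3 * (H - H) + 2 + 0, j, false); (0, l.1, ~~ l.2)])) => //.
    by rewrite /= !inE !xpair_eqE; lia.
  by rewrite /= lt_l; lia.
Qed.

Let lit (i : nat) (C : clause) : literal := nth (0, false) C i.
Let off (i : nat) (C : clause) : nat := (lit i C).1 %% Z.

Lemma lit_level h side t C : C \in level_clauses c h side t ->
  lit 0 C = (g_var c (guard_index h side t), false).
Proof.
rewrite mem_cat !inE -orbA => /or3P[/eqP->|/eqP->|] //.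
by case/flatten_mapP=> v2 _ /mapP[v1 _ ->].
Qed.

Lemma lit_base side C : C \in base_clauses c side ->
  lit 0 C = (g_var c (guard_index 0 side 0), false).
Proof. by rewrite mem_cat !inE -!orbA => /or4P[] /eqP->. Qed.

Lemma lit_top j C : C \in top_clauses c F j ->
  lit 0 C = (g_var c 1, false) /\ lit 1 C = (r_var c H 0 j, false).
Proof.
rewrite /top_clauses; case: ifP => _; first by case/mapP=> l _ ->.
by rewrite inE => /eqP->.
Qed.

(** The group of a clause, read off its first literal. Offset 1 is tested before the level, because
    [guard_level 1] is 0 as well. *)
Definition kind (C : clause) : nat :=
  if (lit 0 C).1 %/ Z == 3 * H + 3 then (if (lit 0 C).2 then 2 else 3)
  else if off 0 C == 1 then 4 else if guard_level (off 0 C) == 0 then 0 else 1.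

Lemma guard_rowF : (3 * H + 2 == 3 * H + 3) = false.
Proof. by apply/negbTE; rewrite eqn_add2l. Qed.

Lemma kind_guard h side t C : h <= c -> side < 2 -> t < 2 ^ h ->
  lit 0 C = (g_var c (guard_index h side t), false) -> kind C = (0 < h).
Proof.
move=> le_h lt_side lt_t e; have lt_g := guard_offset c_gt0 le_h lt_side lt_t.
have [el _ _] := guard_indexK lt_side lt_t.
rewrite /kind /off e cell_div // cell_mod // guard_rowF el.
have -> : (guard_index h side t == 1) = false.
  by rewrite /guard_index expnS; have := expn_gt0 2 h; lia.
by case: h {le_h lt_t e lt_g el}.
Qed.

Lemma off_cell i C row o b : o < Z -> lit i C = (cell_var c row o, b) -> off i
  C = o.
Proof. by move=> lt_o e; rewrite /off e cell_mod. Qed.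

Lemma uniq_level h side t : 0 < h <= c -> side < 2 -> t < 2 ^ h ->
  uniq (level_clauses c h side t).
Proof.
case/andP=> h_gt0 le_h lt_side lt_t.
have lt_vZ v : v < dexp h.-1 -> v < Z.
  by move=> lt_v; apply: leq_trans lt_v (leq_dexp_width _);
  apply: leq_trans (leq_pred _) (leqW le_h).
(* The difference clauses have three literals, the decoding clauses four. *)
apply: (@uniq_cat_pred _ (fun C => size C == 3)) => //.
- rewrite /diff_clauses /= andbT inE; apply/negP => /eqP/(congr1 (lit 1)).
  by rewrite /lit /=; case.
- apply: (uniq_flatten_key (key := off 2)) => [|v2|v2].
  + exact: iota_uniq.
  + rewrite mem_iota => /andP[_ lt_v2]; rewrite map_inj_in_uniq ?iota_uniq //
      => v v'.
    rewrite !mem_iota => /andP[_ lt_v] /andP[_ lt_v'] /(congr1 (off 1)).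
    by rewrite /off /lit /= !cell_mod ?lt_vZ.
  + rewrite mem_iota => /andP[_ lt_v2] C /mapP[v1 _ ->].
    by apply: off_cell (lt_vZ _ lt_v2) _; reflexivity.
- by apply/allP => C /flatten_mapP[v2 _ /mapP[v1 _ ->]].
Qed.

Lemma uniq_base side : side < 2 -> uniq (base_clauses c side).
Proof.
move=> lt_side; have lt_1Z : 1 < Z.
  apply: leq_trans (lt_guards_width c_gt0).
  by rewrite /nb_guards; have := expn_gt0 2 H; lia.
have lt_g := guard_offset c_gt0 (leq0n c) lt_side (isT : 0 < 2 ^ 0).
have ne v : v < 2 -> (e_var c 1 (guard_index 0 side 0) == r_var c 1 side v) =
  false.
  move=> lt_v; rewrite cell_eq //; last by lia.
  by apply/negbTE; rewrite negb_and; lia.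
have eqC (x y z x' y' z' : literal) : ([:: x; y; z] == [:: x'; y'; z']) =
  [&& x == x', y == y' & z == z'] by rewrite !eqseq_cons andbT.
have eql (x y : nat) (b b' : bool) : ((x, b) == (y, b') :> literal) =
  (x == y) && (b == b') by [].
by rewrite /base_clauses /diff_clauses /= expn0 addn0 !inE !eqC !eql !ne //
  !andbF.
Qed.

(** Nested keys: the kind, then the level, half and bit of the guard in the first literal. In the
    top group the second literal gives the clause number, and the third is injective because clauses
    of [F] have no repeated literal. *)
Lemma uniq_emitted : uniq (emitted c F).
Proof.
have lt_TZ := lt_guards_width c_gt0.
have lt_1Z : 1 < Z.
  by apply: leq_trans lt_TZ; rewrite /nb_guards; have := expn_gt0 2 H; lia.
pose levels := flatten [seq flatten [seq flatten [seq level_clauses c h side t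
    | t <- iota 0 (2 ^ h)] | side <- iota 0 2] | h <- iota 1 c].
pose groups := nth [::] [:: flatten [seq base_clauses c side | side <- iota 0
  2];
  levels; [:: [:: (c_var c 1, true)]]; [seq chain_clause c i | i <- iota 0 T];
  flatten [seq top_clauses c F j | j <- iota 0 (dexp c)]].
have -> : emitted c F = flatten [seq groups i | i <- iota 0 5].
  by rewrite [flatten [seq groups _ | _ <- _]]/= cats0.
have off0 h side t C : h <= c -> side < 2 -> t < 2 ^ h ->
    lit 0 C = (g_var c (guard_index h side t), false) -> off 0 C = guard_index
      h side t.
  by move=> le_h lt_side lt_t; apply: off_cell; apply: (guard_offset c_gt0).
apply: (uniq_flatten_key (key := kind)) => // i.
- rewrite mem_iota; case: i => [|[|[|[|[|]]]]] // _.
  + apply: (uniq_flatten_key (key := guard_side \o off 0)) => // side.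
      by rewrite mem_iota; apply: uniq_base.
    rewrite mem_iota => lt_side C /lit_base/(off0 0 side 0) /= -> //.
    by have [] := @guard_indexK 0 side 0 lt_side isT.
  + apply: (uniq_flatten_key (key := guard_level \o off 0)) => [|h|h].
    * exact: iota_uniq.
    * rewrite mem_iota add1n ltnS => lt_h; have /andP[_ le_h] := lt_h.
      apply: (uniq_flatten_key (key := guard_side \o off 0)) => [//|side|side].
      - rewrite mem_iota => lt_side.
        apply: (uniq_flatten_key (key := guard_bit \o off 0)) => [|t|t].
        + exact: iota_uniq.
        + by rewrite mem_iota => lt_t; apply: uniq_level.
        + rewrite mem_iota => lt_t C /lit_level/(off0 h side t) /= -> //.
          by have [] := guard_indexK lt_side lt_t.
      - rewrite mem_iota => lt_side C /flatten_mapP[t].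
        rewrite mem_iota => lt_t /lit_level/(off0 h side t) /= -> //.
        by have [] := guard_indexK lt_side lt_t.
    * rewrite mem_iota add1n ltnS => /andP[_ le_h] C /flatten_mapP[side].
      rewrite mem_iota => lt_side /flatten_mapP[t].
      rewrite mem_iota => lt_t /lit_level/(off0 h side t) /= -> //.
      by have [] := guard_indexK lt_side lt_t.
  + rewrite map_inj_in_uniq ?iota_uniq // => j j'.
    rewrite !mem_iota => /andP[_ lt_j] /andP[_ lt_j'] /(congr1 (off 0)).
    by rewrite /off /lit /= !cell_mod ?(ltn_trans _ lt_TZ).
  + apply: (uniq_flatten_key (key := off 1)) => [|j|j].
    * exact: iota_uniq.
    * rewrite mem_iota => lt_j; rewrite /top_clauses; case: ifP => // lt_jF.
      rewrite map_inj_uniq => [|[x b] [x' b'] [-> /negb_inj ->] //].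
      by case/andP: F_3cnf => _ /allP/(_ _ (mem_nth [::] lt_jF))/and3P[].
    * rewrite mem_iota => lt_j C /lit_top[_ /off_cell]; apply.
      by apply: leq_trans lt_j (leq_dexp_width _); apply: leqW.
- rewrite mem_iota; case: i => [|[|[|[|[|]]]]] // _ C.
  + case/flatten_mapP=> side; rewrite mem_iota => lt_side /lit_base.
    by move/(kind_guard (leq0n c) lt_side (isT : 0 < 2 ^ 0)).
  + case/flatten_mapP=> h; rewrite mem_iota add1n ltnS => /andP[h_gt0 le_h].
    case/flatten_mapP=> side; rewrite mem_iota => lt_side.
    case/flatten_mapP=> t; rewrite mem_iota => lt_t /lit_level.
    by move/(kind_guard le_h lt_side lt_t) => ->; rewrite h_gt0.
  + by rewrite inE => /eqP->; rewrite /kind /lit /= cell_div // eqxx.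
  + case/mapP=> j; rewrite mem_iota => /andP[_ lt_j] ->.
    by rewrite /kind /lit /= cell_div ?eqxx // (ltn_trans _ lt_TZ).
  + case/flatten_mapP=> j _ /lit_top[e _].
    by rewrite /kind /off e cell_div // cell_mod // guard_rowF.
Qed.

Lemma is_dqbf_red : is_dqbf 4 (red_qbf c F).
Proof.
by rewrite /is_dqbf /is_dcnf rev_uniq uniq_emitted all_rev;
apply: well_formed_emitted.
Qed.

End Format.

(** * Programs on counters *)

Lemma upd_id s r : r < size (regs s) -> upd s r (reg s r) = s.
Proof.
case: s => l i o /= lt_r; congr Store; apply: (@eq_from_nth _ 0) => [|j _].
  by rewrite size_set_nth; apply/maxn_idPr.
by rewrite nth_set_nth /=; case: eqP => [->|].
Qed.

(* The output is written from right to left, each clause in front of its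
   predecessors. *)
Definition enc_clauses (L : cnf) (o : seq bool) : seq bool :=
  flatten [seq true :: enc_seq enc_literal C | C <- rev L] ++ o.

Lemma enc_clauses_cat L1 L2 o :
  enc_clauses (L1 ++ L2) o = enc_clauses L2 (enc_clauses L1 o).
Proof. by rewrite /enc_clauses rev_cat map_cat flatten_cat catA. Qed.

Lemma enc_clauses1 C o :
  enc_clauses [:: C] o = true :: enc_seq enc_literal C ++ o.
Proof. by rewrite /enc_clauses /= cats0. Qed.

Lemma flatten_iotaS (A : Type) (f : nat -> seq A) b j :
  flatten [seq f i | i <- iota b j.+1] =
  flatten [seq f i | i <- iota b j] ++ f (b + j).
Proof. by rewrite -addn1 iotaD map_cat flatten_cat /= cats0. Qed.

Lemma enc_clauses_iotaS (f : nat -> clause) b j o :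
  enc_clauses [seq f i | i <- iota b j.+1] o =
  enc_clauses [:: f (b + j)] (enc_clauses [seq f i | i <- iota b j] o).
Proof. by rewrite -enc_clauses_cat -addn1 iotaD map_cat. Qed.

Lemma enc_flatten_iotaS (f : nat -> cnf) b j o :
  enc_clauses (flatten [seq f i | i <- iota b j.+1]) o =
  enc_clauses (f (b + j)) (enc_clauses (flatten [seq f i | i <- iota b j]) o).
Proof. by rewrite -enc_clauses_cat flatten_iotaS. Qed.

(** * Arithmetic on counters and output of literals *)

Section Macros.

Variables (sym : finType) (blank : sym) (bit : bool -> sym).
Hypotheses (bit_inj : injective bit) (bit_blank : forall b, bit b != blank).
Variables (R w : nat).
Let k := R.+1 + w.+1.

Local Notation triple := (triple blank bit (R := R) (w := w)).
Local Notation inc := (@inc sym R w).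
Local Notation dec := (@dec sym R w).
Local Notation out := (@out sym bit R w).
Local Notation for_ := (@for_ sym bit R w).
Local Notation while_pos := (@while_pos sym bit R w).

Lemma triple_weaken m s s1 s2 t t' :
  triple m s s1 t -> s1 = s2 -> t <= t' -> triple m s s2 t'.
Proof. by move=> h <- le_t; apply: triple_le h. Qed.

Definition skip : routine sym k := prim (@stay_act sym k).

Lemma triple_skip s : triple skip s s 1.
Proof.
split=> T hT; exists T => //.
by rewrite -{2}[T](act_on_stay blank); apply: exec_prim.
Qed.

Definition if_pos (r : 'I_R) :=
  ifr (fun h : heads sym k => h (reg_tape w r) != bit true).

Lemma triple_if_pos (r : 'I_R) m1 m2 s s' t :
  triple (if 0 < reg s r then m1 else m2) s s' t ->
  triple (if_pos r m1 m2) s s' t.+1.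
Proof.
move=> [h]; split=> T hT; have [T' e hT'] := h T hT; exists T' => //.
by apply: exec_ifr; rewrite (pos_test bit_blank _ hT); case: ifP e.
Qed.

(** At zero the head is on the mark and must not move beyond it; this gives truncated
    subtraction. *)
Definition dec_pos (r : 'I_R) := if_pos r (dec r) skip.

Lemma triple_dec_pos (r : 'I_R) s : r < size (regs s) ->
  triple (dec_pos r) s (upd s r (reg s r).-1) 2.
Proof.
move=> lt_r; apply: triple_if_pos; case: ifP => [|/negbT].
  exact: triple_dec.
rewrite -eqn0Ngt => /eqP e; have := upd_id lt_r; rewrite e /= => ->.
exact: triple_skip.
Qed.

Definition clear (r : 'I_R) := while_pos r (dec r).

Lemma triple_clear (r : 'I_R) s : r < size (regs s) ->
  triple (clear r) s (upd s r 0) (reg s r * 2).+1.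
Proof.
move=> lt_r; rewrite -{1}[s](upd_id lt_r).
pose f i := upd s r (reg s r - i).
have -> : upd s r (reg s r) = f 0 by rewrite /f subn0.
have -> : upd s r 0 = f (reg s r) by rewrite /f subnn.
apply: (triple_while bit_blank (s := f)) => [i lt_i||i lt_i].
- by rewrite /f reg_upd eqxx subn_gt0.
- by rewrite /f reg_upd eqxx subnn.
- apply: triple_weaken (triple_dec _ _ _) _ _ => //.
    by rewrite /f reg_upd eqxx subn_gt0.
  by rewrite /f upd_upd eqxx reg_upd eqxx subnS.
Qed.

Variable x : 'I_R.

Definition iter_reg (r : 'I_R) (m : routine sym k) := for_ x r m.

Lemma triple_iter_reg (r : 'I_R) m (f : nat -> store) t :
  x != r -> x < size (regs (f 0)) -> r < size (regs (f 0)) ->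
  (forall j, size (regs (f j)) = size (regs (f 0))) ->
  reg (f 0) x = 0 -> (forall j, reg (f j) x = 0) ->
  (forall j, reg (f j) r = reg (f 0) r) ->
  (forall j a b, j < reg (f 0) r ->
    triple m (upd (upd (f j) r a) x b) (upd (upd (f j.+1) r a) x b) t) ->
  triple (iter_reg r m) (f 0) (f (reg (f 0) r)) (reg (f 0) r * (t + 6) + 2).
Proof.
move=> ne lt_x lt_r size_f x0 fx fr body.
apply: (triple_for bit_blank) => // j le_j.
  by rewrite -{1}(fr j) upd_id ?size_f // -(fx j) upd_id ?size_f.
exact: body.
Qed.

Definition add_to (d r : 'I_R) := iter_reg r (inc d).

Lemma triple_add_to (d r : 'I_R) s : d != x -> r != x -> d != r ->
  x < size (regs s) -> r < size (regs s) -> d < size (regs s) -> reg s x = 0 ->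
  triple (add_to d r) s (upd s d (reg s d + reg s r)) (reg s r * 7 + 2).
Proof.
move=> ne_dx ne_rx ne_dr lt_x lt_r lt_d x0.
have ne1 : (x == d :> nat) = false by rewrite eq_sym; apply/negbTE.
have ne2 : (r == d :> nat) = false by rewrite eq_sym; apply/negbTE.
have ne3 : (d == x :> nat) = false by apply/negbTE.
have ne4 : (d == r :> nat) = false by apply/negbTE.
pose f j := upd s d (reg s d + j).
have f0 : f 0 = s by rewrite /f addn0 upd_id.
have := @triple_iter_reg r (inc d) f 1; rewrite !f0; apply=> //.
- by rewrite eq_sym.
- by move=> j; rewrite size_set_nth; apply/maxn_idPr.
- by move=> j; rewrite /f reg_upd ne1.
- by move=> j; rewrite /f reg_upd ne2.
- move=> j a b _; apply: triple_weaken (triple_inc _ _) _ _ => //.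
  rewrite /f !reg_upd ne3 ne4 eqxx addnS.
  by rewrite (upd_upd _ x _ d) ne1 (upd_upd _ r _ d) ne2 (upd_upd _ d _ d) eqxx.
Qed.

Definition sub_from (d r : 'I_R) := iter_reg r (dec_pos d).

Lemma triple_sub_from (d r : 'I_R) s : d != x -> r != x -> d != r ->
  x < size (regs s) -> r < size (regs s) -> d < size (regs s) -> reg s x = 0 ->
  triple (sub_from d r) s (upd s d (reg s d - reg s r)) (reg s r * 8 + 2).
Proof.
move=> ne_dx ne_rx ne_dr lt_x lt_r lt_d x0.
have ne1 : (x == d :> nat) = false by rewrite eq_sym; apply/negbTE.
have ne2 : (r == d :> nat) = false by rewrite eq_sym; apply/negbTE.
have ne3 : (d == x :> nat) = false by apply/negbTE.
have ne4 : (d == r :> nat) = false by apply/negbTE.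
pose f j := upd s d (reg s d - j).
have f0 : f 0 = s by rewrite /f subn0 upd_id.
have size_upd s' i v : i < size (regs s') -> size (regs (upd s' i v)) = size
  (regs s').
  by move=> lt_i; rewrite size_set_nth; apply/maxn_idPr.
have := @triple_iter_reg r (dec_pos d) f 2; rewrite !f0; apply=> //.
- by rewrite eq_sym.
- by move=> j; rewrite size_upd.
- by move=> j; rewrite /f reg_upd ne1.
- by move=> j; rewrite /f reg_upd ne2.
- move=> j a b _; apply: triple_weaken (triple_dec_pos _) _ _ => //.
    by rewrite !size_upd ?size_upd.
  rewrite /f !reg_upd ne3 ne4 eqxx subnS.
  by rewrite (upd_upd _ x _ d) ne1 (upd_upd _ r _ d) ne2 (upd_upd _ d _ d) eqxx.
Qed.

Definition push (s : store) (o : seq bool) : store :=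
  Store (regs s) (input s) (o ++ output s).

Fixpoint outs (o : seq bool) : routine sym k :=
  if o is b :: o' then seqr (outs o') (out b) else skip.

Lemma triple_outs o s : triple (outs o) s (push s o) (size o).+1.
Proof.
elim: o => [|b o IH] /=; first by case: s => ? ? ?; apply: triple_skip.
rewrite -addn1; apply: triple_seq IH _.
exact: triple_out.
Qed.

Definition out_times (r : 'I_R) (o : seq bool) := iter_reg r (outs o).

Lemma triple_out_times (r : 'I_R) o s : r != x ->
  x < size (regs s) -> r < size (regs s) -> reg s x = 0 ->
  triple (out_times r o) s (push s (flatten (nseq (reg s r) o)))
    (reg s r * (size o + 7) + 2).
Proof.
move=> ne_rx lt_x lt_r x0.
pose f j := push s (flatten (nseq j o)).
have f0 : f 0 = s by rewrite /f; case: s {lt_x lt_r x0 f}.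
have := @triple_iter_reg r (outs o) f (size o).+1; rewrite !f0 addSnnS;
apply=> //.
  by rewrite eq_sym.
move=> j a b _; apply: triple_weaken (triple_outs _ _) _ _ => //.
by rewrite /push /upd /= catA.
Qed.

(* A literal whose variable is a sum of counters plus a constant. *)
Definition lit_expr := (seq 'I_R * nat * bool)%type.

Definition lit_val (s : store) (l : lit_expr) : literal :=
  (sumn [seq reg s (r : 'I_R) | r <- l.1.1] + l.1.2, l.2).

(** In unary a sum is a concatenation: every counter prints its ones in front of the others, and the
    sum itself is never computed. *)
Fixpoint emit_var (rs : seq 'I_R) (c : nat) : routine sym k :=
  if rs is r :: rs' then seqr (emit_var rs' c) (out_times r [:: true])
  else outs (rcons (nseq c true) false).

Lemma triple_emit_var rs c s W : x < size (regs s) -> reg s x = 0 ->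
  all (fun r : 'I_R => [&& r != x, r < size (regs s) & reg s r <= W]) rs ->
  triple (emit_var rs c) s
    (push s (enc_nat (sumn [seq reg s (r : 'I_R) | r <- rs] + c)))
    (size rs * (8 * W + 2) + c + 2).
Proof.
move=> lt_x x0; elim: rs => [_|r rs IH /= /andP[/and3P[ne_rx lt_r le_W]
  /IH{}IH]].
  by apply: triple_weaken (triple_outs _ _) _ _;
  rewrite //= size_rcons size_nseq; lia.
have hr := @triple_out_times r [:: true]
  (push s (enc_nat (sumn [seq reg s (r : 'I_R) | r <- rs] + c))) ne_rx lt_x
    lt_r x0.
apply: triple_weaken (triple_seq IH hr) _ _.
  have flat m a : flatten (nseq m [:: true]) ++ enc_nat a = enc_nat (m + a).
    by elim: m => //= m ->.
  by rewrite /push /= catA flat addnA.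
by move: le_W; rewrite /reg /= mulSn; lia.
Qed.

Definition emit_lit (l : lit_expr) : routine sym k :=
  seqr (emit_var l.1.1 l.1.2) (outs [:: true; l.2]).

Fixpoint emit_lits (ls : seq lit_expr) : routine sym k :=
  if ls is l :: ls' then seqr (emit_lits ls') (emit_lit l) else outs [:: false].

Definition emit_clause (ls : seq lit_expr) : routine sym k :=
  seqr (emit_lits ls) (outs [:: true]).

(** Uniform bounds, met by all literals printed below, that make the cost of a literal linear in
    [W]. *)
Definition good_lit (s : store) (W : nat) (l : lit_expr) : bool :=
  [&& size l.1.1 <= 5, l.1.2 <= 2 &
  all (fun r : 'I_R => [&& r != x, r < size (regs s) & reg s r <= W]) l.1.1].

Lemma triple_emit_clause ls s W : x < size (regs s) -> reg s x = 0 ->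
  all (good_lit s W) ls ->
  triple (emit_clause ls) s
    (Store (regs s) (input s) (enc_clauses [:: [seq lit_val s l | l <- ls]]
      (output s)))
    (size ls * (40 * W + 20) + 5).
Proof.
move=> lt_x x0 good_ls; have : triple (emit_lits ls) s
    (push s (enc_seq enc_literal [seq lit_val s l | l <- ls]))
    (size ls * (40 * W + 20) + 2).
  elim: ls good_ls => [_|l ls IH /= /andP[/and3P[le5 le2 good_l] /IH{}IH]].
    exact: triple_outs.
  set o := enc_seq _ _ in IH.
  have hl := @triple_emit_var l.1.1 l.1.2 (push s o) W lt_x x0 good_l.
  apply: triple_weaken (triple_seq IH (triple_seq hl (triple_outs _ _))) _ _.
    by rewrite /push /= /enc_seq /= rcons_cat /= -catA.
  rewrite /=; move: (size ls) (size l.1.1) le5 => a b le5.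
  by have := leq_mul le5 (leqnn (8 * W + 2)); lia.
move=> h; apply: triple_weaken (triple_seq h (triple_outs _ _)) _ _;
last by rewrite /=; lia.
by rewrite enc_clauses1.
Qed.

End Macros.

Definition nb_regs : nat := 21.
(* rX, rW: scratch; rA1 = rA2: the length of a one-hot vector; rBd: the bound
   on the number of clauses; rCnt: the number of levels below the top one; rZ:
   the length of a row; rP0, rP, rQ: the first variables of the rows of e at the
   levels 0, h and h.+1; rS: 0 or rZ, for the two halves of a number; rTau: the
   next guard; rV: the variable or the number being handled; rB: 2 ^ h; rU1,
   rU2, rU3: 2 * n + 1; the others count the iterations of loops. *)
Definition rX : 'I_nb_regs := @Ordinal nb_regs 0 isT.
Definition rW : 'I_nb_regs := @Ordinal nb_regs 1 isT.
Definition rA1 : 'I_nb_regs := @Ordinal nb_regs 2 isT.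
Definition rA2 : 'I_nb_regs := @Ordinal nb_regs 3 isT.
Definition rBd : 'I_nb_regs := @Ordinal nb_regs 4 isT.
Definition rCnt : 'I_nb_regs := @Ordinal nb_regs 5 isT.
Definition rZ : 'I_nb_regs := @Ordinal nb_regs 6 isT.
Definition rP0 : 'I_nb_regs := @Ordinal nb_regs 7 isT.
Definition rP : 'I_nb_regs := @Ordinal nb_regs 8 isT.
Definition rQ : 'I_nb_regs := @Ordinal nb_regs 9 isT.
Definition rS : 'I_nb_regs := @Ordinal nb_regs 10 isT.
Definition rTau : 'I_nb_regs := @Ordinal nb_regs 11 isT.
Definition rT : 'I_nb_regs := @Ordinal nb_regs 12 isT.
Definition rP1 : 'I_nb_regs := @Ordinal nb_regs 13 isT.
Definition rP2 : 'I_nb_regs := @Ordinal nb_regs 14 isT.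
Definition rV : 'I_nb_regs := @Ordinal nb_regs 15 isT.
Definition rB : 'I_nb_regs := @Ordinal nb_regs 16 isT.
Definition rK : 'I_nb_regs := @Ordinal nb_regs 17 isT.
Definition rU1 : 'I_nb_regs := @Ordinal nb_regs 18 isT.
Definition rU2 : 'I_nb_regs := @Ordinal nb_regs 19 isT.
Definition rU3 : 'I_nb_regs := @Ordinal nb_regs 20 isT.

Definition st (w a1 a2 bd cnt z p0 p q S tau t p1 p2 v b k u1 u2 u3 : nat)
    (i o : seq bool) : store :=
  Store [:: 0; w; a1; a2; bd; cnt; z; p0; p; q; S; tau; t; p1; p2; v; b; k;
            u1; u2; u3] i o.

Section Rows.

Variable c : nat.
Local Notation H := (height c).
Local Notation Z := (width c).

Definition row_start (h : nat) : nat := (3 * (H - h) + 1) * Z.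

Lemma e_varE h u : e_var c h u = row_start h + u.
Proof. by []. Qed.

Lemma r_varE h side v : r_var c h side v = row_start h + (Z + (side * Z + v)).
Proof. by rewrite /r_var /cell_var /row_start !mulnDl mul1n; lia. Qed.

Lemma g_varE i : g_var c i = row_start 0 + (Z + i).
Proof. by rewrite /g_var /cell_var /row_start subn0 !mulnDl mul1n; lia. Qed.

Lemma c_varE i : c_var c i = row_start 0 + (Z + (Z + i)).
Proof. by rewrite /c_var /cell_var /row_start subn0 !mulnDl mul1n; lia. Qed.

Lemma row_startS h : h < H -> row_start h - Z - Z - Z = row_start h.+1.
Proof.
move=> lt_h; rewrite /row_start.
have -> : 3 * (H - h) + 1 = 3 * (H - h.+1) + 1 + 3 by lia.
by rewrite mulnDl; move: ((_ + 1) * Z) => x; lia.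
Qed.

Lemma exp_W h : h <= H -> 2 ^ h.+1 <= Z.
Proof.
move=> le_h; rewrite /width /dexp leq_exp2l //.
by apply: leq_ltn_trans le_h _; apply: ltn_expl.
Qed.

Variable W : nat.
Hypothesis rows_W : nb_rows c * Z <= W.

Lemma row_start_W h : row_start h <= W.
Proof.
apply: leq_trans rows_W; rewrite leq_mul2r /nb_rows.
by apply/orP; right; have := leq_subr h H; lia.
Qed.

Lemma Z_W : 3 * Z <= W.
Proof. by apply: leq_trans rows_W; rewrite leq_mul2r /nb_rows; lia. Qed.

Lemma level_W : c <= W.
Proof.
have := Z_W; have := exp_W (leqnn H).
by have := ltn_expl H.+1 (isT : 1 < 2); have : c < H := ltnSn c; lia.
Qed.

End Rows.

(** * Output of the matrix *)

Section Emission.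

Variables (sym : finType) (blank : sym) (bit : bool -> sym).
Hypotheses (bit_inj : injective bit) (bit_blank : forall b, bit b != blank).
Variable w : nat.
Let kt := nb_regs.+1 + w.+1.

Local Notation triple := (triple blank bit (R := nb_regs) (w := w)).
Local Notation inc := (@inc sym nb_regs w).
Local Notation for_ := (@for_ sym bit nb_regs w).
Local Notation advance := (@advance sym nb_regs w).
Local Notation while_input := (@while_input sym bit nb_regs w).
Local Notation if_input := (@if_input sym bit nb_regs w).
Local Notation add_to := (@add_to sym bit nb_regs w rX).
Local Notation sub_from := (@sub_from sym bit nb_regs w rX).
Local Notation clear := (@clear sym bit nb_regs w).
Local Notation emit := (@emit_clause sym bit nb_regs w rX).
Local Notation "m1 ;; m2" := (@seqr sym kt m1 m2) (at level 70, right
  associativity).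

Definition lit_ok (l : lit_expr nb_regs) : bool :=
  [&& size l.1.1 <= 5, l.1.2 <= 2 & all (fun r => r != rX) l.1.1].

(** Four literals at [40 * W + 20] steps each, and 5 steps for the delimiters. *)
Definition emit_cost (W : nat) : nat := 160 * W + 85.

Lemma triple_emit ls s C W : size (regs s) = nb_regs -> reg s rX = 0 ->
  all (leq^~ W) (regs s) -> size ls <= 4 -> all lit_ok ls ->
  [seq lit_val s l | l <- ls] = C ->
  triple (emit ls) s (Store (regs s) (input s) (enc_clauses [:: C] (output s)))
    (emit_cost W).
Proof.
move=> size_s x0 le_W size_ls ok_ls <-.
have lt_s (r : 'I_nb_regs) : r < size (regs s) by rewrite size_s.
have good : all (good_lit rX s W) ls.
  apply: sub_all ok_ls => l /and3P[l5 l2 ne]; rewrite /good_lit l5 l2.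
  apply: sub_all ne => r -> /=; rewrite lt_s /=.
  by apply: (allP le_W); apply: mem_nth.
apply: triple_weaken (triple_emit_clause bit_blank w (lt_s rX) x0 good) _ _ =>
  //.
by have := leq_mul size_ls (leqnn (40 * W + 20)); rewrite /emit_cost; lia.
Qed.

Lemma triple_add (d r : 'I_nb_regs) s : d != rX -> r != rX -> d != r ->
  size (regs s) = nb_regs -> reg s rX = 0 ->
  triple (add_to d r) s (upd s d (reg s d + reg s r)) (reg s r * 7 + 2).
Proof. by move=> ? ? ? size_s ?; apply: triple_add_to; rewrite ?size_s. Qed.

Lemma triple_sub (d r : 'I_nb_regs) s : d != rX -> r != rX -> d != r ->
  size (regs s) = nb_regs -> reg s rX = 0 ->
  triple (sub_from d r) s (upd s d (reg s d - reg s r)) (reg s r * 8 + 2).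
Proof. by move=> ? ? ? size_s ?; apply: triple_sub_from; rewrite ?size_s. Qed.

Lemma triple_clr (r : 'I_nb_regs) s : size (regs s) = nb_regs ->
  triple (clear r) s (upd s r 0) (reg s r * 2).+1.
Proof. by move=> size_s; apply: triple_clear; rewrite ?size_s. Qed.

Lemma triple_loop (s : nat -> store) n t (i r : 'I_nb_regs) m s0 s1 t' :
  i != r -> s0 = s 0 -> s1 = s n ->
  (forall j, j <= n -> upd (upd (s j) r n) i 0 = s j) ->
  (forall j, j < n -> triple m (upd (upd (s j) r (n - j)) i j)
                               (upd (upd (s j.+1) r (n - j)) i j) t) ->
  n * (t + 6) + 2 <= t' -> triple (for_ i r m) s0 s1 t'.
Proof.
move=> ne -> -> fixs body le_t; apply: triple_le le_t _.
exact: (triple_for bit_blank).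
Qed.

Lemma triple_inc_st (r : 'I_nb_regs) s s' :
  s' = upd s r (reg s r).+1 -> triple (inc r) s s' 1.
Proof. by move->; apply: triple_inc. Qed.

(** [for_] uses up its bound while it runs, so nested loops over one number need the two copies
    [rA1] and [rA2]. *)
Definition square : routine sym kt :=
  for_ rP1 rA1 (for_ rP2 rA2 (inc rW)) ;; clear rA1 ;; clear rA2 ;;
  add_to rA1 rW ;; add_to rA2 rW ;; clear rW.

Lemma triple_square a bd cnt z p0 p q S tau t v b k u1 u2 u3 i o :
  triple square
    (st 0 a a bd cnt z p0 p q S tau t 0 0 v b k u1 u2 u3 i o)
    (st 0 (a * a) (a * a) bd cnt z p0 p q S tau t 0 0 v b k u1 u2 u3 i o)
    (50 * (a * a) + 50).
Proof.
pose s1 x := st x a a bd cnt z p0 p q S tau t 0 0 v b k u1 u2 u3 i o.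
have loop : triple (for_ rP1 rA1 (for_ rP2 rA2 (inc rW))) (s1 0) (s1 (a * a))
    (a * (a * 7 + 2 + 6) + 2).
  apply: (triple_loop (s := fun j => s1 (j * a)) (n := a) (t := a * 7 + 2)) =>
    // j lt_j.
  pose s2 l := st (j * a + l) (a - j) a bd cnt z p0 p q S tau t j 0 v b k u1 u2
    u3 i o.
  apply: (triple_loop (s := s2) (n := a) (t := 1)) => //.
  - by rewrite /s2 addn0.
  - by rewrite /s2 -mulSnr.
  - by move=> l lt_l; apply: triple_inc_st; rewrite /s2 /upd /reg /= addnS.
apply: triple_weaken (triple_seq loop (triple_seq (triple_clr rA1 _)
  (triple_seq (triple_clr rA2 _) (triple_seq (triple_add _ _ _ _ _)
  (triple_seq (triple_add _ _ _ _ _) (triple_clr rW _)))))) _ _ => //.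
by rewrite /reg /upd /=; nia.
Qed.

Section Levels.

Variables (c W : nat).
Local Notation H := (height c).
Local Notation Z := (width c).
Local Notation row_start := (row_start c).
(** The pairs come in the order of increasing [v2 * a + v1], so [rV] obtains this index by counting,
    without a multiplication. *)
Definition idx_loop : routine sym kt :=
  for_ rP2 rA1 (for_ rP1 rA2 (
    emit [:: ([:: rP0; rZ; rTau], 0, false); ([:: rP; rZ; rP1], 0, false);
             ([:: rP; rZ; rZ; rP2], 0, false); ([:: rQ; rZ; rS;
             rV], 0, true)] ;;
    inc rV)).

Definition idx_cost : nat := W * (W * (emit_cost W + 1 + 6) + 2 + 6) + 2.

Lemma triple_idx h side a bd cnt tau t b k u i o :
  all (leq^~ W) [:: a * a; bd; cnt; Z; row_start 0; row_start h; row_start h.+1;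
    side * Z; tau; t; b; k; u] ->
  triple idx_loop
    (st 0 a a bd cnt Z (row_start 0) (row_start h) (row_start h.+1) (side * Z)
       tau t 0 0 0 b k u u u i o)
    (st 0 a a bd cnt Z (row_start 0) (row_start h) (row_start h.+1) (side * Z)
       tau t 0 0 (a * a) b k u u u i
       (enc_clauses (flatten [seq [seq [:: (g_var c tau, false);
       (r_var c h 0 v1, false);
                       (r_var c h 1 v2, false);
                       (r_var c h.+1 side (v2 * a + v1), true)]
               | v1 <- iota 0 a] | v2 <- iota 0 a]) o))
    idx_cost.
Proof.
move=> /= leW; have le_a : a <= W by nia.
pose F v2 v1 := [:: (g_var c tau, false); (r_var c h 0 v1, false);
  (r_var c h 1 v2, false); (r_var c h.+1 side (v2 * a + v1), true)].
pose s1 j := st 0 a a bd cnt Z (row_start 0) (row_start h) (row_start h.+1)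
  (side * Z) tau t 0 0 (j * a) b k u u u i
  (enc_clauses (flatten [seq [seq F v2 v1 | v1 <- iota 0 a] | v2 <- iota 0 j])
    o).
apply: (triple_loop (s := s1) (n := a) (t := a * (emit_cost W + 1 + 6) + 2)) =>
  //.
  move=> j lt_j.
  pose s2 l := st 0 (a - j) a bd cnt Z (row_start 0) (row_start h) (row_start
    h.+1)
    (side * Z) tau t 0 j (j * a + l) b k u u u i
    (enc_clauses [seq F j v1 | v1 <- iota 0 l] (output (s1 j))).
  apply: (triple_loop (s := s2) (n := a) (t := emit_cost W + 1)) => //.
  - by rewrite /s2 addn0.
  - by rewrite /s2 -mulSnr /s1 flatten_iotaS enc_clauses_cat.
  - move=> l lt_l; apply: triple_weaken (triple_seq (triple_emit (C := F j l)
      (W := W) _ _ _ _ _ _) (triple_inc rV _)) _ _ => //.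
    + have lt_jl : j * a + l <= a * a by nia.
      by rewrite /=; lia.
    + by rewrite /F !r_varE g_varE /lit_val /reg /= !addn0 !mul1n.
    + by rewrite /s2 enc_clauses_iotaS add0n addnS.
by rewrite /idx_cost leq_add2r leq_mul // !leq_add2r leq_mul2r le_a orbT.
Qed.

Definition double_b : routine sym kt :=
  add_to rW rB ;; add_to rB rW ;; clear rW.

Lemma triple_double_b a1 a2 bd cnt z p0 p q S tau t p1 p2 v b k u1 u2 u3 i o :
  triple double_b
    (st 0 a1 a2 bd cnt z p0 p q S tau t p1 p2 v b k u1 u2 u3 i o)
    (st 0 a1 a2 bd cnt z p0 p q S tau t p1 p2 v (2 * b) k u1 u2 u3 i o)
    (16 * b + 5).
Proof.
apply: triple_weaken (triple_seq (triple_add _ _ _ _ _)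
  (triple_seq (triple_add _ _ _ _ _) (triple_clr rW _))) _ _ => //.
  by rewrite /upd /reg /= mul2n addnn.
by rewrite /reg /=; lia.
Qed.

Hypothesis rows_W : nb_rows c * Z <= W.

(** In iteration [t], [rB] has dropped to [2 ^ h - t] and [rT] is [t]; so the offset [2 ^ h + t] is
    [rB] plus twice [rT]. *)
Definition side_loop : routine sym kt :=
  for_ rT rB (
    emit [:: ([:: rP0; rZ; rTau], 0, false); ([:: rP; rB; rT; rT], 0, true);
             ([:: rQ; rTau], 0, true)] ;;
    emit [:: ([:: rP0; rZ; rTau], 0, false); ([:: rP; rB; rT; rT], 0, false);
             ([:: rQ; rTau], 0, false)] ;;
    idx_loop ;; clear rV ;; inc rTau).

Definition side_cost : nat := W * (2 * emit_cost W + idx_cost + (2 * W).+1 + 1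
  + 6) + 2.

Lemma triple_side h side (a := dexp h.-1) cnt k u i o : 0 < h <= c -> side < 2
  ->
  cnt <= W -> k <= W -> u <= W ->
  triple side_loop
    (st 0 a a 0 cnt Z (row_start 0) (row_start h) (row_start h.+1) (side * Z)
       (guard_index h side 0) 0 0 0 0 (2 ^ h) k u u u i o)
    (st 0 a a 0 cnt Z (row_start 0) (row_start h) (row_start h.+1) (side * Z)
       (guard_index h side (2 ^ h)) 0 0 0 0 (2 ^ h) k u u u i
       (enc_clauses (flatten [seq level_clauses c h side t | t <- iota 0 (2 ^
         h)]) o))
    side_cost.
Proof.
move=> /andP[h_gt0 le_h] lt_side le_cnt le_k le_u.
have ZW := (Z_W rows_W); have bZ : 2 ^ h.+2 <= Z by apply: exp_W.
have haa : a * a = dexp h by rewrite -dexpS prednK.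
have aZ : dexp h <= Z by apply: leq_dexp_width; apply: leqW.
have aW : a <= W.
  by have := @leq_dexp_width c h.-1 (leq_trans (leq_pred h) (leqW le_h));
  rewrite -/a; lia.
have SW : side * Z <= W by case: side lt_side => [|[|]] // _; rewrite ?mul1n;
lia.
have bW : 2 ^ h <= W by move: bZ; rewrite !expnS; lia.
have pW := (row_start_W rows_W).
pose s j := st 0 a a 0 cnt Z (row_start 0) (row_start h) (row_start h.+1) (side
  * Z)
  (guard_index h side j) 0 0 0 0 (2 ^ h) k u u u i
  (enc_clauses (flatten [seq level_clauses c h side t | t <- iota 0 j]) o).
apply: (triple_loop (s := s) (n := 2 ^ h)
  (t := 2 * emit_cost W + idx_cost + (2 * W).+1 + 1)) => //.
  move=> j lt_j; set s0 := upd _ _ _.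
  have tauZ : guard_index h side j <= W.
    by have := guard_index_lt lt_side lt_j; lia.
  pose D b := [:: (g_var c (guard_index h side j), false);
  (e_var c h (2 ^ h + j), b);
      (e_var c h.+1 (guard_index h side j), b)].
  have emitD b o' : triple (emit [:: ([:: rP0; rZ; rTau], 0, false);
      ([:: rP; rB; rT; rT], 0, b); ([:: rQ; rTau], 0, b)])
      (Store (regs s0) (input s0) o')
      (Store (regs s0) (input s0) (enc_clauses [:: D b] o')) (emit_cost W).
    apply: (triple_emit (C := D b) (W := W)) => //.
      by move: (pW 0) (pW h) (pW h.+1); rewrite /=; lia.
    have ej : 2 ^ h - j + (j + j) = 2 ^ h + j by lia.
    by rewrite /D g_varE !e_varE /lit_val /reg /= !addn0 ej.
  have idx := @triple_idx h side a 0 cnt (guard_index h side j) j (2 ^ h - j) k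
    u i
    (enc_clauses [:: D false] (enc_clauses [:: D true] (output (s j)))).
  have {}idx := idx _; apply: triple_weaken (triple_seq (emitD true _)
    (triple_seq (emitD false _) (triple_seq (idx _)
    (triple_seq (triple_clr rV _) (triple_inc rTau _))))) _ _ => //.
  - by move: (pW 0) (pW h) (pW h.+1); rewrite /= haa; lia.
  - rewrite /s enc_flatten_iotaS add0n /level_clauses enc_clauses_cat.
    rewrite -[diff_clauses _ _ _ _]/([:: D true] ++ [:: D false])
      enc_clauses_cat.
    by rewrite /guard_index addnS.
  - by rewrite /reg /= haa; lia.
by rewrite /side_cost leq_add2r leq_mul2r bW orbT.
Qed.

Definition sub3 (d : 'I_nb_regs) : routine sym kt :=
  sub_from d rZ ;; sub_from d rZ ;; sub_from d rZ.

(** The rows are shifted before the output and the lengths updated after it, so that the loop can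
    start from the counters of the base phase. *)
Definition level_body : routine sym kt :=
  sub3 rP ;; sub3 rQ ;; side_loop ;; add_to rS rZ ;; side_loop ;;
  sub_from rS rZ ;; square ;; double_b.

Definition level_cost : nat := 2 * side_cost + 150 * W + 200.

Definition level_emitted (h : nat) : cnf :=
  flatten [seq flatten [seq level_clauses c h side t | t <- iota 0 (2 ^ h)]
          | side <- iota 0 2].

Lemma triple_level h cnt k u i o : 0 < h <= c ->
  cnt <= W -> k <= W -> u <= W ->
  triple level_body
    (st 0 (dexp h.-1) (dexp h.-1) 0 cnt Z (row_start 0) (row_start h.-1)
      (row_start h)
       0 (2 ^ h.+1) 0 0 0 0 (2 ^ h) k u u u i o)
    (st 0 (dexp h) (dexp h) 0 cnt Z (row_start 0) (row_start h) (row_start h.+1)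
       0 (2 ^ h.+2) 0 0 0 0 (2 ^ h.+1) k u u u i (enc_clauses (level_emitted h)
         o))
    level_cost.
Proof.
move=> lt_h le_cnt le_k le_u; have /andP[h_gt0 le_h] := lt_h.
(* Successive halves and levels have consecutive guards, so [rTau] is only ever incremented. *)
have g0 : guard_index h 0 0 = 2 ^ h.+1 by rewrite /guard_index !addn0.
have g1 : guard_index h 0 (2 ^ h) = guard_index h 1 0 by rewrite /guard_index;
lia.
have g2 : guard_index h 1 (2 ^ h) = 2 ^ h.+2 by rewrite /guard_index !expnS;
lia.
have haa : dexp h.-1 * dexp h.-1 = dexp h by rewrite -dexpS prednK.
have side0 := triple_side i o lt_h (isT : 0 < 2) le_cnt le_k le_u.
have side1 := triple_side i (enc_clauses
  (flatten [seq level_clauses c h 0 t | t <- iota 0 (2 ^ h)]) o)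
  lt_h (isT : 1 < 2) le_cnt le_k le_u.
rewrite mul0n g0 g1 in side0; rewrite mul1n g2 in side1.
have e1 : row_start h.-1 - Z - Z - Z = row_start h.
  by rewrite row_startS prednK // ltnW.
have sp := triple_seq (@triple_sub rP rZ _ isT isT isT _ _) (triple_seq
  (@triple_sub rP rZ _ isT isT isT _ _) (@triple_sub rP rZ _ isT isT isT _ _)).
have sq := triple_seq (@triple_sub rQ rZ _ isT isT isT _ _) (triple_seq
  (@triple_sub rQ rZ _ isT isT isT _ _) (@triple_sub rQ rZ _ isT isT isT _ _)).
have {}sp := sp (st 0 (dexp h.-1) (dexp h.-1) 0 cnt Z (row_start 0) (row_start
  h.-1) (row_start h)
       0 (2 ^ h.+1) 0 0 0 0 (2 ^ h) k u u u i o) erefl erefl erefl erefl erefl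
         erefl.
have {}sq := sq (st 0 (dexp h.-1) (dexp h.-1) 0 cnt Z (row_start 0) (row_start
  h) (row_start h)
       0 (2 ^ h.+1) 0 0 0 0 (2 ^ h) k u u u i o) erefl erefl erefl erefl erefl
         erefl.
rewrite /upd /reg /= e1 in sp; rewrite /upd /reg /= row_startS // in sq.
pose s' S tau o' := st 0 (dexp h.-1) (dexp h.-1) 0 cnt Z (row_start 0)
  (row_start h)
  (row_start h.+1) S tau 0 0 0 0 (2 ^ h) k u u u i o'.
have sadd tau o' := @triple_add rS rZ (s' 0 tau o') isT isT isT erefl erefl.
have ssub tau o' := @triple_sub rS rZ (s' Z tau o') isT isT isT erefl erefl.
apply: triple_weaken (triple_seq sp (triple_seq sq (triple_seq side0 (triple_seq
  (sadd _ _) (triple_seq side1 (triple_seq (ssub _ _) (triple_seq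
  (triple_square _ _ _ _ _ _ _ _ _ _ _ _ _ _ _ _ _ _)
  (triple_double_b _ _ _ _ _ _ _ _ _ _ _ _ _ _ _ _ _ _ _ _ _)))))))) _ _ => //.
- rewrite subnn haa -expnS /level_emitted.
  by rewrite [flatten [seq flatten _ | _ <- _]]/= cats0 enc_clauses_cat.
- have := (Z_W rows_W); have := @leq_dexp_width c h (leqW le_h);
  have := @exp_W c h (leqW le_h).
  by rewrite /reg /= haa /level_cost expnS; lia.
Qed.

Definition levels : routine sym kt := for_ rK rCnt level_body.

Lemma triple_levels u i o : u <= W ->
  triple levels
    (st 0 (dexp 0) (dexp 0) 0 c Z (row_start 0) (row_start 0) (row_start 1)
       0 (2 ^ 2) 0 0 0 0 (2 ^ 1) 0 u u u i o)
    (st 0 (dexp c) (dexp c) 0 c Z (row_start 0) (row_start c) (row_start c.+1)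
       0 (2 ^ c.+2) 0 0 0 0 (2 ^ c.+1) 0 u u u i
       (enc_clauses (flatten [seq level_emitted h | h <- iota 1 c]) o))
    (W * (level_cost + 6) + 2).
Proof.
move=> le_u; pose s j := st 0 (dexp j) (dexp j) 0 c Z (row_start 0) (row_start
  j)
  (row_start j.+1) 0 (2 ^ j.+2) 0 0 0 0 (2 ^ j.+1) 0 u u u i
  (enc_clauses (flatten [seq level_emitted h | h <- iota 1 j]) o).
apply: (triple_loop (s := s) (n := c) (t := level_cost)) => //; last first.
  by rewrite leq_add2r leq_mul2r (level_W rows_W) orbT.
move=> j lt_j; have cW := (level_W rows_W); have h_ok : 0 < j.+1 <= c by [].
have le_cnt : c - j <= W by lia.
have le_k : j <= W by lia.
apply: triple_weaken (triple_level _ _ h_ok le_cnt le_k le_u) _ _ => //.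
by rewrite /s enc_flatten_iotaS.
Qed.

Definition diff_lits (b : bool) : seq (lit_expr nb_regs) :=
  [:: ([:: rP0; rZ; rTau], 0, false); ([:: rP], 1, b); ([:: rQ; rTau], 0, b)].

Definition base_lits (b : bool) (v : nat) : seq (lit_expr nb_regs) :=
  [:: ([:: rP0; rZ; rTau], 0, false); ([:: rP], 1, b); ([:: rQ; rZ;
  rS], v, true)].

Definition base_body : routine sym kt :=
  emit (diff_lits true) ;; emit (diff_lits false) ;;
  emit (base_lits true 0) ;; emit (base_lits false 1) ;; inc rTau.

Lemma triple_base_body side (g := guard_index 0 side 0) a cnt b u i o : side <
  2 ->
  a <= W -> cnt <= W -> b <= W -> u <= W ->
  triple base_body
    (st 0 a a 0 cnt Z (row_start 0) (row_start 0) (row_start 1) (side * Z)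
       g 0 0 0 0 b 0 u u u i o)
    (st 0 a a 0 cnt Z (row_start 0) (row_start 0) (row_start 1) (side * Z)
       g.+1 0 0 0 0 b 0 u u u i (enc_clauses (base_clauses c side) o))
    (4 * emit_cost W + 1).
Proof.
move=> lt_side le_a le_cnt le_b le_u; have ZW := (Z_W rows_W);
have pW := (row_start_W rows_W).
have gW : g <= W.
  have := guard_index_lt lt_side (isT : 0 < 2 ^ 0).
  by have := exp_W (ltn0Sn c : 1 <= H); rewrite -/g; lia.
have SW : side * Z <= W by case: side lt_side {g gW} => [|[|]] // _;
rewrite ?mul1n; lia.
pose s o' := st 0 a a 0 cnt Z (row_start 0) (row_start 0) (row_start 1) (side *
  Z)
       g 0 0 0 0 b 0 u u u i o'.
have leW o' : all (leq^~ W) (regs (s o')).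
  by move: (pW 0) (pW 1); rewrite /=; lia.
have em ls C o' : size ls <= 4 -> all lit_ok ls -> [seq lit_val (s o') l | l <-
  ls] = C ->
    triple (emit ls) (s o') (s (enc_clauses [:: C] o')) (emit_cost W).
  by move=> *; apply: (triple_emit (C := C) (W := W)).
have eqd b' : [:: (row_start 0 + (Z + (g + 0)) + 0, false);
(row_start 0 + 0 + 1, b');
    (row_start 1 + (g + 0) + 0, b')] =
    [:: (g_var c g, false); (e_var c 0 (2 ^ 0 + 0), b'); (e_var c 1 g, b')].
  by rewrite g_varE !e_varE !addn0.
have eqb b' v : [:: (row_start 0 + (Z + (g + 0)) + 0, false);
(row_start 0 + 0 + 1, b');
    (row_start 1 + (Z + (side * Z + 0)) + v, true)] =
    [:: (g_var c g, false); (e_var c 0 1, b'); (r_var c 1 side v, true)].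
  by rewrite g_varE e_varE r_varE !addn0 -!addnA.
apply: triple_weaken (triple_seq (em (diff_lits true) _ _ isT isT (eqd true))
  (triple_seq (em (diff_lits false) _ _ isT isT (eqd false))
  (triple_seq (em (base_lits true 0) _ _ isT isT (eqb true 0))
  (triple_seq (em (base_lits false 1) _ _ isT isT (eqb false 1))
  (triple_inc rTau _))))) _ _ => //; last by lia.
rewrite /s /base_clauses /diff_clauses -/g; congr Store.
by rewrite -!enc_clauses_cat.
Qed.

Definition base_phase : routine sym kt :=
  base_body ;; add_to rS rZ ;; base_body ;; sub_from rS rZ.

Lemma triple_base a cnt b u i o : a <= W -> cnt <= W -> b <= W -> u <= W ->
  triple base_phase
    (st 0 a a 0 cnt Z (row_start 0) (row_start 0) (row_start 1) 0
       2 0 0 0 0 b 0 u u u i o)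
    (st 0 a a 0 cnt Z (row_start 0) (row_start 0) (row_start 1) 0
       (2 ^ 2) 0 0 0 0 b 0 u u u i
       (enc_clauses (flatten [seq base_clauses c side | side <- iota 0 2]) o))
    (8 * emit_cost W + 15 * W + 10).
Proof.
move=> le_a le_cnt le_b le_u.
have b0 := triple_base_body i o (isT : 0 < 2) le_a le_cnt le_b le_u.
have b1 := triple_base_body i (enc_clauses (base_clauses c 0) o) (isT : 1 < 2)
  le_a le_cnt le_b le_u.
rewrite mul1n in b1.
pose s' S tau o' := st 0 a a 0 cnt Z (row_start 0) (row_start 0) (row_start 1) S
  tau 0 0 0 0 b 0 u u u i o'.
have sadd tau o' := @triple_add rS rZ (s' 0 tau o') isT isT isT erefl erefl.
have ssub tau o' := @triple_sub rS rZ (s' Z tau o') isT isT isT erefl erefl.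
apply: triple_weaken (triple_seq b0 (triple_seq (sadd _ _) (triple_seq b1 (ssub
  _ _)))) _ _ => //.
- have -> : flatten [seq base_clauses c side | side <- iota 0 2] =
    base_clauses c 0 ++ base_clauses c 1 by rewrite -[base_clauses c 1]cats0.
  by rewrite enc_clauses_cat /upd /reg /= subnn.
- by have := (Z_W rows_W); rewrite /reg /=; lia.
Qed.

(** After the levels [rTau] has reached [nb_guards], and thus serves as the bound of this loop. *)
Definition chain_phase : routine sym kt :=
  emit [:: ([:: rP0; rZ; rZ], 1, true)] ;;
  for_ rT rTau (
    emit [:: ([:: rP0; rZ; rZ; rT], 0, false); ([:: rP0; rZ; rT], 0, true);
             ([:: rP0; rZ; rZ; rT], 1, true)]).

Lemma triple_chain a q b u i o : a <= W -> q <= W -> b <= W -> u <= W ->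
  triple chain_phase
    (st 0 a a 0 c Z (row_start 0) (row_start c) q 0 (nb_guards c) 0 0 0 0 b 0 u
      u u i o)
    (st 0 a a 0 c Z (row_start 0) (row_start c) q 0 (nb_guards c) 0 0 0 0 b 0 u
      u u i
      (enc_clauses ([:: [:: (c_var c 1, true)]] ++
         [seq chain_clause c i | i <- iota 0 (nb_guards c)]) o))
    (emit_cost W + (W * (emit_cost W + 6) + 2)).
Proof.
move=> le_a le_q le_b le_u; have ZW := (Z_W rows_W);
have pW := (row_start_W rows_W); have cW := (level_W rows_W).
have TW : nb_guards c <= W by rewrite /nb_guards -expnS;
have := exp_W (leqnn H); lia.
rewrite enc_clauses_cat; apply: triple_seq.
  apply: (triple_emit (C := [:: (c_var c 1, true)]) (W := W)) => //.
    by move: (pW 0) (pW c); rewrite /=; lia.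
  by rewrite c_varE /lit_val /reg /= !addn0 -!addnA.
pose s j := st 0 a a 0 c Z (row_start 0) (row_start c) q 0 (nb_guards c) 0 0 0
  0 b 0 u u u i
      (enc_clauses [seq chain_clause c i | i <- iota 0 j] (enc_clauses [:: [::
        (c_var c 1, true)]] o)).
apply: (triple_loop (s := s) (n := nb_guards c) (t := emit_cost W)) => //;
last first.
  by rewrite leq_add2r leq_mul2r TW orbT.
move=> j lt_j; apply: triple_weaken (triple_emit (C := chain_clause c j) (W :=
  W) _ _ _ _ _ _) _ _ => //.
- by move: (pW 0) (pW c); rewrite /=; lia.
- by rewrite /chain_clause !c_varE g_varE /lit_val /reg /= !addn0 -!addnA addn1.
- by rewrite /s enc_clauses_iotaS.
Qed.

Definition top_lits : seq (lit_expr nb_regs) :=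
  [:: ([:: rP0; rZ], 1, false); ([:: rQ; rZ; rP1], 0, false)].

(** The sign is remembered by the control, the variable by [rV]. *)
Definition read_lit (b : bool) : routine sym kt :=
  advance ;; while_input (advance ;; inc rV) ;; advance ;;
  emit (rcons top_lits ([:: rV], 0, ~~ b)).

Definition read_clause : routine sym kt :=
  advance ;;
  while_input (advance ;; if_input (read_lit true) (read_lit false) ;;
  clear rV) ;;
  advance.

(** When the clauses are exhausted, the input head stays on the final false bit, so every remaining
    number gets the default clause. *)
Definition top_phase : routine sym kt :=
  for_ rP1 rA1 (if_input read_clause (emit top_lits)).

Definition top_cost : nat := 3 * (5 * W + emit_cost W + 8) + 4.

Section Top.

Variables (n a1 a2 p b u j : nat).
Hypotheses (le_n : n <= W) (le_j : j <= W).
Hypothesis le_s : all (leq^~ W) [:: a1; a2; p; b; u].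

Let s v i o := st 0 a1 a2 0 c Z (row_start 0) p (row_start H) 0 (nb_guards c)
  0 j 0 v b 0 u u u i o.

Let top_prefix : clause := [:: (g_var c 1, false); (r_var c H 0 j, false)].

Lemma top_store_W v i o : v <= W -> all (leq^~ W) (regs (s v i o)).
Proof.
move=> le_v; move: le_s (row_start_W rows_W 0) (row_start_W rows_W H) (Z_W
  rows_W) (level_W rows_W) (exp_W (leqnn H)).
by rewrite /= /nb_guards -expnS; lia.
Qed.

Lemma top_lits_val v i o : [seq lit_val (s v i o) l | l <- top_lits] =
  top_prefix.
Proof. by rewrite /top_prefix g_varE r_varE /lit_val /reg /= !addn0 -!addnA.
  Qed.

Lemma triple_read_lit x sign i o : x <= W ->
  triple (read_lit sign) (s 0 (sign :: enc_nat x ++ i) o)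
    (s x i (enc_clauses [:: rcons top_prefix (x, ~~ sign)] o)) (3 * W +
      emit_cost W + 3).
Proof.
move=> le_x; pose s' l := s l (enc_nat (x - l) ++ i) o.
have loop : triple (while_input (advance ;; inc rV)) (s' 0) (s' x) (x * 3).+1.
  have eS l : l < x -> x - l = (x - l.+1).+1 by move=> lt_l;
  rewrite -subSn // subSS.
  apply: (triple_while_input bit_inj bit_blank (t := 2)) => [l lt_l||l lt_l].
  - by rewrite /s' eS.
  - by rewrite /s' subnn.
  - apply: triple_weaken (triple_seq (triple_advance _) (triple_inc rV _)) _ _
      => //.
    by rewrite /s' (eS l).
rewrite /s' subn0 subnn in loop.
have em : triple (emit (rcons top_lits ([:: rV], 0, ~~ sign))) (s x i o)
    (s x i (enc_clauses [:: rcons top_prefix (x, ~~ sign)] o)) (emit_cost W).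
  apply: triple_emit (top_store_W i o le_x) _ _ _ => //.
  by rewrite map_rcons top_lits_val /lit_val /reg /= !addn0.
have adv : triple advance (s x ([:: false] ++ i) o) (s x i o) 1 :=
  triple_advance _.
have adv0 : triple advance (s 0 (sign :: enc_nat x ++ i) o) (s 0 (enc_nat x ++
  i) o) 1
  := triple_advance _.
apply: triple_weaken (triple_seq adv0 (triple_seq loop (triple_seq adv em))) _
  _ => //.
by lia.
Qed.

Lemma triple_read_clause (C : clause) i o : size C <= 3 ->
  all (fun l : literal => l.1 < n) C ->
  triple read_clause (s 0 (true :: enc_seq enc_literal C ++ i) o)
    (s 0 i (enc_clauses [seq rcons top_prefix (l.1, ~~ l.2) | l : literal <- C]
      o)) top_cost.-1.
Proof.
move=> le_C lt_C; pose s' l := s 0 (enc_seq enc_literal (drop l C) ++ i)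
  (enc_clauses [seq rcons top_prefix (l.1, ~~ l.2) | l : literal <- take l C]
    o).
have loop : triple (while_input (advance ;;
if_input (read_lit true) (read_lit false) ;;
    clear rV)) (s' 0) (s' (size C)) (size C * (5 * W + emit_cost W + 7).+1).+1.
  apply: (triple_while_input bit_inj bit_blank) => [l lt_l||l lt_l].
  - by rewrite /s' (drop_nth (0, false)).
  - by rewrite /s' drop_size.
  - rewrite /s' (drop_nth (0, false) lt_l) (take_nth (0, false) lt_l).
    have := allP lt_C _ (mem_nth (0, false) lt_l).
    case: (nth (0, false) C l) => x sign /= lt_x.
    have le_x : x <= W by lia.
    pose i' := enc_seq enc_literal (drop l.+1 C) ++ i;
    set o' := enc_clauses _ o.
    have rd := triple_read_lit sign i' o' le_x.
    have rd' : triple (if_input (read_lit true) (read_lit false))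
        (s 0 (sign :: enc_nat x ++ i') o')
        (s x i' (enc_clauses [:: rcons top_prefix (x, ~~ sign)] o'))
        (3 * W + emit_cost W + 3).+1.
      apply: (triple_if_input bit_inj bit_blank).
      by case: sign rd.
    rewrite rcons_cat -catA.
    have adv : triple advance (s 0 (true :: sign :: enc_nat x ++ i') o')
      (s 0 (sign :: enc_nat x ++ i') o') 1 := triple_advance _.
    apply: triple_weaken (triple_seq adv (triple_seq rd' (triple_clr rV _))) _
      _ => //.
    + by rewrite map_rcons -(cats1 (map _ _)) enc_clauses_cat.
    + by rewrite /reg /=; lia.
have adv0 : triple advance (s 0 (true :: enc_seq enc_literal C ++ i) o)
  (s' 0) 1 by apply: triple_weaken (triple_advance _) _ _;
  rewrite // /s' drop0 take0.
have adv1 : triple advance (s' (size C))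
  (s 0 i (enc_clauses [seq rcons top_prefix (l.1, ~~ l.2) | l : literal <- C]
    o)) 1.
  by apply: triple_weaken (triple_advance _) _ _;
  rewrite // /s' drop_size take_size.
apply: triple_weaken (triple_seq adv0 (triple_seq loop adv1)) _ _ => //.
by have := leq_mul le_C (leqnn (5 * W + emit_cost W + 7).+1);
rewrite /top_cost; lia.
Qed.

End Top.

Lemma triple_top n (F : cnf) p b u o : n <= W -> is_dcnf 3 n F -> size F <=
  dexp c ->
  all (leq^~ W) [:: p; b; u] ->
  triple top_phase
    (st 0 (dexp c) (dexp c) 0 c Z (row_start 0) p (row_start H) 0 (nb_guards c)
      0 0 0 0 b 0 u u u (enc_cnf F) o)
    (st 0 (dexp c) (dexp c) 0 c Z (row_start 0) p (row_start H) 0 (nb_guards c)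
      0 0 0 0 b 0 u u u [:: false]
      (enc_clauses (flatten [seq top_clauses c F j | j <- iota 0 (dexp c)]) o))
    (W * (top_cost + 6) + 2).
Proof.
move=> le_n F3 le_F le_s; have aZ := leq_dexp_width (leqnSn c);
have ZW := (Z_W rows_W).
pose s j := st 0 (dexp c) (dexp c) 0 c Z (row_start 0) p (row_start H) 0
  (nb_guards c)
      0 0 0 0 b 0 u u u (enc_cnf (drop j F))
      (enc_clauses (flatten [seq top_clauses c F j | j <- iota 0 j]) o).
apply: (triple_loop (s := s) (n := dexp c) (t := top_cost)) => //.
- by rewrite /s drop0.
- by rewrite /s drop_oversize.
- move=> j lt_j; have le_j : j <= W by lia.
  have le_s' : all (leq^~ W) [:: dexp c - j; dexp c; p; b; u].
    by move: le_s; rewrite /=; lia.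
  rewrite /s enc_flatten_iotaS; set o' := enc_clauses _ o.
  have -> : top_cost = top_cost.-1.+1 by rewrite prednK // /top_cost addnS.
  apply: (triple_if_input bit_inj bit_blank).
  rewrite /top_clauses add0n; case: ltnP => [lt_jF|le_jF].
    have enc_cons C G : enc_cnf (C :: G) = true :: enc_seq enc_literal C ++
      enc_cnf G.
      by rewrite /enc_cnf {1}/enc_seq /= rcons_cat.
    rewrite (drop_nth [::] lt_jF) enc_cons /=.
    have Cj := mem_nth [::] lt_jF.
    case/andP: F3 => _ /allP/(_ _ Cj)/and3P[_ size3 lt_C].
    have := triple_read_clause le_n le_j le_s' (enc_cnf (drop j.+1 F)) o' size3
      lt_C => rd.
    apply: triple_weaken rd _ _ => //.
  rewrite !drop_oversize ?(leqW le_jF) //=.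
  pose s' o1 := st 0 (dexp c - j) (dexp c) 0 c Z (row_start 0) p (row_start H) 0
    (nb_guards c) 0 j 0 0 b 0 u u u (enc_cnf [::]) o1.
  have em : triple (emit top_lits) (s' o') (s' (enc_clauses
      [:: [:: (g_var c 1, false); (r_var c H 0 j, false)]] o')) (emit_cost W).
    apply: triple_emit => //; last exact: top_lits_val.
    exact: (top_store_W le_n le_j le_s').
  apply: triple_weaken em _ _ => //.
  by rewrite /top_cost; lia.
- by rewrite leq_add2r leq_mul2r; apply/orP; right; lia.
Qed.

End Levels.

End Emission.

Definition enc_quants (qs : seq quantifier) (o : seq bool) : seq bool :=
  flatten [seq [:: true; is_exists q] | q <- qs] ++ o.

Lemma enc_quants_cat qs1 qs2 o :
  enc_quants (qs1 ++ qs2) o = enc_quants qs1 (enc_quants qs2 o).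
Proof. by rewrite /enc_quants map_cat flatten_cat catA. Qed.

Lemma enc_quants_nseq m q o :
  enc_quants (nseq m q) o = flatten (nseq m [:: true; is_exists q]) ++ o.
Proof. by rewrite /enc_quants map_nseq. Qed.

(** * Parameters of the reduction and output of the prefix *)

Section Phases.

Variables (sym : finType) (blank : sym) (bit : bool -> sym).
Hypotheses (bit_inj : injective bit) (bit_blank : forall b, bit b != blank).
Variable w : nat.
Let kt := nb_regs.+1 + w.+1.

Local Notation triple := (triple blank bit (R := nb_regs) (w := w)).
Local Notation inc := (@inc sym nb_regs w).
Local Notation dec := (@dec sym nb_regs w).
Local Notation outs := (@outs sym bit nb_regs w).
Local Notation for_ := (@for_ sym bit nb_regs w).
Local Notation advance := (@advance sym nb_regs w).
Local Notation while_pos := (@while_pos sym bit nb_regs w).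
Local Notation while_input := (@while_input sym bit nb_regs w).
Local Notation add_to := (@add_to sym bit nb_regs w rX).
Local Notation sub_from := (@sub_from sym bit nb_regs w rX).
Local Notation clear := (@clear sym bit nb_regs w).
Local Notation out_times := (@out_times sym bit nb_regs w rX).
Local Notation square := (@square sym bit w).
Local Notation sub3 := (@sub3 sym bit w).
Local Notation double_b := (@double_b sym bit w).
Local Notation "m1 ;; m2" := (@seqr sym kt m1 m2) (at level 70, right
  associativity).

Lemma triple_adv b r i o :
  triple advance (Store r (b :: i) o) (Store r i o) 1.
Proof. exact: triple_advance. Qed.

(** Three copies, one for each of the nested loops of [count_bound]. *)
Definition inc_u : routine sym kt := inc rU1 ;; inc rU2 ;; inc rU3.

Definition read_size : routine sym kt :=
  inc_u ;; while_input (advance ;; inc_u ;; inc_u) ;; advance.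

Lemma triple_inc_u u i o :
  triple inc_u (st 0 0 0 0 0 0 0 0 0 0 0 0 0 0 0 0 0 u u u i o)
    (st 0 0 0 0 0 0 0 0 0 0 0 0 0 0 0 0 0 u.+1 u.+1 u.+1 i o) 3.
Proof.
by apply: triple_weaken (triple_seq (triple_inc rU1 _)
  (triple_seq (triple_inc rU2 _) (triple_inc rU3 _))) _ _.
Qed.

Lemma triple_read_size n i o :
  triple read_size (st 0 0 0 0 0 0 0 0 0 0 0 0 0 0 0 0 0 0 0 0 (enc_nat n ++ i)
    o)
    (st 0 0 0 0 0 0 0 0 0 0 0 0 0 0 0 0 0 (2 * n).+1 (2 * n).+1 (2 * n).+1 i o)
    (8 * n + 5).
Proof.
pose s j := st 0 0 0 0 0 0 0 0 0 0 0 0 0 0 0 0 0 (2 * j).+1 (2 * j).+1 (2 *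
  j).+1
  (enc_nat (n - j) ++ i) o.
have loop : triple (while_input (advance ;; inc_u ;;
inc_u)) (s 0) (s n) (n * 8).+1.
  have eS j : j < n -> n - j = (n - j.+1).+1 by move=> lt_j;
  rewrite -subSn // subSS.
  apply: (triple_while_input bit_inj bit_blank (t := 7)) => [j lt_j||j lt_j].
  - by rewrite /s eS.
  - by rewrite /s subnn.
  - rewrite /s (eS j) // mulnS.
    have adv := triple_adv true (regs (s j)) (enc_nat (n - j.+1) ++ i) o.
    exact: (triple_seq adv (triple_seq (triple_inc_u (2 * j).+1 _ _)
      (triple_inc_u (2 * j).+2 _ _))).
rewrite /s subn0 subnn in loop.
have adv := triple_adv false (regs (s n)) i o.
by apply: triple_weaken (triple_seq (triple_inc_u 0 _ _) (triple_seq loop adv))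
  _ _ => //; lia.
Qed.

Definition count_bound : routine sym kt :=
  for_ rT rU1 (for_ rP1 rU2 (for_ rP2 rU3 (inc rBd ;; inc rBd))).

Lemma triple_count_bound u i o :
  triple count_bound (st 0 0 0 0 0 0 0 0 0 0 0 0 0 0 0 0 0 u u u i o)
    (st 0 0 0 (2 * u ^ 3) 0 0 0 0 0 0 0 0 0 0 0 0 0 u u u i o)
    (u * (u * (u * 8 + 8) + 8) + 2).
Proof.
pose s1 bd := st 0 0 0 bd 0 0 0 0 0 0 0 0 0 0 0 0 0 u u u i o.
apply: (triple_loop bit_blank (s := fun j => s1 (j * (2 * (u * u)))) (n := u)
  (t := u * (u * 8 + 8) + 2)) => //; last by lia.
  by rewrite /s1 !expnS expn0; congr (st _ _ _ _ _ _ _ _ _ _ _ _ _ _ _ _ _ _ _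
    _ _ _); lia.
move=> j lt_j; pose s2 bd := st 0 0 0 bd 0 0 0 0 0 0 0 j 0 0 0 0 0 (u - j) u u
  i o.
apply: (triple_loop bit_blank (s := fun l => s2 (j * (2 * (u * u)) + l * (2 *
  u)))
  (n := u) (t := u * 8 + 2)) => //; try lia.
- by rewrite /s2 addn0.
- by rewrite /s2 /s1; congr (st _ _ _ _ _ _ _ _ _ _ _ _ _ _ _ _ _ _ _ _ _ _);
  lia.
move=> l lt_l.
pose s3 bd := st 0 0 0 bd 0 0 0 0 0 0 0 j l 0 0 0 0 (u - j) (u - l) u i o.
apply: (triple_loop bit_blank (s := fun h => s3 (j * (2 * (u * u)) + l * (2 *
  u) + h * 2))
  (n := u) (t := 2)) => //; try lia.
- by rewrite /s3 addn0.
- by rewrite /s3 /s2; congr (st _ _ _ _ _ _ _ _ _ _ _ _ _ _ _ _ _ _ _ _ _ _);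
  lia.
move=> h lt_h; apply: triple_weaken (triple_seq (triple_inc rBd _) (triple_inc
  rBd _)) _ _ => //.
by rewrite /s3 /upd /reg /= -!addnS.
Qed.

(** The bound is compared with the growing powers by subtracting them from it. The loop therefore
    stops at the first [c] where [dexp 1 + ... + dexp c] reaches the bound, which is why [dexp_sum]
    determines the height. *)
Definition find_height : routine sym kt :=
  inc rA1 ;; inc rA1 ;; inc rA2 ;; inc rA2 ;;
  while_pos rBd (square ;; inc rCnt ;; sub_from rBd rA1).

Definition dexp_sum (j : nat) : nat := sumn [seq dexp i | i <- iota 1 j].

Lemma dexp_sumS j : dexp_sum j.+1 = dexp_sum j + dexp j.+1.
Proof. by rewrite /dexp_sum -[in LHS](addn1 j) iotaD map_cat sumn_cat /= addn0
  add1n. Qed.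

Lemma triple_find_height c bd u i o :
  (forall j, j < c -> dexp_sum j < bd) -> bd <= dexp_sum c ->
  triple find_height (st 0 0 0 bd 0 0 0 0 0 0 0 0 0 0 0 0 0 u u u i o)
    (st 0 (dexp c) (dexp c) 0 c 0 0 0 0 0 0 0 0 0 0 0 0 u u u i o)
    (c * (58 * dexp c + 54) + 5).
Proof.
move=> lt_bd le_bd.
pose s j := st 0 (dexp j) (dexp j) (bd - dexp_sum j) j 0 0 0 0 0 0 0 0 0 0 0 0
  u u u i o.
have loop : triple (while_pos rBd (square ;; inc rCnt ;; sub_from rBd rA1))
    (s 0) (s c) (c * (58 * dexp c + 53).+1).+1.
  apply: (triple_while bit_blank) => [j lt_j||j lt_j].
  - by rewrite /s /reg /= subn_gt0 lt_bd.
  - by apply/eqP; rewrite subn_eq0.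
  - pose s1 j' := st 0 (dexp j.+1) (dexp j.+1) (bd - dexp_sum j) j' 0 0 0 0 0 0
      0 0 0 0 0 0 u u u i o.
    have sq := triple_square bit_blank w (dexp j) (bd - dexp_sum j) j 0 0 0 0 0
      0 0 0 0 0 u u u i o.
    rewrite -dexpS in sq.
    have sub := @triple_sub _ _ _ bit_blank w rBd rA1 (s1 j.+1) isT isT isT
      erefl erefl.
    apply: triple_weaken (triple_seq sq (triple_seq (triple_inc rCnt (s1 j))
      sub)) _ _ => //.
      by rewrite /s /upd /reg /= dexp_sumS subnDA.
    have : dexp j.+1 <= dexp c by apply: leq_dexp.
    by rewrite /reg /=; lia.
rewrite /s subn0 in loop; rewrite /= (eqP (_ : bd - dexp_sum c == 0)) in loop;
last by rewrite subn_eq0.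
pose s0 a1 a2 := st 0 a1 a2 bd 0 0 0 0 0 0 0 0 0 0 0 0 0 u u u i o.
apply: triple_weaken (triple_seq (triple_inc rA1 (s0 0 0)) (triple_seq
  (triple_inc rA1 (s0 1 0))
  (triple_seq (triple_inc rA2 (s0 2 0)) (triple_seq (triple_inc rA2 (s0 2 1))
    loop)))) _ _ => //.
lia.
Qed.

Definition mul_z : routine sym kt := for_ rP1 rA1 (for_ rP2 rA2 (inc rZ)).

Lemma triple_mul_z a c u i o :
  triple mul_z (st 0 a a 0 c 0 0 0 0 0 0 0 0 0 0 0 0 u u u i o)
    (st 0 a a 0 c (a * a) 0 0 0 0 0 0 0 0 0 0 0 u u u i o)
    (a * (a * 7 + 8) + 2).
Proof.
pose s1 z := st 0 a a 0 c z 0 0 0 0 0 0 0 0 0 0 0 u u u i o.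
apply: (triple_loop bit_blank (s := fun j => s1 (j * a)) (n := a) (t := a * 7 +
  2)) => //; last by lia.
move=> j lt_j; pose s2 z := st 0 (a - j) a 0 c z 0 0 0 0 0 0 j 0 0 0 0 u u u i
  o.
apply: (triple_loop bit_blank (s := fun l => s2 (j * a + l)) (n := a) (t := 1))
  => //.
- by rewrite /s2 addn0.
- by rewrite /s2 -mulSnr.
- by move=> l lt_l; apply: triple_inc_st; rewrite /s2 /upd /reg /= addnS.
Qed.

Definition add3 : routine sym kt :=
  add_to rP0 rZ ;; add_to rP0 rZ ;; add_to rP0 rZ.

(** Level 0 starts at row [3 * (c + 1) + 1], that is [3 * c + 4]. *)
Definition set_rows : routine sym kt :=
  add_to rP0 rZ ;; add3 ;; for_ rK rCnt add3.

Lemma triple_add3 z a1 a2 cnt p0 k u i o :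
  triple add3 (st 0 a1 a2 0 cnt z p0 0 0 0 0 0 0 0 0 0 k u u u i o)
    (st 0 a1 a2 0 cnt z (p0 + 3 * z) 0 0 0 0 0 0 0 0 0 k u u u i o)
    (21 * z + 6).
Proof.
pose s p0 := st 0 a1 a2 0 cnt z p0 0 0 0 0 0 0 0 0 0 k u u u i o.
have add p := @triple_add _ _ _ bit_blank w rP0 rZ (s p) isT isT isT erefl
  erefl.
apply: triple_weaken (triple_seq (add p0) (triple_seq (add (p0 + z)) (add (p0 +
  z + z)))) _ _.
  by rewrite /upd /reg /= /st; congr (Store [:: _, _, _, _, _, _, _, _ & _] _
    _); lia.
by rewrite /reg /=; lia.
Qed.

Lemma triple_set_rows z a c u i o :
  triple set_rows (st 0 a a 0 c z 0 0 0 0 0 0 0 0 0 0 0 u u u i o)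
    (st 0 a a 0 c z ((3 * c + 4) * z) 0 0 0 0 0 0 0 0 0 0 u u u i o)
    (c * (21 * z + 12) + 28 * z + 10).
Proof.
pose s p0 k := st 0 a a 0 (c - k) z p0 0 0 0 0 0 0 0 0 0 k u u u i o.
pose s1 p0 := st 0 a a 0 c z p0 0 0 0 0 0 0 0 0 0 0 u u u i o.
have add := @triple_add _ _ _ bit_blank w rP0 rZ (s1 0) isT isT isT erefl erefl.
have loop : triple (for_ rK rCnt add3) (s1 (4 * z)) (s1 ((3 * c + 4) * z))
    (c * (21 * z + 12) + 2).
  apply: (triple_loop bit_blank (s := fun j => s1 (4 * z + j * (3 * z))) (n :=
    c)
    (t := 21 * z + 6)) => //.
  - by rewrite addn0.
  - by congr s1; lia.
  - move=> j lt_j; apply: triple_weaken (triple_add3 _ _ _ _ _ _ _ _ _) _ _ =>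
      //.
    by rewrite /upd /= /st mulSn; congr (Store [:: _, _, _, _, _, _, _, _ & _]
      _ _); lia.
  - by lia.
have add3 := triple_add3 z a a c z 0 u i o;
rewrite (_ : z + 3 * z = 4 * z) in add3; last by lia.
by apply: triple_weaken (triple_seq add (triple_seq add3 loop)) _ _ => //;
rewrite /reg /=; lia.
Qed.

Definition inc2 (r : 'I_nb_regs) : routine sym kt := inc r ;; inc r.

Definition set_start : routine sym kt :=
  add_to rP rP0 ;; add_to rQ rP0 ;; sub3 rQ ;; inc2 rTau ;;
  clear rA1 ;; clear rA2 ;; inc2 rA1 ;; inc2 rA2 ;; inc2 rB.

Lemma triple_inc2 (r : 'I_nb_regs) s : r < size (regs s) ->
  triple (inc2 r) s (upd s r (reg s r).+2) 2.
Proof.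
move=> lt_r; apply: triple_weaken (triple_seq (triple_inc r s) (triple_inc r
  _)) _ _ => //.
by rewrite upd_upd eqxx reg_upd eqxx.
Qed.

Lemma triple_set_start z a c p0 u i o :
  triple set_start (st 0 a a 0 c z p0 0 0 0 0 0 0 0 0 0 0 u u u i o)
    (st 0 2 2 0 c z p0 p0 (p0 - z - z - z) 0 2 0 0 0 0 2 0 u u u i o)
    (14 * p0 + 24 * z + 4 * a + 30).
Proof.
pose s a1 a2 p q tau b := st 0 a1 a2 0 c z p0 p q 0 tau 0 0 0 0 b 0 u u u i o.
have addp := @triple_add _ _ _ bit_blank w rP rP0 (s a a 0 0 0 0) isT isT isT
  erefl erefl.
have addq := @triple_add _ _ _ bit_blank w rQ rP0 (s a a p0 0 0 0) isT isT isT
  erefl erefl.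
have sub q := @triple_sub _ _ _ bit_blank w rQ rZ (s a a p0 q 0 0) isT isT isT
  erefl erefl.
have i1 := @triple_inc2 rTau (s a a p0 (p0 - z - z - z) 0 0) isT.
have c1 := @triple_clr _ _ _ bit_blank w rA1 (s a a p0 (p0 - z - z - z) 2 0)
  erefl.
have c2 := @triple_clr _ _ _ bit_blank w rA2 (s 0 a p0 (p0 - z - z - z) 2 0)
  erefl.
have i2 := @triple_inc2 rA1 (s 0 0 p0 (p0 - z - z - z) 2 0) isT.
have i3 := @triple_inc2 rA2 (s 2 0 p0 (p0 - z - z - z) 2 0) isT.
have i4 := @triple_inc2 rB (s 2 2 p0 (p0 - z - z - z) 2 0) isT.
apply: triple_weaken (triple_seq addp (triple_seq addq (triple_seq
  (triple_seq (sub p0) (triple_seq (sub (p0 - z)) (sub (p0 - z - z))))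
  (triple_seq i1 (triple_seq c1 (triple_seq c2 (triple_seq i2 (triple_seq i3
    i4)))))))) _ _ => //.
by rewrite /reg /=; lia.
Qed.

Section Prefix.

Variable c : nat.
Local Notation H := (height c).
Local Notation Z := (width c).

(** The universal padding ends the row, hence is written first. *)
Definition out_row : routine sym kt :=
  add_to rW rZ ;; sub_from rW rB ;; sub_from rW rB ;;
  out_times rW [:: true; false] ;; out_times rB [:: true; true] ;;
  out_times rB [:: true; true] ;; clear rW.

Lemma triple_out_row a cnt z p0 p q tau b k u i o : z = Z -> 2 * b <= Z ->
  triple out_row
    (st 0 a a 0 cnt z p0 p q 0 tau 0 0 0 0 b k u u u i o)
    (st 0 a a 0 cnt z p0 p q 0 tau 0 0 0 0 b k u u u i
      (enc_quants (row_prefix c (2 * b)) o))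
    (60 * Z + 20).
Proof.
move=> -> le_b.
pose s w' o' := st w' a a 0 cnt Z p0 p q 0 tau 0 0 0 0 b k u u u i o'.
have add := @triple_add _ _ _ bit_blank w rW rZ (s 0 o) isT isT isT erefl erefl.
have sub v := @triple_sub _ _ _ bit_blank w rW rB (s v o) isT isT isT erefl
  erefl.
pose o1 := enc_quants (nseq (Z - b - b) Forall) o.
pose o2 := enc_quants (nseq b Exists) o1.
have f1 := @triple_out_times _ _ _ bit_blank _ w rX rW [:: true;
false] (s (Z - b - b) o) isT isT isT erefl.
have f2 := @triple_out_times _ _ _ bit_blank _ w rX rB [:: true;
true] (s (Z - b - b) o1) isT isT isT erefl.
have f3 := @triple_out_times _ _ _ bit_blank _ w rX rB [:: true;
true] (s (Z - b - b) o2) isT isT isT erefl.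
have cl := @triple_clr _ _ _ bit_blank w rW (s (Z - b - b) (enc_quants (nseq b
  Exists) o2)) erefl.
rewrite /push -(enc_quants_nseq _ Forall) in f1.
rewrite /push -(enc_quants_nseq _ Exists) in f2.
rewrite /push -(enc_quants_nseq _ Exists) in f3.
apply: triple_weaken (triple_seq add (triple_seq (sub Z) (triple_seq (sub (Z -
  b))
  (triple_seq f1 (triple_seq f2 (triple_seq f3 cl)))))) _ _ => //.
  rewrite /row_prefix enc_quants_cat mul2n -addnn nseqD enc_quants_cat.
  by rewrite subnDA.
by rewrite /reg /=; lia.
Qed.

Definition out_universals : routine sym kt := out_times rZ [:: true; false].

(** The rows are printed from the last to the first. The levels have left [2 ^ H] in [rB], as the
    guard and chain rows require; it restarts at 1 for level 0. Row 0 is printed without its first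
    quantifier: the bit for its kind is the last one written here, and its leading bit is left to
    [out_last]. *)
Definition prefix_phase : routine sym kt :=
  outs [:: false] ;; out_row ;; out_row ;; clear rB ;; inc rB ;; out_row ;;
  inc rCnt ;;
  for_ rK rCnt (out_universals ;; out_universals ;; double_b ;; out_row) ;;
  dec rZ ;; out_universals ;; outs [:: false].

Definition rows (i : nat) : seq quantifier :=
  flatten [seq row_prefix c (row_exists c row) | row <- iota i (nb_rows c - i)].

Lemma rowsS i : i < nb_rows c ->
  rows i = row_prefix c (row_exists c i) ++ rows i.+1.
Proof. by move=> lt_i; rewrite /rows -(@subnSK i) //= . Qed.

Lemma row_prefix0 : row_prefix c 0 = nseq Z Forall.
Proof. by rewrite /row_prefix subn0. Qed.

Lemma rows_level h : 0 < h <= H -> rows (3 * (H - h) + 1) =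
  row_prefix c (2 * 2 ^ h) ++ nseq Z Forall ++ nseq Z Forall ++
  rows (3 * (H - h.-1) + 1).
Proof.
case/andP=> h_gt0 le_h; have hH : 0 < h <= H by rewrite h_gt0.
rewrite rowsS; last by rewrite /nb_rows; lia.
rewrite row_exists_e // -row_prefix0 rowsS; last by rewrite /nb_rows; lia.
have r0 := row_exists_r hH (isT : 0 < 2);
have r1 := row_exists_r hH (isT : 1 < 2).
rewrite -[(_ + 1).+1]addnS -[3 * (H - h) + 2]addn0 r0.
rewrite addn0 -[(_ + 2).+1]addn1 [X in _ ++ _ ++ X]rowsS;
last by rewrite /nb_rows; lia.
by rewrite r1 (_ : (3 * (H - h) + 2 + 1).+1 = 3 * (H - h.-1) + 1); last by lia.
Qed.

Lemma two_exp_Z h : h <= H -> 2 * 2 ^ h <= Z.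
Proof. by move=> le_h; rewrite -expnS; apply: exp_W. Qed.

Lemma triple_prefix a p0 p q tau u i o :
  triple prefix_phase
    (st 0 a a 0 c Z p0 p q 0 tau 0 0 0 0 (2 ^ H) 0 u u u i o)
    (st 0 a a 0 H Z.-1 p0 p q 0 tau 0 0 0 0 (2 ^ H) 0 u u u i
      (false :: enc_quants (nseq Z.-1 Forall ++ rows 1) (false :: o)))
    (H * (94 * Z + 50) + 300 * Z + 100).
Proof.
pose o1 := enc_quants (rows (3 * H + 3)) (false :: o).
pose o2 := enc_quants (rows (3 * H + 2)) (false :: o).
pose s c' z b o' := st 0 a a 0 c' z p0 p q 0 tau 0 0 0 0 b 0 u u u i o'.
have end_row : rows (3 * H + 4) = [::] by rewrite /rows subnn.
have e1 : o1 = enc_quants (row_prefix c (2 * 2 ^ H)) (false :: o).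
  rewrite /o1 rowsS ?row_exists_c; last by rewrite /nb_rows; lia.
  by rewrite -[(_ + 3).+1]addnS end_row cats0.
have e2 : o2 = enc_quants (row_prefix c (2 * 2 ^ H)) o1.
  rewrite /o2 rowsS ?row_exists_g; last by rewrite /nb_rows; lia.
  by rewrite enc_quants_cat -[(_ + 2).+1]addnS.
have e3 : enc_quants (rows (3 * H + 1)) (false :: o) = enc_quants (row_prefix c
  2) o2.
  rewrite rowsS; last by rewrite /nb_rows; lia.
  have := @row_exists_e c 0 isT; rewrite subn0 => ->.
  by rewrite enc_quants_cat -[(_ + 1).+1]addnS.
have out0 := @triple_outs _ blank bit nb_regs w [:: false] (s c Z (2 ^ H) o).
have row1 := triple_out_row a c p0 p q tau 0 u i (false :: o) erefl (two_exp_Z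
  (leqnn H)).
have row2 := triple_out_row a c p0 p q tau 0 u i o1 erefl (two_exp_Z (leqnn H)).
have row3 := triple_out_row a c p0 p q tau 0 u i o2 erefl (two_exp_Z (leq0n H)).
rewrite -e1 in row1; rewrite -e2 in row2; rewrite muln1 -e3 in row3.
have clb := @triple_clr _ _ _ bit_blank w rB (s c Z (2 ^ H) o2) erefl.
have incb := @triple_inc _ blank bit _ w rB (s c Z 0 o2).
have incc := @triple_inc _ blank bit _ w rCnt (s c Z 1 (enc_quants (rows (3 * H
  + 1)) (false :: o))).
have loop : triple (for_ rK rCnt (out_universals ;; out_universals ;;
double_b ;; out_row))
    (s H Z 1 (enc_quants (rows (3 * H + 1)) (false :: o)))
    (s H Z (2 ^ H) (enc_quants (rows 1) (false :: o))) (H * (94 * Z + 50) + 2).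
  pose f j := s H Z (2 ^ j) (enc_quants (rows (3 * (H - j) + 1)) (false :: o)).
  apply: (triple_loop bit_blank (s := f) (n := H) (t := 94 * Z + 44)) => //.
  - by rewrite /f subnn.
  - move=> j lt_j; pose g b o' := st 0 a a 0 (H - j) Z p0 p q 0 tau 0 0 0 0 b j
      u u u i o'.
    have lev : 0 < j.+1 <= H by [].
    pose o3 := enc_quants (rows (3 * (H - j) + 1)) (false :: o).
    have un o' : triple out_universals (g (2 ^ j) o')
        (g (2 ^ j) (enc_quants (nseq Z Forall) o')) (Z * 9 + 2).
      rewrite enc_quants_nseq.
      exact: (@triple_out_times _ _ _ bit_blank _ w rX rZ [:: true;
      false] (g (2 ^ j) o') isT isT isT erefl).
    have dbl o' := triple_double_b bit_blank w a a 0 (H - j) Z p0 p q 0 tau 0 0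
      0 0 (2 ^ j) j u u u i o'.
    have row o' := triple_out_row a (H - j) p0 p q tau j u i o' erefl
      (two_exp_Z lt_j).
    rewrite -expnS in dbl.
    apply: triple_weaken (triple_seq (un o3) (triple_seq (un _) (triple_seq
      (dbl _) (row _)))) _ _.
      rewrite /f rows_level //= enc_quants_cat enc_quants_cat enc_quants_cat.
      by [].
    have := two_exp_Z (ltnW lt_j); lia.
  - by lia.
have decz := @triple_dec _ blank bit _ w rZ (s H Z (2 ^ H) (enc_quants (rows 1)
  (false :: o))) (dexp_gt0 H).
have un := @triple_out_times _ _ _ bit_blank _ w rX rZ [:: true; false]
  (s H Z.-1 (2 ^ H) (enc_quants (rows 1) (false :: o))) isT isT isT erefl.
rewrite /push -(enc_quants_nseq _ Forall) -enc_quants_cat in un.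
have outl := @triple_outs _ blank bit nb_regs w [:: false]
  (s H Z.-1 (2 ^ H) (enc_quants (nseq Z.-1 Forall ++ rows 1) (false :: o))).
apply: triple_weaken (triple_seq out0 (triple_seq row1 (triple_seq row2
  (triple_seq clb
  (triple_seq incb (triple_seq row3 (triple_seq incc (triple_seq loop
    (triple_seq decz
  (triple_seq un outl)))))))))) _ _ => //.
have := two_exp_Z (leqnn H); rewrite /reg /=; lia.
Qed.

End Prefix.

End Phases.

(** * The whole reduction *)

Section Reducer.

Variables (sym : finType) (blank : sym) (bit : bool -> sym).
Hypotheses (bit_inj : injective bit) (bit_blank : forall b, bit b != blank).
Variable w : nat.
Let kt := nb_regs.+1 + w.+1.

Local Notation triple := (triple blank bit (R := nb_regs) (w := w)).
Local Notation "m1 ;; m2" := (@seqr sym kt m1 m2) (at level 70, right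
  associativity).

Definition reducer_body : routine sym kt :=
  read_size bit w ;; count_bound bit w ;; find_height bit w ;;
  mul_z bit w ;; set_rows bit w ;; set_start bit w ;;
  outs bit nb_regs w [:: false] ;; base_phase bit w ;; levels bit w ;;
  chain_phase bit w ;; top_phase bit w ;; prefix_phase bit w.

Definition reducer : routine sym kt :=
  mark_regs bit nb_regs w ;; reducer_body ;; out_last bit nb_regs w true.

(** One summand for each phase, associated as in [reducer_body], with all parameters replaced by
    [W]. *)
Definition reducer_cost (W : nat) : nat :=
  8 * W + 5 + (W * (W * (W * 8 + 8) + 8) + 2 + (W * (58 * W + 54) + 5 +
  (W * (W * 7 + 8) + 2 + (W * (21 * W + 12) + 28 * W + 10 +
  (14 * W + 24 * W + 4 * W + 30 + (2 + (8 * emit_cost W + 15 * W + 10 +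
  (W * (level_cost W + 6) + 2 + (emit_cost W + (W * (emit_cost W + 6) + 2) +
  (W * (top_cost W + 6) + 2 + (W * (94 * W + 50) + 300 * W + 100))))))))))).

Variables (n c : nat) (F : cnf).
Hypotheses (F_3cnf : is_dcnf 3 n F) (le_F : size F <= dexp c) (le_n : (2 *
  n).+1 <= dexp c).
Hypotheses (lt_sum : forall j, j < c -> dexp_sum j < 2 * (2 * n).+1 ^ 3)
  (le_sum : 2 * (2 * n).+1 ^ 3 <= dexp_sum c).

Local Notation Z := (width c).
Local Notation H := (height c).
Local Notation u := (2 * n).+1.

Lemma enc_cnf_rev L : enc_cnf (rev L) = enc_clauses L [:: false].
Proof. by rewrite /enc_cnf /enc_seq -cats1. Qed.

Lemma enc_qbf_red : enc_qbf (red_qbf c F) = true :: false ::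
  enc_quants (nseq Z.-1 Forall ++ rows c 1) (false :: enc_cnf (rev (emitted c
    F))).
Proof.
have -> : enc_qbf (red_qbf c F) =
    enc_quants (red_prefix c) (false :: enc_cnf (rev (emitted c F))).
  by rewrite /enc_qbf /enc_seq /enc_quants -cats1 -catA.
have -> : red_prefix c = Forall :: nseq Z.-1 Forall ++ rows c 1; last by [].
have -> : red_prefix c = rows c 0 by rewrite /rows subn0.
by rewrite rowsS // row_prefix0; case: Z (width_gt0 c).
Qed.

Lemma triple_reducer_body (W := nb_rows c * Z) : exists rs i,
  triple reducer_body (Store (nseq nb_regs 0) (enc_sat n F) [::])
    (Store rs i (behead (enc_qbf (red_qbf c F)))) (reducer_cost W).
Proof.
have rows_W : nb_rows c * Z <= W by [].
have ZW := Z_W rows_W; have cW := level_W rows_W; have pW := row_start_W rows_W.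
have aW : dexp c <= W by have := @leq_dexp_width c c (leqnSn c); lia.
have uW : u <= W by lia.
have TW : nb_guards c <= W.
  by rewrite /nb_guards -expnS; have := @exp_W c H (leqnn H); lia.
have bW : 2 ^ H <= W by move: TW; rewrite /nb_guards; lia.
have p0E : row_start c 0 = (3 * c + 4) * Z.
  by rewrite /row_start subn0 /height; congr (_ * _); lia.
have p1E : row_start c 0 - Z - Z - Z = row_start c 1 by apply: row_startS.
have zE : dexp c * dexp c = Z by rewrite -dexpS.
set f := enc_cnf F.
pose o0 := [:: false].
pose o1 := enc_clauses (flatten [seq base_clauses c side | side <- iota 0 2])
  o0.
pose o2 := enc_clauses (flatten [seq level_emitted c h | h <- iota 1 c]) o1.
pose o3 := enc_clauses ([:: [:: (c_var c 1, true)]] ++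
   [seq chain_clause c i | i <- iota 0 (nb_guards c)]) o2.
pose o4 := enc_clauses (flatten [seq top_clauses c F j | j <- iota 0 (dexp c)])
  o3.
have o4E : o4 = enc_cnf (rev (emitted c F)).
  have enc5 L1 L2 L3 L4 L5 o : enc_clauses (L1 ++ L2 ++ L3 ++ L4 ++ L5) o =
      enc_clauses L5 (enc_clauses (L3 ++ L4) (enc_clauses L2 (enc_clauses L1
        o))).
    by rewrite !enc_clauses_cat.
  by rewrite enc_cnf_rev /emitted enc5.
have r1 := triple_read_size bit_inj bit_blank w n f [::].
have r2 := triple_count_bound bit_blank w u f [::].
have r3 := triple_find_height bit_blank w u f [::] lt_sum le_sum.
have r4 := triple_mul_z bit_blank w (dexp c) c u f [::].
have r5 := triple_set_rows bit_blank w Z (dexp c) c u f [::].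
have r6 := triple_set_start bit_blank w Z (dexp c) c (row_start c 0) u f [::].
rewrite zE in r4; rewrite -p0E in r5; rewrite p1E in r6.
have r7 := @triple_outs _ blank bit nb_regs w [:: false]
  (st 0 2 2 0 c Z (row_start c 0) (row_start c 0) (row_start c 1) 0 2 0 0 0 0 2
    0 u u u f [::]).
have W2 : 2 <= W by have := @exp_W c 0 (leq0n H); lia.
have r8 := triple_base bit_blank w rows_W f o0 W2 cW W2 uW.
have r9 := triple_levels bit_blank w rows_W f o1 uW.
have r10 := triple_chain bit_blank w rows_W f o2 aW (pW H) bW uW.
have le_nW : n <= W by lia.
have le_s : all (leq^~ W) [:: row_start c c; 2 ^ H; u].
  by rewrite /= pW bW uW.
have r11 := triple_top bit_inj bit_blank w rows_W o3 le_nW F_3cnf le_F le_s.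
have r12 := triple_prefix bit_blank w c (dexp c) (row_start c 0) (row_start c c)
  (row_start c H) (nb_guards c) u [:: false] o4.
do 2 eexists.
apply: triple_weaken (triple_seq r1 (triple_seq r2 (triple_seq r3 (triple_seq r4
  (triple_seq r5 (triple_seq r6 (triple_seq r7 (triple_seq r8 (triple_seq r9
  (triple_seq r10 (triple_seq r11 r12))))))))))) _ _.
  congr Store; rewrite o4E.
  by rewrite enc_qbf_red.
have HW : H <= W by have := ltn_expl H (isT : 1 < 2); lia.
have pW0 := pW 0; have nW : n <= W by lia.
have ZW' : Z <= W by lia.
have le_mad x y x' y' k : x <= x' -> y <= y' -> x * y + k <= x' * y' + k.
  by move=> le_x le_y; rewrite leq_add2r leq_mul.
have t1 : 8 * n + 5 <= 8 * W + 5 by lia.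
have t2 := le_mad _ _ _ _ 2 uW (le_mad _ _ _ _ 8 uW (le_mad _ _ _ _ 8 uW (leqnn
  8))).
have t3 : c * (58 * dexp c + 54) + 5 <= W * (58 * W + 54) + 5 by apply: le_mad;
lia.
have t4 : dexp c * (dexp c * 7 + 8) + 2 <= W * (W * 7 + 8) + 2 by apply:
  le_mad; lia.
have t5 : c * (21 * Z + 12) + 28 * Z + 10 <= W * (21 * W + 12) + 28 * W + 10.
  by rewrite leq_add2r leq_add ?leq_mul //; lia.
have t6 : 14 * row_start c 0 + 24 * Z + 4 * dexp c + 30 <= 14 * W + 24 * W + 4
  * W + 30.
  by lia.
have t12 : H * (94 * Z + 50) + 300 * Z + 100 <= W * (94 * W + 50) + 300 * W +
  100.
  by rewrite leq_add2r leq_add ?leq_mul //; lia.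
exact: leq_add t1 (leq_add t2 (leq_add t3 (leq_add t4 (leq_add t5 (leq_add t6
  (leq_add (leqnn 2) (leq_add (leqnn _) (leq_add (leqnn _) (leq_add (leqnn _)
  (leq_add (leqnn _) t12)))))))))).
Qed.

Lemma exec_reducer (W := nb_rows c * Z) : exists2 T, exec blank reducer
    [ffun i => tape_of blank (if i == ord0 then map bit (enc_sat n F) else
      [::])]
    T (reducer_cost W + 2) &
  forall i, T (rshift nb_regs.+1 i) = tape_of blank
    (if i == ord0 then map bit (enc_qbf (red_qbf c F)) else [::]).
Proof.
have [rs [i [body]]] := triple_reducer_body.
have [T1 e1 h1] := exec_mark_regs blank bit nb_regs w (enc_sat n F).
have [T2 e2 h2] := body _ h1; have [T3 e3 h3] := exec_out_last true h2.
exists T3.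
  have -> : reducer_cost W + 2 = 1 + (reducer_cost W + 1) by lia.
  exact: exec_seqr e1 (exec_seqr e2 e3).
move=> j; rewrite h3 /=; congr (tape_of blank (if _ then _ else _)).
by rewrite enc_qbf_red.
Qed.

End Reducer.

(** * Asymptotics *)

Definition literals (n : nat) : seq literal :=
  [seq (i, b) | i <- iota 0 n, b <- [:: true; false]].

(** All lists of at most [k] literals, including those with repetitions or in another order; they
    only serve as an upper bound. *)
Fixpoint clauses_upto (n k : nat) : cnf :=
  if k is k'.+1 then
    [::] :: [seq l :: C | l <- literals n, C <- clauses_upto n k']
  else [:: [::]].

Lemma size_clauses_upto n k : 0 < size (clauses_upto n k) <= (2 * n).+1 ^ k.
Proof.
elim: k => // k /andP[gt0 le_k].
have -> : size (clauses_upto n k.+1) = (n * 2 * size (clauses_upto n k)).+1.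
  by rewrite /= size_allpairs size_allpairs size_iota.
have := leq_mul (leqnn (n * 2)) le_k; rewrite expnS (mulSn (2 * n)) [2 *
  n]mulnC.
by have := leq_trans gt0 le_k; lia.
Qed.

Lemma mem_clauses_upto n k (C : clause) : size C <= k ->
  all (fun l : literal => l.1 < n) C -> C \in clauses_upto n k.
Proof.
elim: k C => [|k IH] [|[i b] C] //= le_C /andP[lt_i lt_C].
rewrite in_cons /=; apply/allpairsP; exists ((i, b), C); split=> //=.
  by apply/allpairsP; exists (i, b); split; rewrite ?mem_iota //= !inE; case: b.
exact: IH.
Qed.

Lemma size_dcnf n F : is_dcnf 3 n F -> size F <= (2 * n).+1 ^ 3.
Proof.
case/andP=> uniq_F /allP F_ok.
have /andP[_ le3] := size_clauses_upto n 3; apply: leq_trans le3.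
apply: uniq_leq_size uniq_F _ => C /F_ok/and3P[_ size_C lt_C].
exact: mem_clauses_upto.
Qed.

Lemma leq_expl m n e : m <= n -> m ^ e <= n ^ e.
Proof. by case: e => // e; rewrite leq_exp2r. Qed.

(** With [x.+1] as the base, exponents can be raised even at 0, so sums and products stay in this
    form. *)
Definition polynomial (f : nat -> nat) : Prop :=
  exists k d, forall x, f x <= k * x.+1 ^ d.

Lemma polynomial_const a : polynomial (fun=> a).
Proof. by exists a, 0 => x; rewrite muln1. Qed.

Lemma polynomial_id : polynomial id.
Proof. by exists 1, 1 => x; rewrite mul1n expn1. Qed.

Lemma polynomial_add f g : polynomial f -> polynomial g ->
  polynomial (fun x => f x + g x).
Proof.
move=> [k [d fk]] [k' [d' gk]]; exists (k + k'), (d + d') => x.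
rewrite mulnDl leq_add //.
  by apply: leq_trans (fk x) _; apply: leq_mul => //;
  apply: leq_pexp2l (leq_addr _ _).
by apply: leq_trans (gk x) _; apply: leq_mul => //;
apply: leq_pexp2l (leq_addl _ _).
Qed.

Lemma polynomial_mul f g : polynomial f -> polynomial g ->
  polynomial (fun x => f x * g x).
Proof.
move=> [k [d fk]] [k' [d' gk]]; exists (k * k'), (d + d') => x.
by rewrite expnD mulnACA leq_mul.
Qed.

Lemma polynomial_reducer_cost : polynomial reducer_cost.
Proof.
rewrite /reducer_cost /level_cost /side_cost /idx_cost /top_cost /emit_cost.
have polyS f : polynomial f -> polynomial (fun x => (f x).+1).
  move=> pf; have [k [d h]] := polynomial_add pf (polynomial_const 1).
  by exists k, d => x; rewrite -addn1.
repeat match goal with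
| |- polynomial (fun=> ?a) => exact: polynomial_const
| |- polynomial (fun x => x) => exact: polynomial_id
| |- polynomial (fun x => @?f x + @?g x) => apply: (@polynomial_add f g)
| |- polynomial (fun x => @?f x * @?g x) => apply: (@polynomial_mul f g)
| |- polynomial (fun x => (@?f x).+1) => apply: (polyS f)
end.
Qed.

(** Functions of order at most the square root of n are o(n); comparing squares avoids taking
    roots. *)
Lemma little_o_sqrt h m N : (forall n, N <= n -> h n ^ 2 <= m * n.+2) ->
  is_little_o h.
Proof.
(* The last 1 gives [n.+2 <= 3 * n], and the middle term then bounds [c ^ 2 * m * (3 * n)] by
   [n ^ 2]. *)
move=> le_h c; exists (N + 3 * c ^ 2 * m + 1) => n le_n.
rewrite -(leq_exp2r _ _ (isT : 0 < 2)) expnMn.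
apply: (@leq_trans (c ^ 2 * (m * n.+2))).
  by rewrite leq_mul2l le_h ?orbT //; lia.
apply: (@leq_trans (3 * c ^ 2 * m * n)); last first.
  by rewrite expnS expn1 leq_mul2r; apply/orP; right; lia.
have le3 : n.+2 <= 3 * n by lia.
rewrite mulnA (_ : 3 * c ^ 2 * m * n = c ^ 2 * m * (3 * n)); last by lia.
by rewrite leq_mul2l le3 orbT.
Qed.

Lemma little_o_add f g : is_little_o f -> is_little_o g ->
  is_little_o (fun n => f n + g n).
Proof.
move=> of_ og c; have [N fN] := of_ (2 * c); have [N' gN] := og (2 * c).
exists (N + N') => n le_n; have := fN n; have := gN n; lia.
Qed.

Lemma little_o_scale f d : is_little_o f -> is_little_o (fun n => d * f n).
Proof.
move=> of_ c; have [N fN] := of_ (c * d); exists N => n le_n.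
by rewrite mulnA fN.
Qed.

Lemma little_o_le f g N : (forall n, N <= n -> f n <= g n) -> is_little_o g ->
  is_little_o f.
Proof.
move=> le_fg og c; have [N' gN] := og c; exists (N + N') => n le_n.
apply: leq_trans (gN n _); last by lia.
by rewrite leq_mul2l le_fg ?orbT //; lia.
Qed.

Lemma little_o_log : is_little_o (fun n => up_log 2 n.+2).
Proof.
(* The 8 is the factor 4 in [k ^ 2 <= 4 * 2 ^ k] times the 2 lost by rounding the logarithm up. *)
apply: (@little_o_sqrt _ 8 0) => n _; set L := up_log 2 n.+2.
have sq k : k ^ 2 <= 4 * 2 ^ k.
  elim: k => // -[|[|[|k]]] // IH; rewrite (expnS 2).
  have : 3 * k.+3 <= k.+3 * k.+3 by rewrite leq_mul2r.
  by rewrite -[k.+4 ^ 2]mulnn -[k.+3 ^ 2]mulnn in IH *; lia.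
have : 2 ^ L.-1 < n.+2 by have /andP[] := up_log_bounds (isT : 1 < 2) (isT : 1
  < n.+2).
have L_gt0 : 0 < L by rewrite up_log_gt0.
have e : 2 ^ L = 2 * 2 ^ L.-1 by rewrite -expnS prednK.
by have := sq L; rewrite e; lia.
Qed.

(** The constant absorbs the finitely many small arguments: the estimate is applied at
    [out_exists n], which is only bounded from above. *)
Lemma little_o_shift f k : is_little_o f -> exists m, forall x, k * f x <= x +
  m.
Proof.
move=> of_; have [N fN] := of_ k; exists (\sum_(x < N) k * f x) => x.
have [lt_xN|le_Nx] := ltnP x N; last by apply: leq_trans (fN x le_Nx) (leq_addr
  _ _).
by rewrite (bigD1 (Ordinal lt_xN)) //=; lia.
Qed.

(** The cube bounds the number of clauses. It is doubled because [dexp_sum c <= 2 * dexp c]: once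
    the sum reaches it, [dexp c] is at least the cube. *)
Definition clause_bound (n : nat) : nat := 2 * (2 * n).+1 ^ 3.

Lemma dexp_sum_ge m : m <= dexp_sum m.
Proof. by elim: m => // m IH; rewrite dexp_sumS -addn1 leq_add ?dexp_gt0. Qed.

Lemma dexp_sum_le m : dexp_sum m <= 2 * dexp m.
Proof.
elim: m => // m IH; rewrite dexp_sumS dexpS.
have : 2 <= dexp m by apply: (leq_dexp (leq0n m)).
by nia.
Qed.

Lemma enough_dexp n : exists c, clause_bound n <= dexp_sum c.
Proof. by exists (clause_bound n); apply: dexp_sum_ge. Qed.

Definition squarings (n : nat) : nat := ex_minn (enough_dexp n).

Lemma squaringsP n (c := squarings n) :
  [/\ 0 < c, (2 * n).+1 ^ 3 <= dexp c, clause_bound n <= dexp_sum c,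
      forall j, j < c -> dexp_sum j < clause_bound n
    & width c <= clause_bound n ^ 4].
Proof.
rewrite /c /squarings; case: ex_minnP => m le_m min_m {c}.
have lt_sum j : j < m -> dexp_sum j < clause_bound n.
  by move=> lt_j; rewrite ltnNge; apply: contraL lt_j => /min_m;
  rewrite -leqNgt.
have m_gt0 : 0 < m by case: m le_m {min_m lt_sum}.
split=> //.
  by have := dexp_sum_le m; have := leq_trans le_m (dexp_sum_le m);
  rewrite /clause_bound leq_mul2l.
(* By minimality of [m]. The width is the fourth power of [dexp m.-1], since two squarings lead from
   [m.-1] to [m.+1]. *)
have le_al : dexp m.-1 <= clause_bound n.
  case: m lt_sum {le_m min_m} m_gt0 => // -[|m] lt_sum _ /=.
    by rewrite /clause_bound -[dexp 0]/(2 * 1) leq_mul2l expn_gt0.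
  by apply: leq_trans (ltnW (lt_sum _ (ltnSn _))); rewrite dexp_sumS leq_addl.
have am : dexp m = dexp m.-1 * dexp m.-1 by rewrite -dexpS prednK.
rewrite /width /height dexpS am.
have -> : clause_bound n ^ 4 = clause_bound n * clause_bound n *
    (clause_bound n * clause_bound n) by rewrite !expnS expn0; lia.
by rewrite !leq_mul.
Qed.

Definition out_size (n : nat) : nat := nb_rows (squarings n) * width (squarings
  n).

(** The prefix does not depend on the clauses, so the empty formula stands for all of them. *)
Definition out_exists (n : nat) : nat := nb_exists (red_qbf (squarings n) [::]).

Lemma clause_bound_le n : clause_bound n <= n.+2 ^ 7.
Proof.
rewrite /clause_bound (expnD n.+2 4 3); apply: (@leq_trans (2 * (2 * n.+2) ^
  3)).
  by rewrite leq_mul2l leq_exp2r //; lia.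
rewrite expnMn mulnA leq_mul2r; apply/orP; right.
by rewrite -[2 * 2 ^ 3]/(2 ^ 4) leq_exp2r.
Qed.

Lemma width_le n : width (squarings n) <= n.+2 ^ 28.
Proof.
have [_ _ _ _ le_Z] := squaringsP n; apply: leq_trans le_Z _.
by rewrite (expnM n.+2 7 4) leq_exp2r // clause_bound_le.
Qed.

(** There are at most 8 times the width many rows, and 8 is at most [n.+2 ^ 3]; the exponent is 3 +
    28 + 28. *)
Lemma out_size_le n : out_size n <= n.+2 ^ 59.
Proof.
have le_Z := width_le n; set c := squarings n in le_Z *.
have c_Z : c < width c.
  have := ltn_expl c.+1 (isT : 1 < 2); have := ltn_expl (2 ^ c.+1) (isT : 1 <
    2).
  by rewrite /width /dexp /height; lia.
apply: (@leq_trans (8 * (width c * width c))).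
  rewrite /out_size -/c mulnA leq_mul2r /nb_rows /height.
  by apply/orP; right; lia.
rewrite (expnD n.+2 3 56) leq_mul //; first by rewrite -[8]/(2 ^ 3) leq_exp2r.
by rewrite (expnD n.+2 28 28) leq_mul.
Qed.

Lemma out_size_ge n : n <= out_size n.
Proof.
have [c_gt0 le_al _ _ _] := squaringsP n.
apply: (@leq_trans (width (squarings n))); last by rewrite /out_size leq_pmull.
apply: leq_trans (leq_dexp (leqnSn _)); apply: leq_trans le_al.
by apply: (@leq_trans (2 * n).+1); [lia | rewrite -{1}[_.+1]expn1 leq_pexp2l].
Qed.

(** The number of existential variables is at most [8 * 2 ^ H], so the left side is at most the 8th
    power of the width, and 224 = 8 * 28. *)
Lemma two_exp_out_exists n : 2 ^ out_exists n <= n.+2 ^ 224.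
Proof.
have le8 : out_exists n <= _ := nb_exists_red (squarings n) [::].
apply: leq_trans (leq_pexp2l (ltn0Sn 1) le8) _.
by rewrite mulnC expnM -/(dexp _) (expnM n.+2 28 8) leq_exp2r // width_le.
Qed.

(** With [k] existential variables, [2 ^ k] is polynomial in n, so [2 ^ f k] is n^o(1); an exponent
    of 1/2 is enough here. The 448 is 2 * 224, for the square and for the degree of the
    polynomial. *)
Lemma little_o_two_exp f : is_little_o f ->
  is_little_o (fun n => 2 ^ f (out_exists n)).
Proof.
move=> of_; have [m le_m] := little_o_shift 448 of_.
apply: (@little_o_sqrt _ (2 ^ m) 0) => n _; set k := out_exists n.
rewrite -(leq_exp2r _ _ (isT : 0 < 224)) -!expnM.
rewrite (_ : f k * (2 * 224) = 448 * f k); last by lia.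
apply: leq_trans (leq_pexp2l (ltn0Sn 1) (le_m k)) _.
rewrite expnD mulnC expnMn leq_mul ?two_exp_out_exists //.
by rewrite -expnM leq_pexp2l // leq_pmulr.
Qed.

Definition reduction_time (n : nat) : nat := reducer_cost (out_size n) + 2.

Lemma little_o_log_poly g : is_poly_bounded g ->
  is_little_o (fun n => up_log 2 (reduction_time n + g (out_size n))).
Proof.
case=> e [N le_g].
have [k [d le_c]] := polynomial_add polynomial_reducer_cost (polynomial_const
  2).
(* In [A], the 1 absorbs the constant [k <= n.+2], and 60 comes from the successor of
   [out_size n]. *)
pose A := 1 + 60 * d; pose B := 59 * e.
apply: (@little_o_le _ (fun n => (A + B).+1 * up_log 2 n.+2) (N + k));
last first.
  exact/little_o_scale/little_o_log.
move=> n le_n; have [le_kn le_Nn] : k <= n.+2 /\ N <= n by lia.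
have le_V := out_size_le n; have ge_V := out_size_ge n.
have le1 : reduction_time n <= n.+2 ^ A.
  have lt_V : (out_size n).+1 <= n.+2 ^ 60.
    have := expn_gt0 n.+2 59; rewrite (expnS _ 59).
    move: (n.+2 ^ 59) le_V => y /= le_V y_gt0; lia.
  apply: leq_trans (le_c _) _; rewrite expnD expn1 expnM.
  exact: leq_mul le_kn (leq_expl _ lt_V).
have le2 : g (out_size n) <= n.+2 ^ B.
  apply: leq_trans (le_g _ (leq_trans le_Nn ge_V)) _.
  by rewrite expnM; apply: leq_expl.
apply: up_log_min => //; apply: (@leq_trans (n.+2 ^ (A + B).+1)).
  rewrite expnS; have leA : n.+2 ^ A <= n.+2 ^ (A + B) by rewrite leq_pexp2l
    ?leq_addr.
  have leB : n.+2 ^ B <= n.+2 ^ (A + B) by rewrite leq_pexp2l ?leq_addl.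
  apply: leq_trans (leq_add le1 le2) (leq_trans (leq_add leA leB) _).
  by rewrite addnn -mul2n; apply: (leq_mul (isT : 2 <= n.+2) (leqnn _)).
rewrite mulnC expnM leq_exp2r //; exact: up_logP.
Qed.

Lemma answers_within_le (M : tm) w t t' b : t <= t' ->
  answers_within M w t b -> answers_within M w t' b.
Proof.
move=> /subnK <- ans; rewrite /answers_within iterD.
by elim: (t' - t) => //= u IH; rewrite /tm_step IH.
Qed.

Theorem theorem1 :
  ETH ->
  ~ exists (M : tm) (f g : nat -> nat),
      is_little_o f /\ is_poly_bounded g /\
      forall phi : qbf, is_dqbf 4 phi ->
        answers_within M (enc_qbf phi)
          (2 ^ (2 ^ f (nb_exists phi)) * g (nb_vars phi)) (qbf_true phi).
Proof.
move=> eth [M [f [g [of_ [pg ans]]]]]; apply: eth.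
pose m : routine (tm_symbol M) (nb_regs.+1 + (tm_work M).+1) :=
  reducer (@tm_bit M) (tm_work M).
exists (then_not m), (fun n => 2 ^ f (out_exists n) +
  up_log 2 (reduction_time n + g (out_size n))); split.
  by apply: little_o_add; [apply: little_o_two_exp | apply: little_o_log_poly].
move=> n F F_3cnf; have [c_gt0 le_al le_sum lt_sum _] := squaringsP n.
set c := squarings n in c_gt0 le_al le_sum lt_sum *.
have le_u : (2 * n).+1 <= dexp c.
  by apply: leq_trans le_al; rewrite -{1}[_.+1]expn1 leq_pexp2l.
have le_n : n <= dexp c by lia.
have le_F := leq_trans (size_dcnf F_3cnf) le_al.
have ans_F := ans _ (is_dqbf_red c_gt0 F_3cnf le_n le_F).
rewrite (red_qbf_true c_gt0 F_3cnf le_n le_F) in ans_F.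
have [T exec_T T_upper] := exec_reducer (@tm_bit_inj M) (@tm_bit_blank M)
  (tm_work M) F_3cnf le_F le_u lt_sum le_sum.
have := then_notP exec_T _ ans_F; rewrite negbK => ans_N.
apply: answers_within_le (ans_N _) => [|i]; last first.
  by rewrite /tm_init ffunE; apply: T_upper.
have -> : nb_exists (red_qbf c F) = out_exists n by [].
rewrite (nb_vars_red c_gt0) -/(out_size n) -/(reduction_time n).
rewrite expnD.
(* The time of the reduction is moved into the polynomial factor, whose logarithm is the second
   summand of the exponent. *)
apply: (@leq_trans (2 ^ 2 ^ f (out_exists n) * (reduction_time n + g (out_size
  n)))).
  by rewrite mulnDr leq_add2r leq_pmull // expn_gt0.
by rewrite leq_mul2l up_logP ?orbT.
Qed.
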